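(* Let $q\in\mathbb{C}^\times$ be such that $q^2$ has multiplicative order $\ell=5$, and let $F_n$ denote the $n$-th Fibonacci number ($F_1=F_2=1$, $F_{n+2}=F_{n+1}+F_n$). (1) The dimensions of the simple $Q_n(5)$-modules are given, for $n=1,2,3,\dots$, by $$\begin{pmatrix}\ell_1(2n+1)&\ell_2(2n)\\ \ell_3(2n+1)&\ell_0(2n)\end{pmatrix}=\begin{pmatrix}2&1\\1&1\end{pmatrix}^n.$$ That is, $\ell_0(2n)=F_{2n-1}$, $\ell_2(2n)=F_{2n}$, $\ell_1(2n+1)=F_{2n+1}$ and $\ell_3(2n+1)=F_{2n}$. (2) The algebra $Q_n(5)$ is semisimple, of dimension $\dim Q_n(5)=F_{2n-1}$, for $n\ge1$.
   Context: $TL_n(q)$ is the associative unital $\mathbb{C}$-algebra with generators $f_1,\dots,f_{n-1}$ and relations $f_i^2=-(q+q^{-1})f_i$, $f_if_{i\pm1}f_i=f_i$, $f_if_j=f_jf_i$ for $|i-j|\ge 2$. Equivalently it has as basis the Temperley-Lieb diagrams $n\to n$, multiplied by stacking, each closed loop being replaced by the scalar $-(q+q^{-1})$; $f_i$ is the diagram joining the top points $i,i+1$ and the bottom points $i,i+1$, all other strings being vertical. A Temperley-Lieb diagram $t\to n$ is a planar non-crossing perfect matching (up to isotopy) of $t$ bottom points and $n$ top points; it is monic if every bottom point is joined to a top point. $\mathcal{T}(n)=\{t\in\mathbb{Z}: 0\le t\le n,\ t\equiv n \bmod 2\}$. For $t\in\mathcal{T}(n)$, the cell module $W_t(n)$ has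 basis the monic diagrams $t\to n$; $TL_n(q)$ acts by stacking on top, non-monic results being set to zero. For monic $D_1,D_2:t\to n$, let $D_1^*$ be the reflection of $D_1$ in a horizontal line; put $D_1^*D_2=(D_1,D_2)\,\mathrm{id}_t$ if $D_1^*D_2$ is a multiple of $\mathrm{id}_t$, and $(D_1,D_2)=0$ otherwise. $L_t(n)$ is the quotient of $W_t(n)$ by the radical of this bilinear form; it is a simple $TL_n(q)$-module. $\ell_t(n):=\dim L_t(n)$, with $\ell_t(n)=0$ if $t\notin\mathcal{T}(n)$. $E_4\in TL_4(q)$ is the unique non-zero idempotent with $f_iE_4=E_4f_i=0$ for $1\le i\le 3$. For $n\ge4$, $TL_4(q)\subseteq TL_n(q)$ via $f_i\mapsto f_i$, and $Q_n(5)$ is the quotient of $TL_n(q)$ by the two-sided ideal generated by $E_4$; for $n<4$, $Q_n(5)=TL_n(q)$. The simple $Q_n(5)$-modules are the $L_t(n)$ with $t\in\mathcal{T}(n)$, $t\le 3$. *)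

(* Defs.v *)
From HB Require Import structures.
From mathcomp Require Import all_boot all_order all_algebra.
From mathcomp Require Import finmap monalg.
From mathcomp Require Import boolp classical_sets reals complex.

Set Implicit Arguments.
Unset Strict Implicit.
Unset Printing Implicit Defensive.

Import GRing.Theory.
Local Open Scope ring_scope.
Local Open Scope quotient_scope.

Record submodule (K : pzRingType) (V : lmodType K) := Submodule {
  submodule_pred :> {pred V};
  submodule_closed : submod_closed submodule_pred
}.

Section ModuleQuotient.
Variables (K : pzRingType) (V : lmodType K) (U : submodule V).

HB.instance Definition _ :=
  GRing.isSubmodClosed.Build K V (submodule_pred U) (submodule_closed U).

Definition mod_quot : Type := Quotient.quot (submodule_pred U).
HB.instance Definition _ := GRing.Zmodule.on mod_quot.

Local Notation Q := (Quotient.quot (submodule_pred U)).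

Definition quot_scale (a : K) : Q -> Q := lift_op1 Q ( *:%R a).

Lemma pi_quot_scale a : {morph \pi_Q : v / a *: v >-> quot_scale a v}.
Proof.
move=> v; unlock quot_scale; apply/eqP; rewrite piE Quotient.equivE.
by rewrite -scalerBr rpredZ // Quotient.idealrBE reprK.
Qed.

Fact quot_scaleA a b x : quot_scale a (quot_scale b x) = quot_scale (a * b) x.
Proof. by rewrite -[x]reprK -!pi_quot_scale scalerA. Qed.
Fact quot_scale1 : left_id 1 quot_scale.
Proof. by move=> x; rewrite -[x]reprK -!pi_quot_scale scale1r. Qed.
Fact quot_scaleDr : right_distributive quot_scale +%R.
Proof.
move=> a x y; rewrite -[x]reprK -[y]reprK -raddfD -!pi_quot_scale.
by rewrite scalerDr raddfD.
Qed.
Fact quot_scaleDl x : {morph quot_scale^~ x : a b / a + b}.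
Proof. by move=> a b; rewrite -[x]reprK -!pi_quot_scale scalerDl raddfD. Qed.

HB.instance Definition _ := GRing.Zmodule_isLmodule.Build K mod_quot
  quot_scaleA quot_scale1 quot_scaleDr quot_scaleDl.

Definition mod_pi (v : V) : mod_quot := \pi_Q v.

Lemma mod_piB : {morph mod_pi : u v / u - v}.
Proof. by move=> u v; rewrite /mod_pi raddfB. Qed.
Lemma mod_piZ a : {morph mod_pi : v / a *: v}.
Proof. exact: pi_quot_scale. Qed.
HB.instance Definition _ := GRing.isZmodMorphism.Build V mod_quot mod_pi mod_piB.
HB.instance Definition _ :=
  GRing.isScalable.Build K V mod_quot *:%R mod_pi mod_piZ.

Lemma mod_pi_eq u v : (mod_pi u == mod_pi v) = (u - v \in submodule_pred U).
Proof. by rewrite Quotient.idealrBE. Qed.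

Definition mod_repr (x : mod_quot) : V := repr (x : Q).

Lemma mod_reprK : cancel mod_repr mod_pi.
Proof. by move=> x; rewrite /mod_pi reprK. Qed.

End ModuleQuotient.

Definition two_sided_ideal (A : pzRingType) (I : set A) : Prop :=
  [/\ I 0, forall x y, I x -> I y -> I (x + y)
    & forall a x b, I x -> I (a * x * b)].

Section AlgebraQuotient.
Variables (K : comNzRingType) (A : algType K).
Implicit Types (S : set A).

Definition ideal_gen S : {pred A} :=
  fun x => `[< smallest (@two_sided_ideal A) S x >].

Lemma ideal_gen_ideal S : two_sided_ideal (smallest (@two_sided_ideal A) S).
Proof.
split=> [I [[]]//|x y Ix Iy I hI|a x b Ix I hI].
- by case: (hI) => -[_ ID _] _; apply: ID; [apply: Ix | apply: Iy].
- by case: (hI) => -[_ _ IM] _; apply: IM; apply: Ix.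
Qed.

Lemma ideal_genE S x : reflect (smallest (@two_sided_ideal A) S x)
  (x \in ideal_gen S).
Proof. exact: asboolP. Qed.

Lemma sub_ideal_gen S x : S x -> x \in ideal_gen S.
Proof. by move=> Sx; apply/ideal_genE; apply: sub_gen_smallest. Qed.

Lemma ideal_genM S a x b : x \in ideal_gen S -> a * x * b \in ideal_gen S.
Proof.
by case: (ideal_gen_ideal S) => _ _ IM /ideal_genE Ix; apply/ideal_genE; apply: IM.
Qed.

Fact ideal_gen_closed S : submod_closed (ideal_gen S).
Proof.
case: (ideal_gen_ideal S) => I0 ID IM; split; first exact/ideal_genE.
move=> a x y Ix Iy; apply/ideal_genE; apply: ID; apply/ideal_genE => //.
by rewrite -mulr_algl -[_ * x]mulr1 ideal_genM.
Qed.

Definition ideal_submodule S : submodule A := Submodule (ideal_gen_closed S).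

(* The quotient of A by the two-sided ideal generated by S.  It may be the zero
   ring, hence only a pzRingType in general. *)
Definition alg_quot S : Type := mod_quot (ideal_submodule S).
HB.instance Definition _ S := GRing.Lmodule.on (alg_quot S).

Definition alg_pi S (x : A) : alg_quot S := mod_pi (ideal_submodule S) x.

Lemma alg_piD S : {morph alg_pi S : x y / x + y}.
Proof. by move=> x y; rewrite /alg_pi raddfD. Qed.
Lemma alg_piB S : {morph alg_pi S : x y / x - y}.
Proof. by move=> x y; rewrite /alg_pi raddfB. Qed.
Lemma alg_piZ S a : {morph alg_pi S : x / a *: x}.
Proof. by move=> x; rewrite /alg_pi linearZ. Qed.

Lemma alg_pi_eq S x y : (alg_pi S x == alg_pi S y) = (x - y \in ideal_gen S).
Proof. exact: mod_pi_eq. Qed.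

Lemma alg_pi_eq0 S x : (alg_pi S x == 0) = (x \in ideal_gen S).
Proof. by rewrite -[in RHS](subr0 x) -alg_pi_eq /alg_pi raddf0. Qed.

Definition alg_repr S (x : alg_quot S) : A :=
  @mod_repr K A (ideal_submodule S) x.

Lemma alg_reprK S : cancel (@alg_repr S) (@alg_pi S).
Proof. exact: mod_reprK. Qed.

Fact quot_mul_key : unit. Proof. by []. Qed.
Definition quot_mul S : alg_quot S -> alg_quot S -> alg_quot S :=
  locked_with quot_mul_key (fun x y => alg_pi S (alg_repr x * alg_repr y)).

Lemma alg_pi_mul S : {morph alg_pi S : x y / x * y >-> quot_mul x y}.
Proof.
move=> x y; apply/eqP; rewrite /quot_mul unlock alg_pi_eq.
set x' := alg_repr _; set y' := alg_repr _.
have Ix : x - x' \in ideal_gen S by rewrite -alg_pi_eq alg_reprK.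
have Iy : y - y' \in ideal_gen S by rewrite -alg_pi_eq alg_reprK.
have -> : x * y - x' * y' = 1 * (x - x') * y + x' * (y - y') * 1.
  by rewrite mul1r mulr1 mulrBl mulrBr addrA subrK.
case: (ideal_gen_ideal S) => _ ID _; apply/ideal_genE; apply: ID; apply/ideal_genE.
  exact: ideal_genM.
exact: ideal_genM.
Qed.

Fact quot_mulA S : associative (@quot_mul S).
Proof.
move=> x y z; rewrite -[x]alg_reprK -[y]alg_reprK -[z]alg_reprK.
by rewrite -!alg_pi_mul mulrA.
Qed.
Fact quot_mul1x S : left_id (alg_pi S 1) (@quot_mul S).
Proof. by move=> x; rewrite -[x]alg_reprK -alg_pi_mul mul1r. Qed.
Fact quot_mulx1 S : right_id (alg_pi S 1) (@quot_mul S).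
Proof. by move=> x; rewrite -[x]alg_reprK -alg_pi_mul mulr1. Qed.
Fact quot_mulDl S : left_distributive (@quot_mul S) +%R.
Proof.
move=> x y z; rewrite -[x]alg_reprK -[y]alg_reprK -[z]alg_reprK.
by rewrite -alg_piD -!alg_pi_mul mulrDl alg_piD.
Qed.
Fact quot_mulDr S : right_distributive (@quot_mul S) +%R.
Proof.
move=> x y z; rewrite -[x]alg_reprK -[y]alg_reprK -[z]alg_reprK.
by rewrite -alg_piD -!alg_pi_mul mulrDr alg_piD.
Qed.

HB.instance Definition _ S := GRing.Zmodule_isPzRing.Build (alg_quot S)
  (@quot_mulA S) (@quot_mul1x S) (@quot_mulx1 S) (@quot_mulDl S)
  (@quot_mulDr S).

Fact alg_pi_is_monoid_morphism S : monoid_morphism (alg_pi S).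
Proof. by split=> [|x y]; last exact: alg_pi_mul. Qed.

HB.instance Definition _ S := GRing.isZmodMorphism.Build A (alg_quot S)
  (alg_pi S) (@alg_piB S).
HB.instance Definition _ S := GRing.isMonoidMorphism.Build A (alg_quot S)
  (alg_pi S) (alg_pi_is_monoid_morphism S).
HB.instance Definition _ S := GRing.isScalable.Build K A (alg_quot S) *:%R
  (alg_pi S) (@alg_piZ S).

Lemma alg_quot_scaleAl S a (x y : alg_quot S) : a *: (x * y) = a *: x * y.
Proof.
rewrite -[x]alg_reprK -[y]alg_reprK -rmorphM -!alg_piZ -rmorphM.
by rewrite scalerAl.
Qed.
Lemma alg_quot_scaleAr S a (x y : alg_quot S) : a *: (x * y) = x * (a *: y).
Proof.
rewrite -[x]alg_reprK -[y]alg_reprK -rmorphM -!alg_piZ -rmorphM.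
by rewrite scalerAr.
Qed.

Section Lift.
Variables (B : algType K) (g : {lrmorphism A -> B}) (S : set A).

Definition alg_lift (x : alg_quot S) : B := g (alg_repr x).

Hypothesis gS : forall s, S s -> g s = 0.

Lemma lift_ideal x : x \in ideal_gen S -> g x = 0.
Proof.
move/ideal_genE/(_ [set y | g y = 0]%classic); apply; split=> //.
split=> [|u v /= gu gv|a u b /= gu]; first exact: rmorph0.
- by rewrite rmorphD /= gu gv addr0.
- by rewrite !rmorphM /= gu mulr0 mul0r.
Qed.

Lemma alg_lift_pi x : alg_lift (alg_pi S x) = g x.
Proof.
apply/eqP; rewrite /alg_lift -subr_eq0 -rmorphB; apply/eqP/lift_ideal.
by rewrite -alg_pi_eq alg_reprK.
Qed.

Fact alg_lift_zmod : zmod_morphism alg_lift.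
Proof.
move=> x y; rewrite -[x]alg_reprK -[y]alg_reprK -rmorphB.
by rewrite !alg_lift_pi rmorphB.
Qed.
Fact alg_lift_monoid : monoid_morphism alg_lift.
Proof.
split=> [|x y]; first by rewrite -(rmorph1 (alg_pi S)) alg_lift_pi rmorph1.
rewrite -[x]alg_reprK -[y]alg_reprK -rmorphM.
by rewrite !alg_lift_pi rmorphM.
Qed.
Fact alg_lift_scalable : scalable alg_lift.
Proof.
by move=> a x; rewrite -[x]alg_reprK -linearZ !alg_lift_pi linearZ.
Qed.

End Lift.
End AlgebraQuotient.

Section FreeAlgebra.
Variables (K : fieldType) (k : nat).

Definition free_alg : Type := {malg K[{fmonom 'I_k}]}.

HB.instance Definition _ := GRing.Lmodule.on free_alg.

(* The product of {malg K[{fmonom 'I_k}]}, locked so that unification does not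
   unfold it. *)
Fact free_mul_key : unit. Proof. by []. Qed.
Definition free_mul : free_alg -> free_alg -> free_alg :=
  locked_with free_mul_key (fun x y : {malg K[{fmonom 'I_k}]} => x * y).

Lemma free_mul_malg (x y : {malg K[{fmonom 'I_k}]}) : free_mul x y = x * y.
Proof. by rewrite /free_mul unlock. Qed.

Fact free_mulA : associative free_mul.
Proof. by move=> x y z; rewrite !free_mul_malg mulrA. Qed.
Fact free_mul1x : left_id (1 : {malg K[{fmonom 'I_k}]}) free_mul.
Proof. by move=> x; rewrite free_mul_malg mul1r. Qed.
Fact free_mulx1 : right_id (1 : {malg K[{fmonom 'I_k}]}) free_mul.
Proof. by move=> x; rewrite free_mul_malg mulr1. Qed.
Fact free_mulDl : left_distributive free_mul +%R.
Proof. by move=> x y z; rewrite !free_mul_malg mulrDl. Qed.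
Fact free_mulDr : right_distributive free_mul +%R.
Proof. by move=> x y z; rewrite !free_mul_malg mulrDr. Qed.

HB.instance Definition _ := GRing.Zmodule_isNzRing.Build free_alg
  free_mulA free_mul1x free_mulx1 free_mulDl free_mulDr
  (oner_neq0 {malg K[{fmonom 'I_k}]}).

Lemma free_mulE (x y : free_alg) :
  x * y = (x : {malg K[{fmonom 'I_k}]}) * (y : {malg K[{fmonom 'I_k}]}).
Proof. exact: free_mul_malg. Qed.

Fact free_alg_scaleAl (a : K) (x y : free_alg) :
  a *: free_mul x y = free_mul (a *: x) y.
Proof. by rewrite !free_mul_malg; apply: scalerAl. Qed.

HB.instance Definition _ :=
  GRing.Lmodule_isLalgebra.Build K free_alg free_alg_scaleAl.

Fact free_alg_scaleAr (a : K) (x y : free_alg) :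
  a *: free_mul x y = free_mul x (a *: y).
Proof.
rewrite !free_mul_malg; apply/malgP => w; rewrite mcoeffZ.
have le_refl (d : {fset {fmonom 'I_k}}) : (d `<=` d)%fset by [].
transitivity (a * \sum_(u <- msupp x) \sum_(v <- msupp y)
                (x@_u * y@_v) *+ (mmul u v == w)).
  by congr (a * _); apply: mcoeffMlw; apply: le_refl.
transitivity (\sum_(u <- msupp x) \sum_(v <- msupp y)
                (x@_u * (a *: y)@_v) *+ (mmul u v == w)); last first.
  by symmetry; apply: mcoeffMlw; [apply: le_refl | apply: msuppZ_le].
rewrite mulr_sumr; apply: eq_bigr => v _; rewrite mulr_sumr.
by apply: eq_bigr => u _; rewrite mcoeffZ -!mulrnAr mulrCA !mulrnAr.
Qed.

HB.instance Definition _ :=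
  GRing.Lalgebra_isAlgebra.Build K free_alg free_alg_scaleAr.

(* Locked: unification must not unfold products of generators. *)
Fact free_gen_key : unit. Proof. by []. Qed.
Definition free_gen : 'I_k -> free_alg :=
  locked_with free_gen_key (fun i => << fmu i >>).

Lemma free_genE i : free_gen i = << fmu i >>.
Proof. by rewrite /free_gen unlock. Qed.

Section Eval.
Variables (B : algType K) (b : 'I_k -> B).

Definition word_eval (w : {fmonom 'I_k}) : B := \prod_(i <- (w : seq _)) b i.

Fact word_eval_mmorphism : mmorphism word_eval.
Proof.
split=> [v w|]; last by rewrite /word_eval fm1 big_nil.
by rewrite /word_eval fmM big_cat.
Qed.

HB.instance Definition _ := isMultiplicative.Build _ _ word_eval
  word_eval_mmorphism.

Definition free_eval (x : free_alg) : B := mmap (in_alg B) word_eval x.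

Fact free_eval_zmod : zmod_morphism free_eval.
Proof. exact: raddfB. Qed.
Fact free_eval_monoid : monoid_morphism free_eval.
Proof.
have [gM g1] : multiplicative
    (mmap (in_alg B) word_eval : {malg K[{fmonom 'I_k}]} -> B).
  apply: commr_mmap_is_multiplicative => x v w.
  by rewrite /GRing.comm mulr_algl mulr_algr.
by split=> // x y; rewrite free_mulE; apply: gM.
Qed.
Fact free_eval_scalable : scalable free_eval.
Proof. by move=> a x; rewrite /free_eval mmapZ /= mulr_algl. Qed.

HB.instance Definition _ := GRing.isZmodMorphism.Build free_alg B free_eval
  free_eval_zmod.
HB.instance Definition _ := GRing.isMonoidMorphism.Build free_alg B free_eval
  free_eval_monoid.
HB.instance Definition _ := GRing.isScalable.Build K free_alg B *:%R free_eval
  free_eval_scalable.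

Lemma free_eval_gen i : free_eval (free_gen i) = b i.
Proof.
rewrite free_genE /free_eval mmapU /= scale1r mul1r /word_eval fmU.
by rewrite big_seq1.
Qed.

End Eval.
End FreeAlgebra.

Section TemperleyLieb.
Variables (K : fieldType) (q : K).

(* Indices are shifted: the generator f_i (1 <= i <= n - 1) has index i - 1. *)
Definition TL_relators (n : nat) : set (free_alg K n.-1) :=
  let x := @free_gen K n.-1 in
  [set r | [\/ exists i, r = x i * x i - (- (q + q^-1)) *: x i,
               exists i j : 'I_n.-1, ((i.+1 == j) || (j.+1 == i)) /\
                                     r = x i * x j * x i - x i
             | exists i j : 'I_n.-1, ((i.+1 < j) || (j.+1 < i))%N /\
                                     r = x i * x j - x j * x i]]%classic.

Arguments TL_relators n _ : clear implicits.

Definition TL (n : nat) : Type := alg_quot (TL_relators n).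
HB.instance Definition _ n := GRing.PzRing.on (TL n).
HB.instance Definition _ n := GRing.Lmodule.on (TL n).

Definition TL_gen n (i : 'I_n.-1) : TL n :=
  alg_pi (TL_relators n) (free_gen K i).

Lemma TL_relators_vanish n (B : algType K)
    (g : {lrmorphism free_alg K n.-1 -> B}) (b : 'I_n.-1 -> B) :
  (forall i, g (free_gen K i) = b i) ->
  (forall i, b i * b i = - (q + q^-1) *: b i) ->
  (forall i j : 'I_n.-1, (i.+1 == j) || (j.+1 == i) -> b i * b j * b i = b i) ->
  (forall i j : 'I_n.-1, (i.+1 < j)%N || (j.+1 < i)%N ->
     b i * b j = b j * b i) ->
  forall r, TL_relators n r -> g r = 0.
Proof.
move=> gb b_sq b_adj b_comm r.
have gM x y : g (x * y) = g x * g y by exact: rmorphM.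
have gB x y : g (x - y) = g x - g y by exact: rmorphB.
have gZ a x : g (a *: x) = a *: g x by exact: linearZ.
case=> [[i ->]|[i [j [ij ->]]]|[i [j [ij ->]]]].
- by rewrite gB gM gZ gb b_sq subrr.
- by rewrite gB !gM !gb b_adj ?subrr.
- by rewrite gB !gM !gb b_comm ?subrr.
Qed.

Fact TL_oner_neq0 n : (1 : TL n) != 0.
Proof.
pose g : {lrmorphism free_alg K n.-1 -> K^o} :=
  @free_eval K n.-1 K^o (fun=> 0).
have gS : forall r, TL_relators n r -> g r = 0.
  apply: (@TL_relators_vanish _ _ _ (fun=> 0)) => [i|i|i j _|i j _].
  - exact: free_eval_gen.
  - by rewrite mulr0 scaler0.
  - by rewrite mulr0.
  - by [].
apply/negP; rewrite -(rmorph1 (alg_pi (TL_relators n))) alg_pi_eq0.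
by move/(lift_ideal gS)/eqP; rewrite rmorph1 oner_eq0.
Qed.

HB.instance Definition _ n :=
  GRing.PzSemiRing_isNonZero.Build (TL n) (TL_oner_neq0 n).
HB.instance Definition _ n := GRing.Lmodule_isLalgebra.Build K (TL n)
  (@alg_quot_scaleAl _ _ (TL_relators n)).
HB.instance Definition _ n := GRing.Lalgebra_isAlgebra.Build K (TL n)
  (@alg_quot_scaleAr _ _ (TL_relators n)).

Lemma TL_relator0 n r : TL_relators _ r -> alg_pi (TL_relators n) r = 0.
Proof. by move=> Sr; apply/eqP; rewrite alg_pi_eq0 sub_ideal_gen. Qed.

Lemma TL_gen_sq n (i : 'I_n.-1) :
  TL_gen i * TL_gen i = - (q + q^-1) *: TL_gen i.
Proof.
apply/eqP; rewrite -subr_eq0 -alg_piZ -rmorphM -alg_piB; apply/eqP.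
by apply: TL_relator0; constructor 1; exists i.
Qed.

Lemma TL_gen_adj n (i j : 'I_n.-1) : (i.+1 == j) || (j.+1 == i) ->
  TL_gen i * TL_gen j * TL_gen i = TL_gen i.
Proof.
move=> ij; apply/eqP; rewrite -subr_eq0 -!rmorphM -alg_piB; apply/eqP.
by apply: TL_relator0; constructor 2; exists i, j.
Qed.

Lemma TL_gen_comm n (i j : 'I_n.-1) : (i.+1 < j)%N || (j.+1 < i)%N ->
  TL_gen i * TL_gen j = TL_gen j * TL_gen i.
Proof.
move=> ij; apply/eqP; rewrite -subr_eq0 -!rmorphM -alg_piB; apply/eqP.
by apply: TL_relator0; constructor 3; exists i, j.
Qed.

Section Inclusion.
Variables (m n : nat) (le_mn : (m <= n)%N).

Fact leq_pred2 : (m.-1 <= n.-1)%N.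
Proof. by rewrite -!subn1 leq_sub2r. Qed.

Definition TL_incl_free : free_alg K m.-1 -> TL n :=
  free_eval (fun i => TL_gen (widen_ord leq_pred2 i)).

HB.instance Definition _ := GRing.LRMorphism.on TL_incl_free.

(* The morphism TL_m -> TL_n with f_i |-> f_i. *)
Definition TL_incl : TL m -> TL n :=
  @alg_lift K (free_alg K m.-1) (TL n) TL_incl_free (TL_relators m).

Fact TL_incl_relators r : TL_relators _ r -> TL_incl_free r = 0.
Proof.
move: r.
apply: (TL_relators_vanish (b := fun i => TL_gen (widen_ord leq_pred2 i))).
- by move=> i; exact: free_eval_gen.
- by move=> i; exact: TL_gen_sq.
- by move=> i j ij; apply: TL_gen_adj; exact: ij.
- by move=> i j ij; apply: TL_gen_comm; exact: ij.
Qed.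

HB.instance Definition _ := GRing.isZmodMorphism.Build (TL m) (TL n) TL_incl
  (alg_lift_zmod TL_incl_relators).
HB.instance Definition _ := GRing.isMonoidMorphism.Build (TL m) (TL n) TL_incl
  (alg_lift_monoid TL_incl_relators).
HB.instance Definition _ := GRing.isScalable.Build K (TL m) (TL n) *:%R TL_incl
  (alg_lift_scalable TL_incl_relators).

Lemma TL_incl_gen i : TL_incl (TL_gen i) = TL_gen (widen_ord leq_pred2 i).
Proof.
rewrite /TL_incl /TL_gen (alg_lift_pi TL_incl_relators).
exact: free_eval_gen.
Qed.

End Inclusion.

Definition is_E4 (E : TL 4) : Prop :=
  [/\ E != 0, E * E = E
    & forall i : 'I_3, @TL_gen 4 i * E = 0 /\ E * @TL_gen 4 i = 0].

Definition E4 : TL 4 := xget 0 [set E | is_E4 E]%classic.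

(* For n < 4 the generating set is empty and Q5 n is TL n modulo 0. *)
Definition Q5 (n : nat) : Type :=
  alg_quot [set x : TL n | exists h : (4 <= n)%N, x = TL_incl h E4]%classic.
HB.instance Definition _ n := GRing.PzRing.on (Q5 n).
HB.instance Definition _ n := GRing.Lmodule.on (Q5 n).

End TemperleyLieb.

(* A diagram t -> n is encoded by the map sending each boundary point to its
   partner; inl i is the i-th bottom point and inr j the j-th top point, both
   counted from the left. *)
Definition boundary (t n : nat) : Type := ('I_t + 'I_n)%type.
HB.instance Definition _ t n := Finite.on (boundary t n).

Definition matching (t n : nat) := {ffun boundary t n -> boundary t n}.

(* Position when walking along the boundary of the strip: the bottom points
   from left to right, then the top points from right to left. *)
Definition boundary_pos t n (x : boundary t n) : nat :=
  match x with inl i => i | inr j => (t + rev_ord j)%N end.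

Definition crossing t n (D : matching t n) (x y : boundary t n) : bool :=
  [&& boundary_pos x < boundary_pos y,
      boundary_pos y < boundary_pos (D x)
    & boundary_pos (D x) < boundary_pos (D y)]%N.

Definition is_TL_diagram t n (D : matching t n) : bool :=
  [&& [forall x, D (D x) == x], [forall x, D x != x]
    & [forall x, forall y, ~~ crossing D x y]].

Definition is_top t n (x : boundary t n) : bool :=
  if x is inr _ then true else false.

Definition is_monic t n (D : matching t n) : bool :=
  [forall i : 'I_t, is_top (D (inl i))].

Definition monic_diagram (t n : nat) : Type :=
  {D : matching t n | is_TL_diagram D && is_monic D}.
HB.instance Definition _ t n := Finite.on (monic_diagram t n).

Definition flip t n (x : boundary t n) : boundary n t :=
  match x with inl i => inr i | inr j => inl j end.

Definition reflect_diagram t n (D : matching t n) : matching n t :=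
  [ffun x => flip (D (flip x))].

Definition id_diagram t : matching t t := [ffun x => flip x].

Section Stacking.
Variables (m n p : nat) (D2 : matching n p) (D1 : matching m n).

(* Bottom, middle and top points of the picture with D2 on top of D1. *)
Definition stack_point : Type := ('I_m + 'I_n + 'I_p)%type.
HB.instance Definition _ := Finite.on stack_point.

Definition lower_point (x : boundary m n) : stack_point := inl x.
Definition upper_point (x : boundary n p) : stack_point :=
  match x with inl j => inl (inr j) | inr k => inr k end.
Definition outer_point (x : boundary m p) : stack_point :=
  match x with inl i => inl (inl i) | inr k => inr k end.
Definition middle_point (j : 'I_n) : stack_point := inl (inr j).

Definition stack_edge : rel stack_point := fun u v =>
  [exists x, (u == lower_point x) && (v == lower_point (D1 x))]
  || [exists x, (u == upper_point x) && (v == upper_point (D2 x))].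

Definition stack_matching : matching m p :=
  [ffun x => odflt x
    [pick y | (y != x) && connect stack_edge (outer_point x) (outer_point y)]].

Definition stack_loops : nat :=
  #|[set C in equivalence_partition (connect stack_edge) [set: stack_point]
    | C \subset [set middle_point j | j : 'I_n]]|.

End Stacking.

Section CellModules.
Variables (K : fieldType) (q : K) (t n : nat).

(* (D1, D2) = delta^(number of loops) if the underlying diagram of D1^* D2 is
   id_t, and 0 otherwise, with delta = - (q + q^-1). *)
Definition gram (D1 D2 : monic_diagram t n) : K :=
  let D1s := reflect_diagram (val D1) in
  if stack_matching D1s (val D2) == id_diagram t
  then (- (q + q^-1)) ^+ stack_loops D1s (val D2) else 0.

Definition cell_module : Type := {ffun monic_diagram t n -> K^o}.
HB.instance Definition _ := GRing.Lmodule.on cell_module.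

Definition cell_form (u v : cell_module) : K :=
  \sum_D1 \sum_D2 (u D1 : K) * v D2 * gram D1 D2.

Definition cell_radical : {pred cell_module} :=
  fun u => `[< forall v, cell_form u v = 0 >].

Fact cell_radical_closed : submod_closed cell_radical.
Proof.
split=> [|a u v /asboolP u0 /asboolP v0]; apply/asboolP => w.
  by rewrite /cell_form big1 // => D1 _; rewrite big1 // => D2 _; rewrite ffunE !mul0r.
have -> : cell_form (a *: u + v) w = a * cell_form u w + cell_form v w.
  rewrite /cell_form mulr_sumr -big_split; apply: eq_bigr => D1 _ /=.
  rewrite mulr_sumr -big_split; apply: eq_bigr => D2 _ /=.
  by rewrite !ffunE !mulrDl !mulrA.
by rewrite u0 v0 mulr0 addr0.
Qed.

(* The underlying vector space of L_t(n). *)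
Definition cell_head : Type := mod_quot (Submodule cell_radical_closed).
HB.instance Definition _ := GRing.Lmodule.on cell_head.

End CellModules.

(* 0 if V is not finite-dimensional. *)
Definition dimension (K : fieldType) (V : lmodType K) : nat :=
  xget 0%N [set d | $|Vector.axiom d V|]%classic.

Definition cell_index (t n : nat) : bool := (t <= n)%N && (odd t == odd n).

Definition ell (K : fieldType) (q : K) (t n : nat) : nat :=
  if cell_index t n then dimension (cell_head q t n) else 0%N.

Definition simple_submodule (R : pzRingType) (V : lmodType R)
    (U : submodule V) : Prop :=
  (exists2 u, u \in submodule_pred U & u != 0) /\
  forall W : submodule V, {subset submodule_pred W <= submodule_pred U} ->
    (forall w, w \in submodule_pred W -> w = 0) \/
    {subset submodule_pred U <= submodule_pred W}.

(* The left regular module is a direct sum of simple submodules; as it is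
   generated by 1, finitely many of them suffice. *)
Definition semisimple_ring (A : pzRingType) : Prop :=
  exists (m : nat) (U : 'I_m -> submodule (A^o : lmodType A)),
    (forall i, simple_submodule (U i)) /\
    forall x : A^o, exists! u : {ffun 'I_m -> A^o},
      (forall i, u i \in submodule_pred (U i)) /\ x = \sum_i u i.

Fixpoint fib (n : nat) : nat :=
  match n with
  | 0 => 0
  | 1 => 1
  | (m.+1 as k).+1 => fib k + fib m
  end%N.

Definition mx2 (T : Type) (a b c d : T) : 'M[T]_2 :=
  \matrix_(i, j) if i == 0 then (if j == 0 then a else b)
                 else (if j == 0 then c else d).

(* Main.v *)
From HB Require Import structures.
Require Import Defs.
From mathcomp Require Import finmap monalg boolp classical_sets reals complex.
From mathcomp Require Import all_boot all_order all_algebra.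
From mathcomp Require Import ring zify.

(** A diagram t -> n is a word in cups, and both the Gram form on W_t(n) and a
  natural form on the functions on paths 0 -> t of length n on the Dynkin diagram
  A_4 (vertices 0, 1, 2, 3) are evaluated on words by the same rules, because cups
  and caps on the two sides are adjoint and obey the same relations.  On paths
  the form is diagonal with entries products of inverse quantum dimensions
  d_0, ..., d_3, which are non-zero, while d_4 = 0 makes the loop relation hold
  at vertex 3.  A function killed by all caps vanishes, so the words span, and
  l_t(n) is the number of paths.

  The same operators represent TL_n on paths of length n.  They kill E_4 and
  produce every matrix unit between paths with a common endpoint.  Conversely
  E_4 = 0 rewrites f_2 f_1 f_3 f_2, so Q_n is spanned by the F_{2n-1} words using
  each generator at most once; as the squared path numbers also add up to
  F_{2n-1}, Q_n is a product of matrix algebras. *)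

Set Implicit Arguments.
Unset Strict Implicit.
Unset Printing Implicit Defensive.

Import GRing.Theory.

(** * Paths on the graph 0 - 1 - 2 - 3 *)

(** The first claim is treated entirely with diagrams and their Gram form, the second entirely with
    generators and relations; the operators on paths are the only link. The arithmetic of q enters
    them through delta^4 - 3 delta^2 + 1 = 0 with delta = -(q + q^-1). This is d_4 = 0 for the
    Chebyshev recursion d_0 = 1, d_1 = delta, d_{a+1} = delta d_a - d_{a-1}, whose solution is the
    quantum integer [a+1] up to sign. Since K carries no order, non-degeneracy of the path form
    cannot come from positivity; it comes from its diagonal shape. Cups carry a factor d_b and caps
    a factor 1/d_a, and the weights in the form restore adjointness, so no square roots of the d_a
    occur. For the quotient, the relation E_4 = 0 is given only on the first four strands. The
    elements 1 + q f are invertible, and products of them conjugate each generator to the next,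
    which transports the relation along the strands. The upper bound from the spanning words and the
    lower bound from the matrix units then coincide, and this equality makes the path representation
    faithful on the quotient. *)

Definition nbrs (a : nat) : seq nat :=
  match a with
  | 0 => [:: 1] | 1 => [:: 0; 2] | 2 => [:: 1; 3] | 3 => [:: 2] | _ => [::]
  end%N.

(** A path is stored without its starting vertex [a]: its length is its number of steps and its end
    is [last a p]. *)
Definition vpath (a : nat) (p : seq nat) : bool :=
  path (fun x y => y \in nbrs x) a p.

Fixpoint paths (a n : nat) : seq (seq nat) :=
  if n is m.+1 then [seq b :: p | b <- nbrs a, p <- paths b m] else [:: [::]].

Lemma nbrsP a b : b \in nbrs a -> [/\ (a < 4)%N, (b < 4)%N & a \in nbrs b].
Proof. by case: a => [|[|[|[|a]]]]; case: b => [|[|[|[|b]]]]. Qed.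

Lemma nbrs_uniq a : uniq (nbrs a).
Proof. by case: a => [|[|[|[|a]]]]. Qed.

Lemma paths_uniq a n : uniq (paths a n).
Proof.
elim: n a => [|n IH] a //=; apply: allpairs_uniq_dep => //.
- exact: nbrs_uniq.
- by move=> [b p] [b' p'] _ _ /= [-> ->].
Qed.

Lemma mem_paths a n p : (p \in paths a n) = (size p == n) && vpath a p.
Proof.
elim: n a p => [|n IH] a [|b p] //=.
- by apply/negbTE/negP => /allpairsPdep [x [y [_ _]]].
- rewrite eqSS; apply/allpairsPdep/idP => [[x [y [xa yp [-> ->]]]]|].
  + by move: yp; rewrite IH xa => /andP[-> ->].
  + by case/and3P=> sp ba vp; exists b, p; rewrite IH sp ba vp.
Qed.

Arguments paths : simpl never.

Lemma last_iota1 j : last 0%N (iota 1 j) = j.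
Proof. by case: j => // j; rewrite -[X in iota _ X]addn1 iotaD last_cat /= add1n. Qed.

Lemma nbrs_cases a b : b \in nbrs a -> b = a.+1 \/ a = b.+1.
Proof.
by case: a => [|[|[|[|a]]]] //; rewrite !inE; do ?case/orP; move/eqP->; auto.
Qed.

Lemma last_vpath a p : vpath a p -> odd (last a p) = odd (a + size p) /\
  (last a p <= a + size p)%N.
Proof.
elim: p a => [|b p IH] a /=; first by rewrite addn0.
case/andP=> /nbrs_cases[->|->] /IH[-> le]; rewrite addnS ?addSn /= ?negbK; split=> //.
by apply: leq_trans le _; lia.
Qed.

Lemma vpath_lt4 a p : (a < 4)%N -> vpath a p -> (last a p < 4)%N.
Proof. by elim: p a => //= b p IH a _ /andP[/nbrsP[_ b4 _] /IH]; apply. Qed.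

Lemma path_exists t k : (t < 4)%N -> (t <= k)%N -> odd t = odd k ->
  exists2 r, r \in paths 0 k & last 0%N r = t.
Proof.
(* The witness oscillates h times between 0 and 1, then climbs straight to t; parity makes the
   excess k - t even. *)
move=> t4 tk otk; pose r h := flatten (nseq h [:: 1; 0]%N) ++ iota 1 t.
have rP h : [/\ vpath 0 (r h), size (r h) = (h.*2 + t)%N & last 0%N (r h) = t].
  elim: h => [|h [v s l]].
    by rewrite /r /= size_iota last_iota1; split=> //; case: (t) t4 => [|[|[|[|]]]].
  by rewrite doubleS !addSn -s; split.
have [v s l] := rP (k - t)./2; exists (r (k - t)./2) => //.
rewrite mem_paths v s andbT; apply/eqP; move: otk tk.
have := odd_double_half (k - t); lia.
Qed.

(** * Path counts and Fibonacci numbers *)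

Arguments fib : simpl never.

Definition path_count (a t n : nat) : nat := count (fun p => last a p == t) (paths a n).

Lemma path_countS a t n : path_count a t n.+1 = \sum_(b <- nbrs a) path_count b t n.
Proof.
rewrite /path_count /paths -/paths count_flatten sumnE !big_map.
by apply: eq_bigr => b _; rewrite count_map.
Qed.

Lemma path_count_step t n : [/\ path_count 0 t n.+1 = path_count 1 t n,
  path_count 1 t n.+1 = path_count 0 t n + path_count 2 t n, path_count 2 t n.+1 = path_count 1 t n + path_count 3 t n
  & path_count 3 t n.+1 = path_count 2 t n].
Proof. by split; rewrite path_countS /= !big_cons big_nil addn0. Qed.

Lemma fibS n : fib n.+2 = fib n.+1 + fib n. Proof. by []. Qed.

(** The recursion moves the starting vertex, so the counts from all four vertices go through the
    induction together; parity kills two of them. *)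
Lemma path_count_t0 m : [/\ path_count 0 0 m.*2.+1 = 0, path_count 1 0 m.*2.+1 = fib m.*2.+1,
  path_count 2 0 m.*2.+1 = 0 & path_count 3 0 m.*2.+1 = fib m.*2].
Proof.
elim: m => [|m [h0 h1 h2 h3]]; first by [].
have [e0 e1 e2 e3] := path_count_step 0 m.*2.+1; have [-> -> -> ->] := path_count_step 0 m.*2.+2.
rewrite e0 e1 e2 e3 h0 h1 h2 h3 doubleS !fibS; split; lia.
Qed.

Lemma path_count_t2 m : [/\ path_count 0 2 m.*2 = fib m.*2, path_count 1 2 m.*2 = 0,
  path_count 2 2 m.*2 = fib m.*2.+1 & path_count 3 2 m.*2 = 0].
Proof.
elim: m => [|m [h0 h1 h2 h3]]; first by [].
have [e0 e1 e2 e3] := path_count_step 2 m.*2; have [-> -> -> ->] := path_count_step 2 m.*2.+1.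
rewrite e0 e1 e2 e3 h0 h1 h2 h3 doubleS !fibS; split; lia.
Qed.

Lemma path_count_t1 m : [/\ path_count 0 1 m.*2 = 0, path_count 1 1 m.*2 = fib m.*2.+1,
  path_count 2 1 m.*2 = 0 & path_count 3 1 m.*2 = fib m.*2].
Proof.
elim: m => [|m [h0 h1 h2 h3]]; first by [].
have [e0 e1 e2 e3] := path_count_step 1 m.*2; have [-> -> -> ->] := path_count_step 1 m.*2.+1.
rewrite e0 e1 e2 e3 h0 h1 h2 h3 doubleS !fibS; split; lia.
Qed.

Lemma path_count_t3 m : [/\ path_count 0 3 m.*2.+1 = fib m.*2, path_count 1 3 m.*2.+1 = 0,
  path_count 2 3 m.*2.+1 = fib m.*2.+1 & path_count 3 3 m.*2.+1 = 0].
Proof.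
elim: m => [|m [h0 h1 h2 h3]]; first by [].
have [e0 e1 e2 e3] := path_count_step 3 m.*2.+1; have [-> -> -> ->] := path_count_step 3 m.*2.+2.
rewrite e0 e1 e2 e3 h0 h1 h2 h3 doubleS !fibS; split; lia.
Qed.

Lemma path_count0_even m : [/\ path_count 0 0 m.*2.+2 = fib m.*2.+1, path_count 0 1 m.*2.+2 = 0,
  path_count 0 2 m.*2.+2 = fib m.*2.+2 & path_count 0 3 m.*2.+2 = 0].
Proof.
have [_ h0 _ _] := path_count_t0 m; have [e0 _ _ _] := path_count_step 0 m.*2.+1.
have [_ h3 _ _] := path_count_t3 m; have [e3 _ _ _] := path_count_step 3 m.*2.+1.
have [h1 _ _ _] := path_count_t1 m.+1; have [h2 _ _ _] := path_count_t2 m.+1.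
by split; rewrite ?e0 ?e3.
Qed.

Lemma path_count0_odd m : [/\ path_count 0 0 m.*2.+1 = 0, path_count 0 1 m.*2.+1 = fib m.*2.+1,
  path_count 0 2 m.*2.+1 = 0 & path_count 0 3 m.*2.+1 = fib m.*2].
Proof.
have [h0 _ _ _] := path_count_t0 m; have [h3 _ _ _] := path_count_t3 m.
have [_ h1 _ _] := path_count_t1 m; have [e1 _ _ _] := path_count_step 1 m.*2.
have [_ h2 _ _] := path_count_t2 m; have [e2 _ _ _] := path_count_step 2 m.*2.
by split; rewrite ?e1 ?e2.
Qed.

Lemma fib_add m n : fib (m + n).+1 = fib m.+1 * fib n.+1 + fib m * fib n.
Proof.
elim: m n => [|m IH] n; first by rewrite mul1n mul0n addn0.
by rewrite addSnnS IH !fibS; lia.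
Qed.

(** At either parity only two endpoints occur, with consecutive Fibonacci numbers as counts, and
    [fib_add] with equal arguments sums their squares. *)
Lemma sum_path_count_sq n : 0 < n -> \sum_(t < 4) path_count 0 t n * path_count 0 t n = fib (2 * n - 1).
Proof.
move=> n0; rewrite -(odd_double_half n) in n0 *; case: (odd n) n0 => /=.
  rewrite add1n => _; have [h0 h1 h2 h3] := path_count0_odd n./2.
  rewrite !big_ord_recl big_ord0 /= /bump /= !add1n h0 h1 h2 h3.
  have -> : 2 * (n./2).*2.+1 - 1 = ((n./2).*2 + (n./2).*2).+1 by lia.
  by rewrite fib_add; lia.
rewrite add0n double_gt0; case: (n./2) => // m _; rewrite doubleS.
have [h0 h1 h2 h3] := path_count0_even m.
rewrite !big_ord_recl big_ord0 /= /bump /= !add1n h0 h1 h2 h3.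
have -> : 2 * m.*2.+2 - 1 = (m.*2.+1 + m.*2.+1).+1 by lia.
by rewrite fib_add; lia.
Qed.

Lemma sum_last (n : nat) (g : nat -> nat) :
  \sum_(p <- paths 0 n) g (last 0 p) = \sum_(t < 4) path_count 0 t n * g t.
Proof.
transitivity (\sum_(p <- paths 0 n) \sum_(t < 4) (last 0 p == t) * g t).
  apply: eq_big_seq => p; rewrite mem_paths => /andP[_ /(vpath_lt4 (ltn0Sn 3)) l4].
  rewrite (bigD1 (Ordinal l4)) //= eqxx mul1n big1 ?addn0 // => t tl.
  by rewrite eq_sym -(inj_eq val_inj) /= in tl; rewrite (negbTE tl).
rewrite exchange_big; apply: eq_bigr => t _ /=.
rewrite -big_distrl /= /path_count -sum1_count; congr (_ * _); rewrite [RHS]big_mkcond.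
by apply: eq_bigr => p _; case: eqP.
Qed.

(** * Diagrams built from cups *)

(** The renumbering of old top positions when new points are inserted at i and i+1. *)
Definition skip (i k : nat) : nat := if k < i then k else k.+2.

Lemma skip_subproof n i (k : 'I_n) : skip i k < n.+2.
Proof. by rewrite /skip; case: ifP => _; have := ltn_ord k; lia. Qed.

Definition skip_ord n i (k : 'I_n) : 'I_n.+2 := Ordinal (skip_subproof i k).

Definition skip_pt t n i (x : boundary t n) : boundary t n.+2 :=
  match x with inl a => inl a | inr k => inr (skip_ord i k) end.

Definition top_pt t n (i : nat) : boundary t n.+2 := inr (inord i).

Lemma skip_inj i : injective (skip i).
Proof. by move=> k l; rewrite /skip; case: ifP; case: ifP; lia. Qed.

Lemma skip_pt_inj t n i : injective (@skip_pt t n i).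
Proof.
by move=> [a|k] [b|l] //= []; [move->|move/skip_inj => kl; congr inr; exact: val_inj].
Qed.

Lemma top_ptE t n i (k : 'I_n.+2) : val k = i -> top_pt t n i = inr k.
Proof. by move=> <-; rewrite /top_pt inord_val. Qed.

Lemma top_pt_inj t n i j : i <= n.+1 -> j <= n.+1 ->
  top_pt t n i = top_pt t n j -> i = j.
Proof. by move=> ni nj [] /(congr1 val) /=; rewrite !inordK. Qed.

Lemma skip_top t n i j : j <= n.+1 -> skip_pt i (top_pt t n j) = top_pt t n.+2 (skip i j).
Proof.
by move=> jn; rewrite (@top_ptE _ _ _ (skip_ord i (inord j))) //= inordK.
Qed.

Variant skip_spec t n i : boundary t n.+2 -> Type :=
| SkipL : skip_spec i (top_pt t n i)
| SkipR : skip_spec i (top_pt t n i.+1)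
| SkipPt y : skip_spec i (skip_pt i y).

Lemma skipP t n i (x : boundary t n.+2) : i <= n -> skip_spec i x.
Proof.
move=> le_in; case: x => [a|k]; first exact: (@SkipPt t n i (inl a)).
case: (ltngtP k i) => [ki|ik|/top_ptE <-]; last exact: SkipL.
  have kn : k < n by lia.
  have -> : inr k = skip_pt i (inr (Ordinal kn)) :> boundary t n.+2.
    by congr inr; apply: val_inj; rewrite /= /skip ki.
  exact: SkipPt.
case: (eqVneq (val k) i.+1) => [/top_ptE <-|ki]; first exact: SkipR.
have kn : k.-2 < n by have := ltn_ord k; move: ki => /=; lia.
have -> : inr k = skip_pt i (inr (Ordinal kn)) :> boundary t n.+2.
  congr inr; apply: val_inj; rewrite /= /skip.
  by move: ki => /=; case: ifP; lia.
exact: SkipPt.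
Qed.

Lemma skip_pt_neq t n i (y : boundary t n) : i <= n ->
  (skip_pt i y != top_pt t n i) * (skip_pt i y != top_pt t n i.+1).
Proof.
move=> le_in; case: y => [a|k] //; split; apply/eqP => -[] /(congr1 val) /=;
  rewrite inordK /skip; try lia; case: ifP; lia.
Qed.

Lemma top_ptS_neq t n i : i <= n -> top_pt t n i != top_pt t n i.+1.
Proof. by move=> le_in; apply/eqP => /top_pt_inj H; have := H; lia. Qed.

(* [is_cup i D' D]: D is obtained from D' by inserting a cup at the top
   positions i and i+1 (counted from 0). *)
Definition is_cup t n i (D' : matching t n) (D : matching t n.+2) : Prop :=
  [/\ D (top_pt t n i) = top_pt t n i.+1, D (top_pt t n i.+1) = top_pt t n i
    & forall x, D (skip_pt i x) = skip_pt i (D' x)].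

Definition unskip (i k : nat) := if k < i then k else k.-2.

Definition cup_matching t n i (D : matching t n) : matching t n.+2 :=
  [ffun x : boundary t n.+2 => match x with
   | inl a => skip_pt i (D (inl a))
   | inr k => if val k == i then top_pt t n i.+1
              else if val k == i.+1 then top_pt t n i
              else if insub (unskip i k) is Some k' then skip_pt i (D (inr k'))
              else inr k end].

Lemma cup_matchingP t n i (D : matching t n) : i <= n -> is_cup i D (cup_matching i D).
Proof.
move=> le_in; split; rewrite ?ffunE /=.
- by rewrite inordK ?eqxx // ltnS ltnW.
- by rewrite inordK // eqxx eqn_leq ltnn.
move=> [a|k]; rewrite ffunE //=.
have -> : (skip i k == i) = false by rewrite /skip; case: ifP; lia.
have -> : (skip i k == i.+1) = false by rewrite /skip; case: ifP; lia.
have -> : unskip i (skip i k) = k by rewrite /unskip /skip; case: (ltnP k i); case: ifP; lia.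
by rewrite valK.
Qed.

Definition perfect t n (D : matching t n) : Prop :=
  (forall x, D (D x) = x) /\ (forall x, D x <> x).

Lemma perfect_cup t n i (D : matching t n) D2 : i <= n ->
  is_cup i D D2 -> perfect D -> perfect D2.
Proof.
move=> le_in [c1 c2 c3] [inv nofix]; split=> x.
  by case: (skipP x le_in) => [||y]; rewrite ?c1 ?c2 ?c3 ?inv.
case: (skipP x le_in) => [||y]; rewrite ?c1 ?c2 ?c3.
- by apply/nesym/eqP; rewrite top_ptS_neq.
- by apply/eqP; rewrite top_ptS_neq.
- by move/skip_pt_inj; apply: nofix.
Qed.

(* The outcome of closing the top points i and i+1 of D by a cap:
   [contr i D true D'] when this creates a loop, [contr i D false D'] when two
   strings get joined, and [both_through i D] when the result is not monic. *)
Definition contr t n i (D : matching t n.+2) (e : bool) (D' : matching t n) : Prop :=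
  if e then is_cup i D' D else
  exists a b, [/\ D (top_pt t n i) = skip_pt i a, D (top_pt t n i.+1) = skip_pt i b,
    D' a = b, D' b = a
    & forall x, x <> a -> x <> b -> D (skip_pt i x) = skip_pt i (D' x)].

Definition both_through t n i (D : matching t n.+2) : Prop :=
  exists a b, D (top_pt t n i) = inl a /\ D (top_pt t n i.+1) = inl b.

(** Inserting two positions at i or at i+1 renumbers all old points alike except the one at position
    i; zigzags straighten because of this. *)
Lemma skipS_pt t n i (x : boundary t n) (k : 'I_n) : val k = i ->
  x <> inr k -> skip_pt i x = skip_pt i.+1 x.
Proof.
case: x => [a|l] //= ki kl; congr inr; apply: val_inj; rewrite /= /skip.
have : val l <> i by move=> li; apply: kl; congr inr; apply: val_inj; rewrite /= ki.
by case: (ltnP l i); case: ifP => /=; lia.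
Qed.

(** Zigzag identity: the cap joins the right end of the new cup to the string that ends at the old
    point k = i, so the left end of the cup takes over the role of k. *)
Lemma contr_cupS t n i (D : matching t n) D2 : i < n -> perfect D ->
  is_cup i D D2 -> contr i.+1 D2 false D.
Proof.
move=> lt_in [inv nofix] [c1 c2 c3]; pose k := Ordinal lt_in.
have sk x := @skipS_pt t n i x k erefl.
have Ea : top_pt t n i = skip_pt i.+1 (inr k).
  by apply: top_ptE; rewrite /= /skip ltnSn.
have Eb : top_pt t n i.+2 = skip_pt i (inr k).
  by apply: top_ptE; rewrite /= /skip ltnn.
exists (inr k), (D (inr k)); split=> //.
- by rewrite c2.
- by rewrite Eb c3 sk.
- move=> x xk xD; rewrite -sk // c3 sk // => Dx; apply: xD.
  by rewrite -Dx inv.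
Qed.

Lemma contr_cup_pred t n i (D : matching t n) D2 : i < n -> perfect D ->
  is_cup i.+1 D D2 -> contr i D2 false D.
Proof.
move=> lt_in [inv nofix] [c1 c2 c3]; pose k := Ordinal lt_in.
have sk x := @skipS_pt t n i x k erefl.
have Ea : top_pt t n i = skip_pt i.+1 (inr k).
  by apply: top_ptE; rewrite /= /skip ltnSn.
have Eb : top_pt t n i.+2 = skip_pt i (inr k).
  by apply: top_ptE; rewrite /= /skip ltnn.
exists (D (inr k)), (inr k); split=> //.
- by rewrite Ea c3 -sk.
- by rewrite c1.
- move=> x xD xk; rewrite sk // c3 -sk // => Dx; apply: xD.
  by rewrite -Dx inv.
Qed.

(** Distant caps and cups commute. The hypotheses on [skip] record how the two pairs of positions
    shift past each other, so that one proof serves a cap to the left and a cap to the right of the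
    cup. *)
Lemma contr_far t n i j i' j' (Dy : matching t n.+2) (D : matching t n.+4) Dz E e :
  i' <= n -> j' <= n ->
  (forall x, skip j (skip i' x) = skip i (skip j' x)) ->
  skip j i' = i -> skip j i'.+1 = i.+1 -> skip i j' = j -> skip i j'.+1 = j.+1 ->
  is_cup j Dy D -> contr i' Dy e Dz -> is_cup j' Dz E -> contr i D e E.
Proof.
move=> le_in le_jn comm si si1 sj sj1 [c1 c2 c3] C [f1 f2 f3].
have commp (x : boundary t n) : skip_pt j (skip_pt i' x) = skip_pt i (skip_pt j' x).
  by case: x => [a|k] //=; congr inr; apply: val_inj; rewrite /= comm.
have ti : top_pt t n.+2 i = skip_pt j (top_pt t n i') by rewrite skip_top ?si // leqW.
have ti1 : top_pt t n.+2 i.+1 = skip_pt j (top_pt t n i'.+1) by rewrite skip_top ?si1.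
have tj : top_pt t n.+2 j = skip_pt i (top_pt t n j') by rewrite skip_top ?sj // leqW.
have tj1 : top_pt t n.+2 j.+1 = skip_pt i (top_pt t n j'.+1) by rewrite skip_top ?sj1.
case: e C => [[g1 g2 g3]|[a [b [h1 h2 h3 h4 h5]]]]; last first.
  exists (skip_pt j' a), (skip_pt j' b); split.
  - by rewrite ti c3 h1 commp.
  - by rewrite ti1 c3 h2 commp.
  - by rewrite f3 h3.
  - by rewrite f3 h4.
  - move=> x; case: (skipP x le_jn) => [||y] na nbrs.
    + by rewrite -tj c1 f1 tj1.
    + by rewrite -tj1 c2 f2 tj.
    + by rewrite -commp c3 h5 ?commp ?f3 // => ya; [apply: na|apply: nbrs]; rewrite ya.
split.
- by rewrite ti c3 g1 ti1.
- by rewrite ti1 c3 g2 ti.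
- move=> x; case: (skipP x le_jn) => [||y].
  + by rewrite -tj c1 f1 tj1.
  + by rewrite -tj1 c2 f2 tj.
  + by rewrite -commp c3 g3 commp f3.
Qed.

Lemma skip_lt i k : k < i -> skip i k = k.
Proof. by rewrite /skip => ->. Qed.

Lemma skip_ge i k : i <= k -> skip i k = k.+2.
Proof. by rewrite /skip ltnNge => ->. Qed.

Lemma skip_comm i k x : i <= k -> skip k.+2 (skip i x) = skip i (skip k x).
Proof.
move=> ik; case: (ltnP x i) => [xi|ix].
  by rewrite (skip_lt (leq_trans xi ik)) !(skip_lt xi) skip_lt //; lia.
rewrite (skip_ge ix); case: (ltnP x k) => [xk|kx].
  by rewrite (skip_lt xk) (skip_ge ix) skip_lt.
by rewrite (skip_ge kx) !skip_ge //; lia.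
Qed.

(* The word [:: i_k; ...; i_1] encodes the diagram cup_{i_k} ... cup_{i_1} id_t. *)
Fixpoint word_diag t (w : seq nat) n {struct w} : matching t n -> Prop :=
  match w, n return matching t n -> Prop with
  | [::], n => fun D => n = t /\ forall (a : 'I_t) (k : 'I_n), val a = val k ->
                 D (inl a) = inr k /\ D (inr k) = inl a
  | i :: w', m.+2 => fun D => i <= m /\ exists D', word_diag w' D' /\ is_cup i D' D
  | _, _ => fun=> False
  end.

Lemma perfect_word t w n (D : matching t n) : word_diag w D -> perfect D.
Proof.
elim: w n D => [|i w IH] n D /=; last first.
  by case: n D => [|[|n]] // D [le_in [D' [/IH pD' c]]]; apply: perfect_cup c pD'.
case=> nt wD; have H a : D (inl a) = inr (cast_ord (esym nt) a) by case: (wD a (cast_ord (esym nt) a) erefl).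
have H' k : D (inr k) = inl (cast_ord nt k) by case: (wD (cast_ord nt k) k erefl).
split=> -[a|k]; rewrite ?H ?H' ?H ?H' // ?cast_ordK ?cast_ordKV //.
Qed.

Lemma word_diag_size t w n (D : matching t n) : word_diag w D -> n = t + (size w).*2.
Proof.
elim: w n D => [|i w IH] n D /=; first by case=> nt _; rewrite addn0.
by case: n D => [|[|n]] // D [_ [D' [/IH nt _]]]; rewrite nt doubleS !addnS.
Qed.

(** Pushes a cap at i down through the cups: equal positions close a loop ([true]), adjacent ones
    straighten, distant ones commute, the one further right being shifted by 2. [None] means that
    the cap reaches the through strings. *)
Fixpoint cap_word (w : seq nat) (i : nat) : option (bool * seq nat) :=
  if w is j :: y then
    if i == j then Some (true, y)
    else if (i == j.+1) || (j == i.+1) then Some (false, y)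
    else if i < j then omap (fun ez => (ez.1, j.-2 :: ez.2)) (cap_word y i)
    else omap (fun ez => (ez.1, j :: ez.2)) (cap_word y i.-2)
  else None.

Lemma contr_word t w n (D : matching t n.+2) i : i <= n -> word_diag w D ->
  match cap_word w i with
  | None => both_through i D
  | Some (e, z) => exists D' : matching t n, word_diag z D' /\ contr i D e D'
  end.
Proof.
elim: w n D i => [|j y IH] n D i le_in.
  case=> nt wD.
  have H' k : D (inr k) = inl (cast_ord nt k) by case: (wD (cast_ord nt k) k erefl).
  by rewrite /=; exists (cast_ord nt (inord i)), (cast_ord nt (inord i.+1)); rewrite !H'.
case=> le_jn [Dy [wDy cD]]; have pDy := perfect_word wDy; rewrite [cap_word _ _]/=.
case: eqP => [->|ij]; first by exists Dy.
case: ifP => [/orP[]/eqP ej|].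
- by exists Dy; split=> //; rewrite ej; apply: contr_cupS => //; rewrite -ej.
- by exists Dy; split=> //; apply: contr_cup_pred; rewrite -?ej.
move=> far; case: ltnP => [lt_ij|le_ji].
- have [k ek] : exists k, j = k.+2 by exists j.-2; lia.
  have ik : i <= k by lia.
  case: n D Dy wDy cD pDy le_in le_jn => [|[|n]] D Dy wDy cD pDy le_in le_jn; try lia.
  have le_in' : i <= n by lia.
  have := IH n Dy i le_in' wDy; case: (cap_word y i) => [[e z]|] /=; last first.
    move=> [a [b [Da Db]]]; exists a, b; case: cD => _ _ c3.
    have ti : top_pt t n.+2 i = skip_pt j (top_pt t n i).
      by rewrite skip_top ?leqW // /skip lt_ij.
    have ti1 : top_pt t n.+2 i.+1 = skip_pt j (top_pt t n i.+1).
      by rewrite skip_top // /skip; congr top_pt; rewrite ifT //; lia.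
    by rewrite ti ti1 !c3 Da Db.
  move=> [Dz [wDz cDz]].
  have le_kn : k <= n by lia.
  exists (cup_matching k Dz); rewrite ek /=; split.
    by split=> //; exists Dz; split=> //; apply: cup_matchingP.
  rewrite ek in cD; apply: (@contr_far t n i k.+2 i k Dy D Dz) cD cDz (cup_matchingP _ le_kn) => //;
    first [by move=> x; rewrite skip_comm | by rewrite skip_lt //; lia | by rewrite skip_ge //; lia].
- have [k ek] : exists k, i = k.+2 by exists i.-2; lia.
  have jk : j <= k by lia.
  case: n D Dy wDy cD pDy le_in le_jn => [|[|n]] D Dy wDy cD pDy le_in le_jn; try lia.
  have le_kn : k <= n by lia.
  rewrite ek /=.
  have := IH n Dy k le_kn wDy; case: (cap_word y k) => [[e z]|] /=; last first.
    move=> [a [b [Da Db]]]; exists a, b; case: cD => _ _ c3.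
    have ti : top_pt t n.+2 k.+2 = skip_pt j (top_pt t n k).
      by rewrite skip_top ?leqW // /skip; congr top_pt; rewrite ifF //; lia.
    have ti1 : top_pt t n.+2 k.+3 = skip_pt j (top_pt t n k.+1).
      by rewrite skip_top // /skip; congr top_pt; rewrite ifF //; lia.
    by rewrite ti ti1 !c3 Da Db.
  move=> [Dz [wDz cDz]].
  have le_jn' : j <= n by lia.
  exists (cup_matching j Dz); split.
    by split=> //; exists Dz; split=> //; apply: cup_matchingP.
  apply: (@contr_far t n k.+2 j k j Dy D Dz) cD cDz (cup_matchingP _ le_jn') => //;
    first [by move=> x; rewrite skip_comm | by rewrite skip_lt //; lia | by rewrite skip_ge //; lia].
Qed.

(** * Loops and connectivity under stacking *)

Section Connect.
Variables (T : finType) (e : rel T).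

Lemma connect_invariant (P : T -> Prop) x y :
  (forall u v, e u v -> P u -> P v) -> connect e x y -> P x -> P y.
Proof.
move=> inv /connectP[p + ->]; elim: p x => //= z p IH x /andP[xz zp] Px.
exact: IH zp (inv _ _ xz Px).
Qed.

Hypothesis sym : connect_sym e.

Definition inside (M : {set T}) : pred T :=
  [pred x | [forall y, connect e x y ==> (y \in M)]].

Lemma insideP (M : {set T}) x : reflect (forall y, connect e x y -> y \in M) (x \in inside M).
Proof. by apply: (iffP forallP) => H y; apply/implyP; apply: H. Qed.

Lemma inside_closed (M : {set T}) : closed e (inside M).
Proof.
move=> x y xy; apply/insideP/insideP => H z yz; apply: H.
  by apply: connect_trans (connect1 xy) _.
by apply: connect_trans yz; rewrite sym connect1.
Qed.

(** Replaces the partition blocks counted by [stack_loops] by [n_comp], which can be compared along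
    an adjunction of graphs. *)
Lemma card_classes (M : {set T}) :
  #|[set C in equivalence_partition (connect e) [set: T] | C \subset M]|
    = n_comp e (inside M).
Proof.
pose cls x := [set y in [set: T] | connect e x y].
have inj : {in predI (roots e) (inside M) &, injective cls}.
  move=> x y /andP[/eqP rx _] /andP[/eqP ry _] /setP/(_ y).
  by rewrite !inE /= connect0 => /(fingraph.rootP sym); rewrite rx ry.
rewrite /n_comp_mem -(card_in_imset inj); apply: eq_card => C; rewrite inE.
apply/andP/imsetP => [[/imsetP[x _ ->] sM]|[x /andP[_ /insideP inM] ->]].
  have xr := connect_root e x.
  exists (fingraph.root e x); last by apply/setP => y; rewrite !inE (same_connect sym xr).
  apply/andP; split; first exact: roots_root.
  apply/insideP => y ry; apply: (subsetP sM); rewrite !inE.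
  exact: connect_trans xr ry.
split; first by apply/imsetP; exists x; rewrite ?inE.
by apply/subsetP => y; rewrite !inE; apply: inM.
Qed.

End Connect.

(* A graph e' obtained from e by deleting the points outside the range of h
   without changing connectivity; these points may form one closed loop. *)
Lemma n_comp_embed (T T' : finType) (e : rel T) (e' : rel T') (h : T' -> T)
    (M : {set T}) (M' : {set T'}) (m : T) (loop : bool) :
  connect_sym e -> connect_sym e' ->
  (forall x y, connect e' x y = connect e (h x) (h y)) ->
  (forall x, (h x \in M) = (x \in M')) ->
  (forall x, (exists x', x = h x') \/ x \in M) ->
  (forall x, (loop && connect e m x) \/ exists x', connect e x (h x')) ->
  (loop -> forall x, connect e m x -> x \in M) ->
  (loop -> forall x', ~~ connect e m (h x')) ->
  n_comp e (inside e M) = loop + n_comp e' (inside e' M').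
Proof.
move=> sym sym' C1 hM cover reach loopM loop_h.
(* The inner components other than the possible extra loop. On them [h] is an adjunction, and the
   loop adds one component at the end. *)
pose a := [pred x | x \in inside e M & ~~ (loop && connect e m x)].
have cl_a : closed e a.
  move=> x y xy; have E := inside_closed sym M xy.
  rewrite [LHS]inE [RHS]inE E.
  by congr (_ && ~~ (_ && _)); exact: (same_connect_r sym (connect1 xy)).
have adj : rel_adjunction h e e' a.
  split=> [x|x' y' _]; last exact: C1.
  rewrite inE => /andP[_ nl]; have /existsP/sigW[x' xx'] : [exists x', connect e x (h x')].
    by case: (reach x) nl => [->//|[x' H] _]; apply/existsP; exists x'.
  by exists x'.
have pre : [preim h of a] =i inside e' M'.
  move=> x'; rewrite !inE; have -> : ~~ (loop && connect e m (h x')).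
    by case: loop loop_h {reach loopM a cl_a adj} => //= /(_ isT x').
  rewrite andbT; apply/insideP/insideP => H y.
    by rewrite -hM C1; apply: H.
  case: (cover y) => // -[y' ->]; rewrite -C1 hM; exact: H.
rewrite -(eq_n_comp_r pre) -(adjunction_n_comp h sym sym' cl_a adj).
case: loop @a cl_a adj pre reach loopM loop_h => a cl_a adj pre reach loopM loop_h; last first.
  by rewrite add0n; apply: eq_n_comp_r => x; rewrite !inE andbT.
rewrite -[true : nat](n_comp_connect sym m) /n_comp_mem.
have inM x : connect e m x -> x \in inside e M.
  by move=> mx; apply/insideP => y xy; apply: loopM => //; apply: connect_trans xy.
rewrite -(cardID (connect e m)); congr (_ + _); apply: eq_card => x; rewrite !inE.
  case mx: (connect e m x); last by rewrite !andbF.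
  by rewrite -[[forall y, _]]/(x \in inside e M) inM ?mx // !andbT.
by rewrite andbC -!andbA.
Qed.

Section StackGraph.
Variables (t n : nat).
Implicit Types (D : matching t n) (x : boundary t n) (u v : stack_point t n t).

(** In the picture of the product, D2 lies below the reflection of D1 and they are glued along their
    top points: [low] places the boundary of D2, [up] that of D1, and the two agree on top
    points. *)
Definition low x : stack_point t n t := lower_point t x.
Definition up x : stack_point t n t := upper_point t (flip x).

Definition stack_graph (D1 D2 : matching t n) : rel (stack_point t n t) :=
  stack_edge (reflect_diagram D1) D2.

Lemma flipK s p : cancel (@flip s p) (@flip p s).
Proof. by case. Qed.

Lemma up_inj : injective up.
Proof. by move=> [a|k] [b|l] // [->]. Qed.

Lemma stack_graphP D1 D2 u v :
  reflect ((exists x, u = low x /\ v = low (D2 x)) \/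
           (exists x, u = up x /\ v = up (D1 x)))
          (stack_graph D1 D2 u v).
Proof.
apply: (iffP orP) => -[].
- by case/existsP => x /andP[/eqP -> /eqP ->]; left; exists x.
- case/existsP => x /andP[/eqP -> /eqP ->]; right; exists (flip x).
  by rewrite /up flipK ffunE.
- by case=> x [-> ->]; left; apply/existsP; exists x; rewrite !eqxx.
- case=> x [-> ->]; right; apply/existsP; exists (flip x).
  by rewrite ffunE flipK !eqxx.
Qed.

Lemma stack_graph_sym D1 D2 : perfect D1 -> perfect D2 ->
  connect_sym (stack_graph D1 D2).
Proof.
move=> [i1 _] [i2 _]; apply: sym_connect_sym => u v.
apply/stack_graphP/stack_graphP => -[] [x [-> ->]].
- by left; exists (D2 x); rewrite i2.
- by right; exists (D1 x); rewrite i1.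
- by left; exists (D2 x); rewrite i2.
- by right; exists (D1 x); rewrite i1.
Qed.

Lemma connect_low D1 D2 x : connect (stack_graph D1 D2) (low x) (low (D2 x)).
Proof. by apply/connect1/stack_graphP; left; exists x. Qed.

Lemma connect_up D1 D2 x : connect (stack_graph D1 D2) (up x) (up (D1 x)).
Proof. by apply/connect1/stack_graphP; right; exists x. Qed.

Definition middle : {set stack_point t n t} := [set middle_point t t j | j : 'I_n].

Lemma mem_middle u : (u \in middle) = if u is inl (inr _) then true else false.
Proof.
apply/imsetP/idP => [[j _ ->]//|]; case: u => [[a|k]|b] // _.
by exists k.
Qed.

End StackGraph.

Section StackContraction.
Variables (t n i : nat).
Hypothesis le_in : i <= n.
Variables (D1 : matching t n.+2) (e : bool) (D1' : matching t n).
Variables (D2' : matching t n) (D2 : matching t n.+2).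
Hypotheses (pD1 : perfect D1) (pD1' : perfect D1').
Hypotheses (pD2' : perfect D2') (cD2 : is_cup i D2' D2).
Hypothesis cD1 : contr i D1 e D1'.

Let G := stack_graph D1 D2.
Let G' := stack_graph D1' D2'.

Definition embed (u : stack_point t n t) : stack_point t n.+2 t :=
  match u with inl x => inl (skip_pt i x) | inr k => inr k end.

Lemma embed_low x : embed (low x) = low (skip_pt i x). Proof. by []. Qed.
Lemma embed_up x : embed (up x) = up (skip_pt i x). Proof. by case: x. Qed.

Lemma embed_inj : injective embed.
Proof. by move=> [x|k] [y|l] // [] => [/skip_pt_inj|] ->. Qed.

Let tl : boundary t n.+2 := top_pt t n i.
Let tr : boundary t n.+2 := top_pt t n i.+1.

Lemma embed_neq u : (embed u <> low tl) /\ (embed u <> low tr).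
Proof.
case: u => [y|k] //=; have [H1 H2] := skip_pt_neq y le_in.
by split=> -[] /eqP; apply/negP.
Qed.

Lemma stack_pointP (u : stack_point t n.+2 t) :
  [\/ u = low tl, u = low tr | exists u', u = embed u'].
Proof.
case: u => [x|k]; last by constructor 3; exists (inr k).
case: (skipP x le_in) => [||y]; [by constructor 1|by constructor 2|].
by constructor 3; exists (inl y).
Qed.

Let symG : connect_sym G := stack_graph_sym pD1 (perfect_cup le_in cD2 pD2').
Let symG' : connect_sym G' := stack_graph_sym pD1' pD2'.

Lemma connect_tl_tr : connect G (low tl) (low tr).
Proof. by case: cD2 => c1 _ _; rewrite -[low tr]/(low (top_pt t n i.+1)) -c1 connect_low. Qed.

Lemma connect_embed_sub u v : connect G' u v -> connect G (embed u) (embed v).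
Proof.
move=> uv; move: (connect0 G (embed u)).
apply: (connect_invariant (P := fun w => connect G (embed u) (embed w))) uv.
move=> w1 w2 w12 uw; apply: connect_trans uw _; case: cD2 => _ _ c3.
case/stack_graphP: w12 => -[x [-> ->]]; first by rewrite !embed_low -c3 connect_low.
rewrite !embed_up; move: cD1; rewrite /contr; case: e => [[_ _ d3]|].
  by rewrite -d3 connect_up.
move=> [a [b [d1 d2 d3 d4 d5]]].
have Htl : connect G (low tl) (up (skip_pt i a)) by rewrite -d1; apply: connect_up.
have Htr : connect G (low tr) (up (skip_pt i b)) by rewrite -d2; apply: connect_up.
(* The edge from a to b in the small picture is the walk a, tl, tr, b of the large one. *)
have Hab : connect G (up (skip_pt i a)) (up (skip_pt i b)).
  apply: connect_trans (connect_trans connect_tl_tr Htr).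
  by rewrite symG.
case: (eqVneq x a) => [->|/eqP xa]; first by rewrite d3.
case: (eqVneq x b) => [->|/eqP xb]; first by rewrite d4 symG.
by rewrite -d5 // connect_up.
Qed.

Lemma connect_embed u v : connect G' u v = connect G (embed u) (embed v).
Proof.
apply/idP/idP; first exact: connect_embed_sub.
have [c1 c2 c3] := cD2; have [inv1 _] := pD1.
have lowE w x : embed w = low x -> exists2 y, w = low y & x = skip_pt i y.
  by case: w => // y [<-]; exists y.
have upE w x : embed w = up x -> exists2 y, w = up y & x = skip_pt i y.
  case: (skipP x le_in) => [||y].
  - by case: (embed_neq w) => H _ /H.
  - by case: (embed_neq w) => _ H /H.
  - by rewrite -embed_up => /embed_inj ->; exists y.
(* A walk in the large graph obeys an invariant: it stands at an embedded point joined to u in the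
   small graph, or at a deleted point while [pm] holds. For a loop [pm] is [False]; otherwise it
   says that u is joined to a, one of the two string ends that meet at the cap. *)
suff [pm [H1 H2 H3]] : exists pm : Prop,
    [/\ pm -> forall x, (x = tl \/ x = tr) ->
         exists2 w, up (D1 x) = embed w & connect G' u w,
        forall y, connect G' u (up y) ->
         (exists2 w, up (D1 (skip_pt i y)) = embed w & connect G' u w) \/
         pm /\ (D1 (skip_pt i y) = tl \/ D1 (skip_pt i y) = tr)
      & True].
  move=> uv; pose P w := (exists2 w', w = embed w' & connect G' u w') \/
    pm /\ (w = low tl \/ w = low tr).
  have : P (embed v).
    apply: connect_invariant uv _; last by left; exists u.
    move=> w1 w2 /stack_graphP[] [x [-> ->]] [].
    - case=> w' /esym/lowE[y -> ->] uy; left; exists (low (D2' y)).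
        by rewrite c3.
      by apply: connect_trans uy _; apply: connect_low.
    - case=> hm; case=> [] [->]; right; split=> //; [right|left].
        by rewrite c1.
      by rewrite c2.
    - case=> w' /esym/upE[y -> ->] /H2[]; first by left.
      by case=> hm [] ->; right; split=> //; [left|right].
    - case=> hm; case=> Hx; left; apply: H1 => //; [left; exact: (@up_inj _ _ x tl Hx) | right; exact: (@up_inj _ _ x tr Hx)].
  case=> [[w /embed_inj -> //]|[_ []] E]; by case: (embed_neq v).
move: cD1; rewrite /contr; case: e => [[_ _ d3]|].
  exists False; split=> // y uy; left; exists (up (D1' y)).
    by rewrite d3 embed_up.
  by apply: connect_trans uy _; apply: connect_up.
move=> [a [b [d1 d2 d3 d4 d5]]].
exists (connect G' u (up a)); split=> //.
  move=> ua x [] ->; [exists (up a) | exists (up b)]; rewrite ?d1 ?d2 ?embed_up //.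
  by apply: connect_trans ua _; rewrite -d3; apply: connect_up.
move=> y uy; case: (eqVneq y a) uy => [->|/eqP ya] uy.
  by right; split=> //; left; rewrite -d1 inv1.
case: (eqVneq y b) uy => [->|/eqP yb] uy.
  right; split; last by right; rewrite -d2 inv1.
  by apply: connect_trans uy _; rewrite -d4; apply: connect_up.
left; exists (up (D1' y)); first by rewrite d5 // embed_up.
by apply: connect_trans uy _; apply: connect_up.
Qed.

Lemma stack_matching_contr :
  stack_matching (reflect_diagram D1) D2 = stack_matching (reflect_diagram D1') D2'.
Proof.
apply/ffunP => x; rewrite !ffunE; congr odflt; apply: eq_pick => y /=.
have E z : outer_point n.+2 z = embed (outer_point n z) by case: z.
by congr (_ && _); rewrite -/G -/G' !E -connect_embed.
Qed.

Lemma stack_loops_contr :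
  stack_loops (reflect_diagram D1) D2 = e + stack_loops (reflect_diagram D1') D2'.
Proof.
have [c1 c2 c3] := cD2.
rewrite /stack_loops -/G -/G' !card_classes // -!/(middle _ _).
have isl : e -> forall x, connect G (low tl) x -> x = low tl \/ x = low tr.
  move: cD1; rewrite /contr; case: e => // -[d1 d2 _] _ x tx.
  apply: (connect_invariant (P := fun x => x = low tl \/ x = low tr)) tx _; last by left.
  move=> w1 w2 /stack_graphP[] [y [-> ->]] [].
  - by case=> ->; rewrite c1; right.
  - by case=> ->; rewrite c2; left.
  - by move/(@up_inj _ _ y tl) ->; rewrite d1; right.
  - by move/(@up_inj _ _ y tr) ->; rewrite d2; left.
apply: (@n_comp_embed _ _ _ _ embed _ _ (low tl)) => //.
- exact: connect_embed.
- by move=> [[a|k]|b]; rewrite !mem_middle.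
- move=> x; case: (stack_pointP x) => [->|->|H]; last by left.
    by right; rewrite mem_middle.
  by right; rewrite mem_middle.
- move=> x; case: (stack_pointP x) => [->|->|[x' ->]]; last by right; exists x'.
    move: cD1; rewrite /contr; case: e => [_|]; first by left; rewrite connect0.
    move=> [a [b [d1 d2 d3 d4 d5]]]; right; exists (up a).
    by rewrite embed_up -d1; apply: connect_up.
  move: cD1; rewrite /contr; case: e => [_|]; first by left; rewrite connect_tl_tr.
  move=> [a [b [d1 d2 d3 d4 d5]]]; right; exists (up b).
  by rewrite embed_up -d2; apply: connect_up.
- by move=> /isl H x /H[] ->; rewrite mem_middle.
- move=> /isl H x; apply/negP => /H []; by case: (embed_neq x).
Qed.

End StackContraction.

(** [pick] scans a fixed enumeration, so y is the first element of C, and excluding any other point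
    does not change the choice. *)
Lemma pick_other (T : finType) (C : pred T) x0 : C x0 ->
  exists2 y, C y & forall x, x != y -> [pick z | (z != x) && C z] = Some y.
Proof.
move=> Cx0; have: x0 \in enum C by rewrite mem_enum.
case Es: (enum C) => [//|y s] _.
have : y \in enum C by rewrite Es mem_head.
rewrite mem_enum => Cy; exists y => // x xy.
rewrite /pick; have -> : enum [pred z | (z != x) && C z] = [seq z <- enum C | z != x].
  by rewrite /enum_mem -filter_predI; apply: eq_filter => z.
by rewrite Es /= eq_sym xy.
Qed.

(* Both through strings a and b meet at the cup, so one component contains more
   than two outer points, and the partner picked in it is the same for all but
   one of them. *)
Lemma stack_matching_through t n i (D1 D2 : matching t n.+2) (D2' : matching t n) :
  i <= n -> perfect D1 -> perfect D2 -> is_cup i D2' D2 -> both_through i D1 ->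
  stack_matching (reflect_diagram D1) D2 != id_diagram t.
Proof.
move=> le_in pD1 pD2 [c1 c2 c3] [a [b [Da Db]]]; apply/negP => /eqP sm.
have ab : a <> b.
  move=> ab; have [inv _] := pD1.
  have := congr1 D1 Da; rewrite inv ab -Db inv => /eqP.
  by apply/negP; rewrite top_ptS_neq.
pose G := stack_graph D1 D2; have symG : connect_sym G by apply: stack_graph_sym.
have aG : connect G (up (inl a)) (low (top_pt t n i)).
  by rewrite symG -Da; apply: (connect_up D1 D2 (top_pt t n i)).
have bG : connect G (low (top_pt t n i.+1)) (up (inl b)).
  by rewrite -Db; apply: (connect_up D1 D2 (top_pt t n i.+1)).
have mG : connect G (low (top_pt t n i)) (low (top_pt t n i.+1)).
  by rewrite -c1; apply: connect_low.
have abG : connect G (up (inl a)) (up (inl b)).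
  exact: connect_trans aG (connect_trans mG bG).
pose C := [pred y : boundary t t | connect G (up (inl a)) (outer_point n.+2 y)].
have [y Cy Hy] := @pick_other _ C (inr a) (connect0 _ _).
have smE x : C x -> x != y -> flip x = y.
  move=> Cx xy; move/ffunP/(_ x): sm; rewrite !ffunE => <-.
  suff -> : [pick z | (z != x) && connect (stack_edge (reflect_diagram D1) D2)
      (outer_point n.+2 x) (outer_point n.+2 z)] = Some y by [].
  rewrite -(Hy x xy); apply: eq_pick => z /=; congr (_ && _).
  by rewrite -/G; apply/esym/(same_connect symG).
have Ca : C (inr a) by apply: connect0.
have Cb : C (inr b) by apply: abG.
case: (eqVneq (inr a : boundary t t) y) => [ya|/(smE _ Ca) ya].
  case: (eqVneq (inr b : boundary t t) y) => [yb|/(smE _ Cb) yb].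
    by apply: ab; move: yb; rewrite -ya => -[].
  by move: yb; rewrite -ya.
case: (eqVneq (inr b : boundary t t) y) => [yb|/(smE _ Cb) yb].
  by move: ya; rewrite -yb.
by apply: ab; move: ya; rewrite -yb => -[].
Qed.

Definition pt_index t n (x : boundary t n) : nat :=
  match x with inl a => a | inr k => k end.

Lemma word_nilE t n (D : matching t n) : word_diag [::] D ->
  forall x, pt_index (D x) = pt_index x /\ is_top (D x) = ~~ is_top x.
Proof.
case=> nt H [a|k].
  by case: (H a (cast_ord (esym nt) a) erefl) => ->.
by case: (H (cast_ord nt k) k erefl) => _ ->.
Qed.

Lemma stack_nil t n (D1 D2 : matching t n) :
  word_diag [::] D1 -> word_diag [::] D2 ->
  stack_matching (reflect_diagram D1) D2 = id_diagram t /\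
  stack_loops (reflect_diagram D1) D2 = 0.
Proof.
move=> w1 w2; have p1 := perfect_word w1; have p2 := perfect_word w2.
pose G := stack_graph D1 D2; have symG : connect_sym G by apply: stack_graph_sym.
(* All strings are vertical, so the column of a point is constant on components. *)
pose c (u : stack_point t n t) : nat :=
  match u with inl x => pt_index x | inr k => k end.
have cup x : c (up x) = pt_index x by case: x.
have inv u v : connect G u v -> c v = c u.
  move=> uv; apply: (connect_invariant (P := fun w => c w = c u)) uv _ => //.
  move=> x y /stack_graphP[] [z [-> ->]] <-; rewrite ?cup /=.
    by rewrite (word_nilE w2 z).1.
  by rewrite (word_nilE w1 z).1.
have [nt H1] := w1; have [_ H2] := w2.
have thr a : connect G (low (inl a)) (up (inl a)).
  have [E2 _] := H2 a (cast_ord (esym nt) a) erefl.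
  have [_ E1] := H1 a (cast_ord (esym nt) a) erefl.
  apply: connect_trans (connect_low D1 D2 (inl a)) _.
  by rewrite E2 -E1; apply: (connect_up D1 D2 (inr _)).
split.
  apply/ffunP => x; rewrite !ffunE; case: pickP => [y /andP[yx xy]|] /=.
    have /= := inv _ _ xy; case: x y {xy} yx => [a|a] [b|b] //=.
    - by move=> ab /val_inj E; rewrite E eqxx in ab.
    - by move=> _ /val_inj ->.
    - by move=> _ /val_inj ->.
    - by move=> ab /val_inj E; rewrite E eqxx in ab.
  move/(_ (flip x))/negbT; case: x => a /=; first by rewrite [connect _ _ _]thr.
  by rewrite symG [connect _ _ _]thr.
rewrite /stack_loops card_classes // -/(middle _ _).
apply: eq_card0 => u; rewrite inE; apply/negP => /andP[_ /insideP H].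
case: u H => [[a|k]|b] H.
- by have := H _ (connect0 _ _); rewrite mem_middle.
- have := H _ (connect_low D1 D2 (inr k)); rewrite mem_middle.
  by have [_ ->] := H2 (cast_ord nt k) k erefl.
- by have := H _ (connect0 _ _); rewrite mem_middle.
Qed.

(** * The Gram form computed on words *)

Section Gram.
Variables (K : fieldType) (delta : K) (t : nat).
Local Open Scope ring_scope.

Definition gram_matching n (D1 D2 : matching t n) : K :=
  let D1s := reflect_diagram D1 in
  if stack_matching D1s D2 == id_diagram t then delta ^+ stack_loops D1s D2 else 0.

(** The cup of the second word next to the gluing line is moved across it and becomes a cap on the
    first word. Diagrams no longer appear, so the path form can be tested against the same
    recursion. *)
Fixpoint gram_words (w1 w2 : seq nat) : K :=
  if w2 is j :: y then
    if cap_word w1 j is Some (e, z) then delta ^+ e * gram_words z y else 0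
  else 1.

Lemma gram_word n w1 w2 (D1 D2 : matching t n) :
  word_diag w1 D1 -> word_diag w2 D2 -> gram_matching D1 D2 = gram_words w1 w2.
Proof.
elim: w2 w1 n D1 D2 => [|j y IH] w1 n D1 D2 wD1 wD2.
  have n1 := word_diag_size wD1; have [n2 _] := wD2.
  case: w1 wD1 n1 => [|i w1] wD1 n1; last by move: n1 => /=; lia.
  by have [E1 E2] := stack_nil wD1 wD2; rewrite /gram_matching E1 eqxx E2.
have pD1 := perfect_word wD1; have pD2 := perfect_word wD2.
case: n D1 D2 wD1 wD2 pD1 pD2 => [|[|n]] // D1 D2 wD1 [le_jn [D2' [wD2' cD2]]] pD1 pD2.
have := contr_word le_jn wD1; rewrite /=; case: (cap_word w1 j) => [[e z]|].
  move=> [D1' [wD1' cD1]]; rewrite -(IH _ _ _ _ wD1' wD2').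
  have pD1' := perfect_word wD1'; have pD2' := perfect_word wD2'.
  rewrite /gram_matching (stack_matching_contr le_jn pD1 pD2' cD2 cD1).
  rewrite (stack_loops_contr le_jn pD1 pD1' pD2' cD2 cD1) exprD.
  by case: ifP => //; rewrite mulr0.
move=> bt; rewrite /gram_matching.
by rewrite (negbTE (stack_matching_through le_jn pD1 pD2 cD2 bt)).
Qed.

End Gram.

(** * Non-crossing diagrams are words in cups *)

(** The order of the boundary walk without numerical positions; in this form [skip_pt] visibly
    preserves it. *)
Definition before t n (x y : boundary t n) : bool :=
  match x, y with
  | inl a, inl b => a < b
  | inl _, inr _ => true
  | inr _, inl _ => false
  | inr k, inr l => l < k
  end.

Lemma boundary_pos_lt t n (x y : boundary t n) :
  (boundary_pos x < boundary_pos y) = before x y.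
Proof.
case: x y => [a|k] [b|l] //=.
- by have := ltn_ord a; lia.
- by have := ltn_ord b; lia.
- by have := ltn_ord k; have := ltn_ord l; lia.
Qed.

Lemma TL_diagramP t n (D : matching t n) :
  reflect (perfect D /\
    forall x y, ~ [&& before x y, before y (D x) & before (D x) (D y)])
   (is_TL_diagram D).
Proof.
apply: (iffP and3P) => [[/forallP i /forallP f /forallP c]|[[i f] c]].
  split; first by split=> x; apply/eqP.
  move=> x y; have /forallP/(_ y) := c x.
  by rewrite /crossing !boundary_pos_lt => /negP.
split; apply/forallP => x; first by apply/eqP.
  by apply/eqP.
apply/forallP => y; apply/negP; rewrite /crossing !boundary_pos_lt.
exact: c.
Qed.

Definition TL_monic t n (D : matching t n) := is_TL_diagram D && is_monic D.

Lemma before_skip t n i (x y : boundary t n) :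
  before (skip_pt i x) (skip_pt i y) = before x y.
Proof.
case: x y => [a|k] [b|l] //=; rewrite /skip.
by case: (ltnP l i); case: (ltnP k i); lia.
Qed.

Lemma is_top_skip t n i (x : boundary t n) : is_top (skip_pt i x) = is_top x.
Proof. by case: x. Qed.

Lemma before_top t n i : i <= n -> before (top_pt t n i.+1) (top_pt t n i).
Proof. by move=> le_in; rewrite /= !inordK ?ltnS // ltnW. Qed.

Lemma before_asym t n (x y : boundary t n) : before x y -> before y x -> False.
Proof. by rewrite -!boundary_pos_lt; lia. Qed.

Lemma before_trans t n (x y z : boundary t n) : before x y -> before y z -> before x z.
Proof. by rewrite -!boundary_pos_lt; lia. Qed.

Lemma before_gap t n i (y : boundary t n.+2) : i <= n ->
  before (top_pt t n i.+1) y -> before y (top_pt t n i) -> False.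
Proof.
by move=> le_in; case: y => [a|k] //=; rewrite !inordK ?ltnS // ?leqW //; lia.
Qed.

Lemma TL_monic_cup t n i (D' : matching t n) (D : matching t n.+2) : i <= n ->
  is_cup i D' D -> TL_monic D' -> TL_monic D.
Proof.
move=> le_in cD /andP[/TL_diagramP[pD' nc] /forallP mD'].
have pD := perfect_cup le_in cD pD'; have [c1 c2 c3] := cD.
apply/andP; split; last first.
  by apply/forallP => a; rewrite -[inl a]/(skip_pt i (inl a)) c3 is_top_skip.
have bt := before_top t le_in.
apply/TL_diagramP; split=> // x y /and3P[].
case: (skipP x le_in) => [||x']; rewrite ?c1 ?c2 ?c3.
- by move=> H1 H2; case: (before_asym bt (before_trans H1 H2)).
- by move=> H1 H2; case: (before_gap le_in H1 H2).
case: (skipP y le_in) => [||y']; rewrite ?c1 ?c2 ?c3.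
- by move=> _ H1 H2; case: (before_asym bt (before_trans H1 H2)).
- by move=> _ H1 H2; case: (before_gap le_in H1 H2).
by rewrite !before_skip => H1 H2 H3; apply: (nc x' y'); rewrite H1 H2.
Qed.

(** Descent to an innermost arc: unless l = k+1, planarity forces the partner of k+1 to lie strictly
    between k+1 and l, which gives a shorter arc. *)
Lemma exists_cap t n (D : matching t n) : is_TL_diagram D ->
  forall (k l : 'I_n), k < l -> D (inr k) = inr l ->
  exists i j : 'I_n, val j = i.+1 /\ D (inr i) = inr j.
Proof.
move=> /TL_diagramP[[inv nofix] nc] k l; move Eg: (l - k) => g.
elim/ltn_ind: g k l Eg => g IH k l Eg lt_kl Dk.
have Dl : D (inr l) = inr k by rewrite -Dk inv.
case: (eqVneq (val l) k.+1) => [lk|lk]; first by exists k, l.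
have lt_ml : k.+1 < l by move: lk => /=; lia.
have lt_mn : k.+1 < n by apply: ltn_trans lt_ml (ltn_ord l).
pose m := Ordinal lt_mn.
case Dm: (D (inr m)) => [a|p].
  have Da : D (inl a) = inr m by rewrite -Dm inv.
  by case: (nc (inl a) (inr l)); rewrite Dl Da /= lt_ml ltnSn.
have Dp : D (inr p) = inr m by rewrite -Dm inv.
have pm : val p <> m.
  by move=> /val_inj pm; apply: (nofix (inr m)); rewrite Dm pm.
have pk : val p <> k.
  by move=> /val_inj pk; move: Dp; rewrite pk Dk => -[] /(congr1 val) /= ?; lia.
have pl : val p <> l.
  by move=> /val_inj pl; move: Dp; rewrite pl Dl => -[] /(congr1 val) /= ?; lia.
have {pk} kp : k < p.
  rewrite ltnNge leq_eqVlt; apply/negP => /orP[/eqP //|{}pk].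
  case: (nc (inr l) (inr m)).
  by rewrite Dl Dm /= lt_ml ltnSn pk.
have {pl} lp : p < l.
  rewrite ltnNge leq_eqVlt; apply/negP => /orP[/eqP/esym //|{}pl].
  case: (nc (inr p) (inr l)).
  by rewrite Dl Dp /= lt_ml ltnSn pl.
have lt_g : p - m < g by move: lp kp pm => /=; lia.
have lt_mp : m < p by move: kp pm => /=; lia.
exact: IH lt_g m p erefl lt_mp Dm.
Qed.

(** With more top than bottom points, two top points are joined by the pigeonhole principle, and an
    innermost such arc is a cup. [D0] is D retyped along n = m.+2. *)
Lemma TL_monic_is_cup t n (D : matching t n) : t < n -> TL_monic D ->
  exists m i (D0 : matching t m.+2) (D' : matching t m),
    [/\ n = m.+2, i <= m, is_cup i D' D0, TL_monic D'
      & forall w, word_diag w D0 -> word_diag w D].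
Proof.
move=> lt_tn /andP[TLD mD].
have [k [l Dk]] : exists k l : 'I_n, D (inr k) = inr l.
  case: (boolP [exists k, [exists l, D (inr k) == inr l]]).
    by case/existsP=> k /existsP[l /eqP Dk]; exists k, l.
  rewrite negb_exists => /forallP H; suff : n <= t by rewrite leqNgt lt_tn.
  have {}H k : {a | D (inr k) = inl a}.
    case E: (D (inr k)) => [a|l]; first by exists a.
    by have := H k; rewrite negb_exists => /forallP/(_ l); rewrite E eqxx.
  have [[inv _] _] := TL_diagramP _ TLD.
  rewrite -(card_ord n) -(card_ord t).
  apply: (@leq_card _ _ (fun k => sval (H k))) => k l.
  case: (H k) (H l) => a Ha [b Hb] /= ab.
  by have := congr1 D Ha; rewrite inv ab -Hb inv => -[].
have [i [j [ij Dij]]] : exists i j : 'I_n, val j = i.+1 /\ D (inr i) = inr j.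
  have [[inv nofix] _] := TL_diagramP _ TLD.
  case: (ltngtP k l) => [kl|lk|/val_inj kl].
  - exact: exists_cap TLD k l kl Dk.
  - by apply: (exists_cap TLD lk); rewrite -Dk inv.
  - by case: (nofix (inr k)); rewrite {2}kl.
case: n D lt_tn TLD mD k l Dk i j ij Dij => [|[|m]] D lt_tn TLD mD _ _ _ i j ij Dij.
- by case: i {ij Dij}.
- by have := ltn_ord j; rewrite ij; have := ltn_ord i; lia.
have le_im : i <= m by have := ltn_ord j; rewrite ij.
have [[inv nofix] nc] := TL_diagramP _ TLD.
have Ei : top_pt t m i = inr i by apply: top_ptE.
have Ej : top_pt t m i.+1 = inr j by apply: top_ptE.
have Di : D (top_pt t m i) = top_pt t m i.+1 by rewrite Ei Ej.
have Dj : D (top_pt t m i.+1) = top_pt t m i by rewrite -Di inv.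
pose D' : matching t m :=
  [ffun x => odflt x [pick y | skip_pt i y == D (skip_pt i x)]].
have D'E x : D (skip_pt i x) = skip_pt i (D' x).
  rewrite ffunE; case: pickP => [y /eqP //|H] /=.
  have [n1 n2] := skip_pt_neq x le_im.
  move Ez: (D (skip_pt i x)) => z; case: (skipP z le_im) Ez => [E|E|y E].
  - by case/eqP: n2; rewrite -Di -E inv.
  - by case/eqP: n1; rewrite -Dj -E inv.
  - by have := H y; rewrite E eqxx.
exists m, i, D, D'; split=> //.
apply/andP; split; last first.
  apply/forallP => a; rewrite -(is_top_skip i) -D'E.
  by have /forallP/(_ a) := mD.
apply/TL_diagramP; split.
  split=> x; first by apply: (@skip_pt_inj _ _ i); rewrite -!D'E inv.
  by move/(congr1 (skip_pt i)); rewrite -D'E; apply: nofix.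
move=> x y H; apply: (nc (skip_pt i x) (skip_pt i y)).
by rewrite !D'E !before_skip.
Qed.

Lemma increasing_ord_id t (f : 'I_t -> 'I_t) :
  (forall a b : 'I_t, a < b -> f a < f b) -> forall a, f a = a.
Proof.
move=> inc a; apply: val_inj.
have lo : forall k (a : 'I_t), val a = k -> k <= f a.
  elim=> // k IH b bk; have kt : k < t by apply: ltn_trans (ltn_ord b); rewrite bk.
  by apply: leq_ltn_trans (IH (Ordinal kt) erefl) (inc _ _ _); rewrite bk /=.
have hi : forall k (a : 'I_t), t - a.+1 = k -> f a <= a.
  elim=> [|k IH] b bk.
    by have := ltn_ord (f b); have := ltn_ord b; lia.
  have bt : b.+1 < t by lia.
  have Hb : t - (Ordinal bt).+1 = k by rewrite /=; lia.
  by have := IH _ Hb; have := inc b (Ordinal bt) (ltnSn b) => /=; lia.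
by apply/eqP; rewrite eqn_leq (hi _ a erefl) lo.
Qed.

Lemma monic_leq t n (D : matching t n) : TL_monic D -> t <= n.
Proof.
case/andP=> /TL_diagramP[[inv _] _] /forallP mD.
have H a : {k | D (inl a) = inr k}.
  by case E: (D (inl a)) => [b|k]; [have := mD a; rewrite E | exists k].
rewrite -(card_ord n) -(card_ord t); apply: (@leq_card _ _ (fun a => sval (H a))) => a b.
case: (H a) (H b) => k Hk [l Hl] /= kl.
by have := congr1 D Hk; rewrite inv kl -Hl inv => -[].
Qed.

Lemma TL_monic_word t n (D : matching t n) : TL_monic D -> exists w, word_diag w D.
Proof.
elim/ltn_ind: n D => n IH D TD.
have := monic_leq TD; rewrite leq_eqVlt => /orP[/eqP tn|lt_tn]; last first.
  have [m [i [D0 [D' [nm le_im cD TD' H]]]]] := TL_monic_is_cup lt_tn TD.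
  have lt_mn : m < n by rewrite nm ltnW.
  have [w wD'] := IH m lt_mn D' TD'.
  by exists (i :: w); apply: H; split=> //; exists D'.
(* With equally many bottom and top points every string is a through string, and the absence of
   crossings makes the assignment increasing, hence the identity. *)
subst n; exists [::]; split=> // a k /val_inj <- {k}.
case/andP: TD => /TL_diagramP[[inv _] nc] /forallP mD.
have H b : {k | D (inl b) = inr k}.
  by case E: (D (inl b)) => [c|k]; [have := mD b; rewrite E | exists k].
suff E b : sval (H b) = b.
  have Da : D (inl a) = inr a by case: (H a) (E a) => k Hk /= ka; rewrite Hk ka.
  by split=> //; rewrite -Da inv.
apply: (increasing_ord_id (f := fun b => sval (H b))) => {b} b c bc.
case: (H b) (H c) => k Hk [l Hl] /=.
case: (ltngtP k l) => // [lk|/val_inj kl].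
  by case: (nc (inl b) (inl c)); rewrite Hk Hl /= bc lk.
have := congr1 D Hk; rewrite inv kl -Hl inv => -[] /(congr1 val) /= E.
by move: bc; rewrite E ltnn.
Qed.

Lemma word_diag_monic t n w (D : matching t n) : word_diag w D -> TL_monic D.
Proof.
elim: w n D => [|i w IH] n D; last first.
  by case: n D => [|[|n]] // D [le_in [D' [/IH TD' cD]]]; apply: TL_monic_cup cD TD'.
move=> wD; have [nt H] := wD; apply/andP; split; last first.
  by apply/forallP => a; have [_ ->] := word_nilE wD (inl a).
apply/TL_diagramP; split; first exact: perfect_word wD.
move=> x y; have [ex tx] := word_nilE wD x; have [ey ty] := word_nilE wD y.
move: (D x) (D y) ex tx ey ty => u v; case: x => a; case: u => b //= eb _;
  case: y => c; case: v => d //= ed _; lia.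
Qed.

Fixpoint word_ok (t : nat) (w : seq nat) : bool :=
  if w is j :: y then (j <= t + (size y).*2) && word_ok t y else true.

Lemma word_diag_ok t w n (D : matching t n) : word_diag w D -> word_ok t w.
Proof.
elim: w n D => //= i w IH [|[|n]] // D [le_in [D' [wD' _]]].
by rewrite -(word_diag_size wD') le_in (IH _ _ wD').
Qed.

Lemma word_ok_diag t w n : word_ok t w -> n = t + (size w).*2 ->
  exists D : matching t n, word_diag w D.
Proof.
elim: w n => [|i w IH] n /=.
  rewrite addn0 => _ ->; exists (id_diagram t); split=> // a k /val_inj ->.
  by rewrite !ffunE.
case/andP=> le_i /IH H ->; rewrite doubleS !addnS.
have [D wD] := H _ erefl; exists (cup_matching i D); split=> //.
by exists D; split=> //; apply: cup_matchingP.
Qed.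

(** Validity of the reduced word is read off from the diagram that it represents, not from the cases
    of [cap_word]. *)
Lemma cap_word_word_ok t w n i e z : word_ok t w -> n.+2 = t + (size w).*2 -> i <= n ->
  cap_word w i = Some (e, z) -> word_ok t z /\ n = t + (size z).*2.
Proof.
move=> okw sw le_in E; have [D wD] := word_ok_diag okw sw.
have := contr_word le_in wD; rewrite E => -[D' [wD' _]].
by split; [apply: word_diag_ok wD'|apply: word_diag_size wD'].
Qed.

Local Open Scope ring_scope.

(** * The path representation of cups and caps *)

Section PathModel.
Variables (K : fieldType) (delta : K).
Hypothesis delta_root : delta ^+ 4 - 3 * delta ^+ 2 + 1 = 0.

(** The Chebyshev values d_a for loop value [delta]: for delta = -(q + q^-1), d_a is (-1)^a times
    the quantum integer [a+1]. By [delta_root] the next value d_4 is 0. *)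
Definition qdim (a : nat) : K :=
  match a with
  | 0%N => 1 | 1%N => delta | 2%N => delta ^+ 2 - 1
  | 3%N => delta ^+ 3 - 2 * delta | _ => 0
  end.

(** If d_a vanished, delta^2 would be 0, 1 or 2, where c^2 - 3c + 1 takes the values 1, -1 and
    -1. *)
Lemma qdim_neq0 a : (a < 4)%N -> qdim a != 0.
Proof.
have d0 : delta != 0.
  apply/eqP => d0; move: delta_root; rewrite d0 !expr0n /= mulr0 subr0 add0r.
  by apply/eqP; rewrite oner_eq0.
have H c : delta ^+ 2 = c -> c ^+ 2 - 3 * c + 1 = 0.
  by move=> <-; rewrite -exprM.
case: a => [|[|[|[|a]]]] //= _; first exact: oner_neq0.
- rewrite subr_eq0; apply/eqP => /H /eqP.
  have -> : 1 ^+ 2 - 3 * 1 + 1 = -1 :> K by ring.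
  by rewrite oppr_eq0 oner_eq0.
- have -> : delta ^+ 3 - 2 * delta = delta * (delta ^+ 2 - 2) by ring.
  rewrite mulf_neq0 // subr_eq0; apply/eqP => /H /eqP.
  have -> : 2 ^+ 2 - 3 * 2 + 1 = -1 :> K by ring.
  by rewrite oppr_eq0 oner_eq0.
Qed.

Lemma sum_qdim_nbrs a : (a < 4)%N -> \sum_(b <- nbrs a) qdim b = delta * qdim a.
Proof.
case: a => [|[|[|[|a]]]] //= _; rewrite !big_cons big_nil /=; try ring.
apply/eqP; rewrite -subr_eq0 -oppr_eq0; apply/eqP; rewrite -[RHS]delta_root.
ring.
Qed.

Implicit Types (phi psi : seq nat -> K) (p r z : seq nat).

(** A cap sums over all excursions a, b, a inserted after i steps, and a cup is supported on paths
    with such an excursion. The factors 1/d_a and d_b make a closed loop the average of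
    [sum_qdim_nbrs], with value delta, and make zigzags trivial. *)
Fixpoint cap (i a : nat) phi r : K :=
  match i, r with
  | 0%N, _ => (qdim a)^-1 * \sum_(b <- nbrs a) phi [:: b, a & r]
  | i'.+1, c :: r' => cap i' c (fun z => phi (c :: z)) r'
  | _, _ => 0
  end.

Fixpoint cup (i a : nat) psi p : K :=
  match i, p with
  | 0%N, [:: b, c & r] => if c == a then qdim b * psi r else 0
  | i'.+1, c :: p' => cup i' c (fun z => psi (c :: z)) p'
  | _, _ => 0
  end.

Lemma eq_cap i a phi psi r : vpath a r -> (a < 4)%N ->
  {in paths a (size r).+2, phi =1 psi} -> cap i a phi r = cap i a psi r.
Proof.
elim: i a phi psi r => [|i IH] a phi psi r /= vr a4 E.
  congr (_ * _); apply: eq_big_seq => b ba; apply: E.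
  by rewrite mem_paths /= eqxx /= ba; case: (nbrsP ba) => _ _ ->.
case: r vr E => [|c r] //= /andP[ca vr] E; apply: IH => //.
  by case: (nbrsP ca).
move=> z; rewrite mem_paths => /andP[sz vz]; apply: E.
by rewrite mem_paths /= ca vz eqSS sz.
Qed.

Lemma eq_cup i a phi psi p n : vpath a p -> size p = n.+2 ->
  {in paths a n, phi =1 psi} -> cup i a phi p = cup i a psi p.
Proof.
elim: i a phi psi p n => [|i IH] a phi psi p n.
  case: p => [|b [|c r]] //= /and3P[ba cb vr] [sr] E.
  case: eqP => // ca; rewrite E // mem_paths sr eqxx -ca //.
case: p => [|c p] //= /andP[ca vp] [sp] E.
case: n sp E => [|n] sp E.
  case: p i {IH} vp sp E => [|b [|b' p]] //= [|i] //= vp _ E.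
  by case: i => //= [] [].
apply: (IH _ _ _ _ n) => // z; rewrite mem_paths => /andP[sz vz]; apply: E.
by rewrite mem_paths /= ca vz eqSS sz.
Qed.

Lemma cap_scale i a x phi r : cap i a (fun z => x * phi z) r = x * cap i a phi r.
Proof.
elim: i a phi r => [|i IH] a phi r /=; first by rewrite -mulr_sumr mulrCA.
by case: r => [|c r]; rewrite ?mulr0 // IH.
Qed.

Lemma cap0 i a r : cap i a (fun=> 0) r = 0.
Proof.
elim: i a r => [|i IH] a r /=; first by rewrite big1 ?mulr0.
by case: r => [|c r] //; rewrite IH.
Qed.

Lemma cup_sum i a x (I : Type) (s : seq I) (F : I -> seq nat -> K) p :
  cup i a (fun z => x * \sum_(b <- s) F b z) p = x * \sum_(b <- s) cup i a (F b) p.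
Proof.
elim: i a F p => [|i IH] a F p /=; last first.
  by case: p => [|c p]; rewrite ?IH // big1 ?mulr0.
case: p => [|b [|c r]]; try by rewrite big1 ?mulr0.
case: ifP => _; last by rewrite big1 ?mulr0.
by rewrite -mulr_sumr mulrCA.
Qed.

Lemma cap_cup_same i a psi p : (a < 4)%N -> vpath a p -> (i <= size p)%N ->
  cap i a (cup i a psi) p = delta * psi p.
Proof.
elim: i a psi p => [|i IH] a psi p a4 /=.
  rewrite eqxx -mulr_suml sum_qdim_nbrs // => _ _.
  by rewrite -mulrA mulrCA mulKf ?qdim_neq0.
case: p => [|c p] //= /andP[/nbrsP[_ c4 _] vp] ip.
exact: (IH c (fun z => psi (c :: z))).
Qed.

Lemma sum_nbrs_pick a c (F : nat -> K) : c \in nbrs a ->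
  \sum_(b <- nbrs a) (if c == b then F b else 0) = F c.
Proof.
move=> ca; rewrite -big_mkcond /= (big_rem c) //= eqxx big_seq_cond big1 ?addr0 //.
by move=> b; rewrite mem_rem_uniq ?nbrs_uniq // inE => /andP[/andP[/negP + _] /eqP bc];
   rewrite bc eqxx.
Qed.

Lemma cap_cupS i a psi p : (a < 4)%N -> vpath a p -> (i < size p)%N ->
  cap i a (cup i.+1 a psi) p = psi p.
Proof.
elim: i a psi p => [|i IH] a psi [|c p] //= a4 /andP[ca vp] ip.
  by rewrite (sum_nbrs_pick (fun b => qdim a * psi (b :: p))) // mulKf ?qdim_neq0.
by apply: (IH c (fun z => psi (c :: z))) => //; case: (nbrsP ca).
Qed.

Lemma capS_cup i a psi p : (a < 4)%N -> vpath a p -> (i < size p)%N ->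
  cap i.+1 a (cup i a psi) p = psi p.
Proof.
elim: i a psi p => [|i IH] a psi [|c p] //= a4 /andP[ca vp] ip;
  case: (nbrsP ca) => _ c4 ac.
  under eq_bigr do rewrite eq_sym.
  by rewrite (sum_nbrs_pick (fun=> qdim c * psi (c :: p))) // mulKf ?qdim_neq0.
exact: (IH c (fun z => psi (c :: z))).
Qed.

Lemma cap_cup_far i k a psi p : (i <= k)%N ->
  cap i a (cup k.+2 a psi) p = cup k a (cap i a psi) p.
Proof.
elim: i k a psi p => [|i IH] k a psi p /=; first by rewrite cup_sum.
by case: k => // k ik; case: p => //= c p; apply: (IH k c (fun z => psi (c :: z))).
Qed.

Lemma cap_far_cup i k a psi p : (i <= k)%N ->
  cap k.+2 a (cup i a psi) p = cup i a (cap k a psi) p.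
Proof.
elim: i k a psi p => [|i IH] k a psi p /=.
  case: p => [|b [|c r]] //= _; case: eqP => [->|_]; last by rewrite cap0.
  by rewrite cap_scale.
by case: k => // k ik; case: p => //= c p; apply: (IH k c (fun z => psi (c :: z))).
Qed.

Definition path_weight p : K := \prod_(b <- p) (qdim b)^-1.

Definition path_form (a t n : nat) phi psi : K :=
  \sum_(p <- paths a n | last a p == t) path_weight p * phi p * psi p.

Lemma path_formS a t n phi psi : path_form a t n.+1 phi psi =
  \sum_(b <- nbrs a) (qdim b)^-1 *
    path_form b t n (fun p => phi (b :: p)) (fun p => psi (b :: p)).
Proof.
rewrite /path_form big_mkcond big_allpairs_dep; apply: eq_bigr => b _ /=.
rewrite -big_mkcond mulr_sumr; apply: eq_bigr => p _.
by rewrite /path_weight big_cons !mulrA.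
Qed.

(** Adjointness is local: the excursion a, b, a has weight 1/(d_b d_a), the cup cancels d_b, and the
    remaining 1/d_a is the factor in [cap]. *)
Lemma path_form_cup i a t n phi psi : (a < 4)%N -> (i <= n)%N ->
  path_form a t n.+2 phi (cup i a psi) = path_form a t n (cap i a phi) psi.
Proof.
elim: i a n phi psi => [|i IH] a n phi psi a4 /=; last first.
  case: n => // n; rewrite ltnS => le_in; rewrite !path_formS.
  apply: eq_big_seq => b /nbrsP[_ b4 _]; congr (_ * _).
  exact: (IH b n (fun p => phi (b :: p)) (fun p => psi (b :: p))).
move=> _; rewrite path_formS.
transitivity (\sum_(b <- nbrs a) (qdim a)^-1 *
    path_form a t n (fun p => phi [:: b, a & p]) psi).
  apply: eq_big_seq => b ba; case: (nbrsP ba) => _ b4 ab; rewrite path_formS.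
  rewrite -(sum_nbrs_pick (fun c => (qdim a)^-1 * path_form a t n (fun p => phi [:: b, a & p]) psi) ab).
  rewrite mulr_sumr; apply: eq_big_seq => c cb.
  rewrite [a == c]eq_sym; case: eqP => [->|_]; last first.
    by rewrite /path_form big1 ?mulr0 // => p _; rewrite mulr0.
  rewrite mulrCA; congr (_ * _); rewrite mulr_sumr; apply: eq_bigr => p _.
  by rewrite mulrCA mulKf ?qdim_neq0.
rewrite -mulr_sumr /path_form exchange_big mulr_sumr; apply: eq_bigr => p _.
by rewrite -mulr_suml -mulr_sumr /=; ring.
Qed.

Lemma cap_cat a l r phi : cap (size l) a phi (l ++ r) =
  (qdim (last a l))^-1 * \sum_(b <- nbrs (last a l)) phi (l ++ [:: b, last a l & r]).
Proof. by elim: l a phi => [|c l IH] a phi //=; rewrite IH. Qed.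

Lemma cup_cat a l p psi : cup (size l) a psi (l ++ p) =
  cup 0 (last a l) (fun z => psi (l ++ z)) p.
Proof. by elim: l a psi => [|c l IH] a psi //=; rewrite IH. Qed.

(** Splits a path at its first step down; a path without one climbs straight and is therefore
    short. *)
Lemma vpath_shape h p : (h < 4)%N -> vpath h p ->
  (p = iota h.+1 (size p) /\ (h + size p < 4)%N) \/
  exists j r, [/\ p = iota h.+1 j ++ (h + j).-1 :: r, (0 < h + j)%N & (h + j < 4)%N].
Proof.
elim: p h => [|c p IH] h h4 /=; first by rewrite addn0; left.
case/andP=> ch vp; have [_ c4 _] := nbrsP ch.
have [ec|ec] : (c = h.+1) \/ (0 < h)%N /\ c = h.-1.
- by case: h h4 ch {IH} => [|[|[|[|h]]]] //= _; rewrite !inE;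
    do ?[case/orP]; move/eqP->; auto.
- subst c; have [[ep lp]|[j [r [-> j0 j4]]]] := IH _ c4 vp; [left|right].
    by rewrite {1}ep addnS.
  by exists j.+1, r; rewrite /= addnS.
- by right; exists 0%N, p; case: ec => h0 ->; rewrite addn0.
Qed.

Lemma vanish_of_cap j r phi : (0 < j < 4)%N ->
  let p := iota 1 j ++ j.-1 :: r in vpath 0 p ->
  (forall i z, (i < j)%N -> (size z).+2 = size p -> vpath 0 z ->
     last 0%N z = last 0%N p -> cap i 0 phi z = 0) ->
  phi p = 0.
Proof.
elim: j r => // j IH r j4 p vp H.
have lj : last 0%N (iota 1 j) = j by exact: last_iota1.
have ep : p = iota 1 j ++ [:: j.+1, j & r].
  by rewrite /p -[X in iota 1 X]addn1 iotaD -catA /= add1n.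
have vl : vpath 0 (iota 1 j ++ r).
  by move: vp; rewrite ep /vpath !cat_path lj /= => /and4P[-> _ _ ->].
have := H j (iota 1 j ++ r) (ltnSn j).
rewrite ep !size_cat !addnS => /(_ erefl vl).
rewrite !last_cat lj => /(_ erefl).
rewrite -{1}(size_iota 1 j) cap_cat lj => /eqP; rewrite mulf_eq0 invr_eq0.
rewrite (negbTE (qdim_neq0 _)) /=; last by case/andP: j4 => _ /ltnW.
case: j IH j4 p vp H lj ep vl => [|j] IH j4 p vp H lj ep vl; first by rewrite big_seq1 => /eqP.
have /IH E : (0 < j.+1 < 4)%N by case/andP: j4 => _ /ltnW.
have {E} E0 : phi (iota 1 j.+1 ++ [:: j, j.+1 & r]) = 0.
  have lj1 : last 0%N (iota 1 j) = j by exact: last_iota1.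
  apply: E => [|i z ij sz vz lz].
    move: vl; rewrite /vpath !cat_path lj /= => /andP[-> ->].
    by case: j j4 {IH p vp H lj ep lj1} => [|[|[|j]]].
  apply: H => //; first exact: leq_trans ij _.
    by rewrite sz ep !size_cat.
  by rewrite lz ep !last_cat.
have -> : nbrs j.+1 = [:: j; j.+2] by case: (j) j4 => [|[|[|]]].
by rewrite !big_cons big_nil E0 add0r addr0 => /eqP.
Qed.

(** A path of length n+2 with end t < n+2 is not straight, so it has a first peak, of height at most
    3. Hence caps at positions 0, 1, 2 suffice; this bound is what lets three generators detect zero
    later. *)
Lemma cap_kernel n t phi : (t < n.+2)%N ->
  (forall i r, (i <= n)%N -> (i < 3)%N -> r \in paths 0 n -> last 0%N r = t ->
     cap i 0 phi r = 0) ->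
  forall p, p \in paths 0 n.+2 -> last 0%N p = t -> phi p = 0.
Proof.
move=> tn H p; rewrite mem_paths => /andP[/eqP sp vp] lp.
have [[ep p4]|[j [r [ep j0 j4]]]] := vpath_shape (ltn0Sn 3) vp.
  by move: tn; rewrite -lp ep last_iota1 sp ltnn.
rewrite add0n in ep j0 j4.
have sjr : size p = (j + size r).+1 by rewrite ep size_cat size_iota /= addnS.
rewrite ep; apply: vanish_of_cap; rewrite -?ep ?j0 // => i z ij sz vz lz.
have ni : (i <= n)%N.
  by rewrite -ltnS; move: sjr; rewrite sp => -[->]; apply: leq_trans ij (leq_addr _ _).
have i3 : (i < 3)%N by apply: leq_trans ij _.
apply: H; rewrite ?lz //.
by rewrite mem_paths vz andbT; move: sz; rewrite sp => -[->].
Qed.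

End PathModel.

(** * Temperley-Lieb relations for the operators on paths *)

Section PathOperators.
Variables (K : fieldType) (delta : K).
Hypothesis delta_root : delta ^+ 4 - 3 * delta ^+ 2 + 1 = 0.
Local Notation cap := (cap delta).
Local Notation cup := (cup delta).
Local Notation qdim := (qdim delta).
Implicit Types (phi psi : seq nat -> K).

Lemma cap_sum i a (I : Type) (s : seq I) (F : I -> seq nat -> K) r :
  cap i a (fun z => \sum_(b <- s) F b z) r = \sum_(b <- s) cap i a (F b) r.
Proof.
elim: i a F r => [|i IH] a F r /=; first by rewrite exchange_big mulr_sumr.
by case: r => [|c r]; rewrite ?IH // big1.
Qed.

Lemma cup_scale i a x psi p : cup i a (fun z => x * psi z) p = x * cup i a psi p.
Proof.
have := cup_sum delta i a x [:: 0%N] (fun=> psi) p; rewrite big_seq1 => <-.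
by congr (cup i a _ p); apply: funext => z; rewrite big_seq1.
Qed.

Lemma cup0 i a p : cup i a (fun=> 0) p = 0.
Proof.
rewrite -[RHS](mul0r (cup i a (fun=> 0) p)) -cup_scale.
by congr (cup i a _ p); apply: funext => z; rewrite mul0r.
Qed.

Lemma cup_cup i k a psi p : (i <= k)%N ->
  cup k.+2 a (cup i a psi) p = cup i a (cup k a psi) p.
Proof.
elim: i k a psi p => [|i IH] k a psi p.
  case: p => [|b [|c r]] //= _; case: eqP => [->|_]; last exact: cup0.
  exact: cup_scale.
by case: k => // k ik; case: p => //= c p; apply: (IH k c (fun z => psi (c :: z))).
Qed.

Lemma cap_cap i k a phi r : (i <= k)%N ->
  cap k a (cap i a phi) r = cap i a (cap k.+2 a phi) r.
Proof.
elim: i k a phi r => [|i IH] k a phi r; first by rewrite /= cap_scale cap_sum.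
by case: k => // k ik; case: r => //= c p; apply: (IH k c (fun z => phi (c :: z))).
Qed.

(** Every vertex has a neighbour b, and on r with an excursion to b inserted after i steps the cup
    takes the value d_b * psi r with d_b non-zero. *)
Lemma cup_eq0 n i psi : (i <= n)%N ->
  (forall p, p \in paths 0 n.+2 -> cup i 0 psi p = 0) ->
  forall r, r \in paths 0 n -> psi r = 0.
Proof.
move=> le_in H r; rewrite mem_paths => /andP[/eqP sr vr].
pose a := last 0%N (take i r).
have a4 : (a < 4)%N.
  move: vr; rewrite -{1}(cat_take_drop i r) /vpath cat_path => /andP[+ _].
  exact: vpath_lt4.
have [b ba] : exists b, b \in nbrs a.
  by case: (a) a4 => [|[|[|[|]]]] // _; [exists 1%N|exists 0%N|exists 1%N|exists 2].
have := H (take i r ++ [:: b, a & drop i r]); rewrite mem_paths.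
have -> : size (take i r ++ [:: b, a & drop i r]) == n.+2.
  by rewrite size_cat /= !addnS -size_cat cat_take_drop sr.
have -> : vpath 0 (take i r ++ [:: b, a & drop i r]).
  move: vr; rewrite -{1}(cat_take_drop i r) /vpath !cat_path /= -/a ba.
  by case: (nbrsP ba) => _ _ -> /andP[-> ->].
move/(_ isT); have si : size (take i r) = i by rewrite size_takel ?sr.
rewrite -{1}si cup_cat -/a /= eqxx cat_take_drop => /eqP.
by rewrite mulf_eq0 (negbTE (qdim_neq0 delta_root _)) => [/eqP|]; case: (nbrsP ba).
Qed.

Definition cupcap (i : nat) phi : seq nat -> K := cup i 0 (cap i 0 phi).

Lemma cupcap_cat l b c r phi : cupcap (size l) phi (l ++ [:: b, c & r]) =
  if c == last 0%N l then
    qdim b * ((qdim c)^-1 * \sum_(b' <- nbrs c) phi (l ++ [:: b', c & r]))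
  else 0.
Proof.
by rewrite /cupcap cup_cat /=; case: eqP => // ->; rewrite cap_cat.
Qed.

Lemma cupcap_sq n i phi p : (i.+2 <= n)%N -> p \in paths 0 n ->
  cupcap i (cupcap i phi) p = delta * cupcap i phi p.
Proof.
case: n => [|[|n]] //; rewrite !ltnS mem_paths => le_in /andP[/eqP sp vp].
rewrite -[RHS]cup_scale; apply: (eq_cup delta i vp sp) => z.
by rewrite mem_paths => /andP[/eqP sz vz]; rewrite cap_cup_same // sz.
Qed.

Lemma cupcap_adj n i phi p : (i.+3 <= n)%N -> p \in paths 0 n ->
  cupcap i (cupcap i.+1 (cupcap i phi)) p = cupcap i phi p.
Proof.
case: n => [|[|n]] //; rewrite !ltnS mem_paths => le_in /andP[/eqP sp vp].
apply: (eq_cup delta i vp sp) => z; rewrite mem_paths => /andP[/eqP sz vz].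
by rewrite /cupcap cap_cupS ?sz // capS_cup ?sz.
Qed.

Lemma cupcap_adj' n i phi p : (i.+3 <= n)%N -> p \in paths 0 n ->
  cupcap i.+1 (cupcap i (cupcap i.+1 phi)) p = cupcap i.+1 phi p.
Proof.
case: n => [|[|n]] //; rewrite !ltnS mem_paths => le_in /andP[/eqP sp vp].
apply: (eq_cup delta i.+1 vp sp) => z; rewrite mem_paths => /andP[/eqP sz vz].
by rewrite /cupcap capS_cup ?sz // cap_cupS ?sz.
Qed.

Lemma cupcap_far i j phi p : (i.+1 < j)%N ->
  cupcap i (cupcap j phi) p = cupcap j (cupcap i phi) p.
Proof.
case: j => [|[|k]] //; rewrite !ltnS => ik; rewrite /cupcap.
have -> : cap i 0 (cup k.+2 0 (cap k.+2 0 phi)) = cup k 0 (cap i 0 (cap k.+2 0 phi)).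
  by apply: funext => z; rewrite cap_cup_far.
have -> : cap k.+2 0 (cup i 0 (cap i 0 phi)) = cup i 0 (cap k 0 (cap i 0 phi)).
  by apply: funext => z; rewrite cap_far_cup.
have -> : cap k 0 (cap i 0 phi) = cap i 0 (cap k.+2 0 phi).
  by apply: funext => z; rewrite cap_cap.
by rewrite cup_cup.
Qed.

Lemma cupcap_kernel n phi : (3 < n)%N ->
  (forall i p, (i < 3)%N -> p \in paths 0 n -> cupcap i phi p = 0) ->
  forall p, p \in paths 0 n -> phi p = 0.
Proof.
case: n => [|[|n]] //; rewrite !ltnS => n1 H p pn.
have lt : (last 0%N p < n.+2)%N.
  move: (pn); rewrite mem_paths => /andP[_ /(vpath_lt4 (ltn0Sn 3)) l4].
  by apply: leq_trans l4 _.
apply: (cap_kernel delta_root lt) (erefl _) => // i r le_in i3 rn _.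
by apply: (cup_eq0 le_in) rn => z zn; apply: H.
Qed.

End PathOperators.

(** * Dimension of the simple modules *)

Section WordVectors.
Variables (K : fieldType) (delta : K).
Hypothesis delta_root : delta ^+ 4 - 3 * delta ^+ 2 + 1 = 0.
Variable t : nat.

Local Notation cap := (cap delta).
Local Notation cup := (cup delta).
Local Notation path_form := (path_form delta).
Local Notation gram_words := (gram_words delta).

(** The identity diagram corresponds to the indicator of the straight path 0, 1, ..., t. *)
Fixpoint word_vec (w : seq nat) : seq nat -> K :=
  if w is j :: y then cup j 0 (word_vec y) else fun p => (p == iota 1 t)%:R.

(** The branches of [cap_word] are the relations between [cap] and [cup]. For the empty word, every
    cap kills the straight path, since that path never returns to a vertex. *)
Lemma cap_word_vec w n i p : word_ok t w -> n.+2 = (t + (size w).*2)%N -> (i <= n)%N ->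
  p \in paths 0 n ->
  cap i 0 (word_vec w) p = if cap_word w i is Some (e, z) then delta ^+ e * word_vec z p else 0.
Proof.
elim: w n i p => [|j y IH] n i p.
  rewrite addn0 /= => _ nt le_in; rewrite mem_paths => /andP[/eqP sp vp].
  have il : size (take i p) = i by rewrite size_takel // sp.
  rewrite -[in LHS](cat_take_drop i p) -{1}il cap_cat; set l := take i p.
  rewrite big1 ?mulr0 // => b _; case: eqP => // E.
  have E1 : last 0%N l = i.+2.
    have := congr1 (nth 0%N ^~ i.+1) E; rewrite nth_cat il ltnNge leqnSn /=.
    by rewrite subSnn /= nth_iota //; lia.
  have E2 : l = iota 1 i.
    have := congr1 (take i) E; rewrite take_cat il ltnn subnn take0 cats0 => ->.
    by rewrite take_iota; congr iota; lia.
  by move: E1; rewrite E2 last_iota1; lia.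
move=> /= /andP[le_j oky]; rewrite doubleS !addnS => -[sy] le_in pn.
move: (pn); rewrite mem_paths => /andP[/eqP sp vp].
case: eqP => [->|ij]; first by rewrite cap_cup_same // sp sy.
case: ifP => [/orP[]/eqP ej|far].
- by rewrite ej mul1r capS_cup // sp -ej; lia.
- by rewrite ej mul1r cap_cupS // sp -ej; lia.
case: ltnP => [lt_ij|le_ji].
- have [k ek] : exists k, j = k.+2 by exists j.-2; lia.
  case: n sy le_in pn sp => [|[|n]] sy le_in pn sp; try lia.
  rewrite ek cap_cup_far //; last by lia.
  have le_in' : (i <= n)%N by lia.
  rewrite (@eq_cup _ delta _ _ _ (fun z => if cap_word y i is Some (e, z') then delta ^+ e * word_vec z' z else 0) p n vp sp).
    case: (cap_word y i) => [[e z]|] /=; last by rewrite cup0.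
    by rewrite cup_scale.
  by move=> z zn; exact: (IH n i z oky sy le_in' zn).
- have [k ek] : exists k, i = k.+2 by exists i.-2; lia.
  case: n sy le_in pn sp => [|[|n]] sy le_in pn sp; try lia.
  rewrite ek cap_far_cup //; last by lia.
  have le_kn : (k <= n)%N by lia.
  rewrite (@eq_cup _ delta _ _ _ (fun z => if cap_word y k is Some (e, z') then delta ^+ e * word_vec z' z else 0) p n vp sp).
    rewrite /=; case: (cap_word y k) => [[e z]|] /=; last by rewrite cup0.
    by rewrite cup_scale.
  by move=> z zn; exact: (IH n k z oky sy le_kn zn).
Qed.

Hypothesis t4 : (t < 4)%N.

Lemma straight_path p : p \in paths 0 t -> last 0%N p = t -> p = iota 1 t.
Proof.
(* As t is at most 3, this is decided by listing the paths of length t. *)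
move=> pt lt; apply/eqP; move: lt => /eqP; apply/implyP; move: p pt; apply/allP.
by case: t t4 => [|[|[|[|]]]].
Qed.

Lemma straight_mem : iota 1 t \in paths 0 t.
Proof. by rewrite mem_paths size_iota eqxx; case: t t4 => [|[|[|[|]]]]. Qed.

Lemma path_form_nil phi : path_form 0 t t phi (word_vec [::]) = path_weight delta (iota 1 t) * phi (iota 1 t).
Proof.
rewrite /path_form (big_rem (iota 1 t)) ?straight_mem //= last_iota1 !eqxx mulr1.
rewrite big_seq_cond big1 ?addr0 // => p; rewrite mem_rem_uniq ?paths_uniq // inE.
by case/andP => /andP[/negbTE -> _] _; rewrite mulr0.
Qed.

Lemma path_weight_neq0 n p : p \in paths 0 n -> path_weight delta p != 0.
Proof.
rewrite mem_paths => /andP[_]; elim: p 0%N {n} => [|b p IH] a /=.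
  by rewrite /path_weight big_nil oner_neq0.
case/andP=> /nbrsP[_ b4 _] vp; rewrite /path_weight big_cons mulf_neq0 ?invr_eq0 ?qdim_neq0 //.
exact: IH vp.
Qed.

Lemma path_form_word_vec w1 w2 n : word_ok t w1 -> word_ok t w2 ->
  n = (t + (size w1).*2)%N -> n = (t + (size w2).*2)%N ->
  path_form 0 t n (word_vec w1) (word_vec w2) = path_weight delta (iota 1 t) * gram_words w1 w2.
Proof.
elim: w2 w1 n => [|j y IH] w1 n ok1 ok2 s1 s2.
  move: s2 => /=; rewrite addn0 => s2; case: w1 ok1 s1 => [|i w1] ok1 s1.
    by rewrite s2 path_form_nil /= eqxx.
  by move: s1 => /=; lia.
case/andP: ok2 => le_j oky; move: s2; rewrite /= doubleS !addnS.
case: n s1 => [|[|n]] // s1 [s2]; have le_jn : (j <= n)%N by rewrite s2.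
rewrite path_form_cup //.
have -> : path_form 0 t n (cap j 0 (word_vec w1)) (word_vec y) = path_form 0 t n
    (fun p => if cap_word w1 j is Some (e, z) then delta ^+ e * word_vec z p else 0) (word_vec y).
  rewrite /path_form big_seq_cond [RHS]big_seq_cond; apply: eq_bigr => p /andP[pn _].
  by rewrite (cap_word_vec ok1 s1).
case E: (cap_word w1 j) => [[e z]|]; last first.
  by rewrite mulr0 /path_form big1 // => p _; rewrite mulr0 mul0r.
have [okz sz] := cap_word_word_ok ok1 s1 le_jn E.
rewrite mulrCA -(IH z n) // /path_form mulr_sumr; apply: eq_bigr => p _.
by rewrite [path_weight _ _ * (_ * _)]mulrCA -!mulrA.
Qed.

(** Spanning is put as triviality of the orthogonal complement, the form in which induction closes:
    by adjointness, phi orthogonal to all words i :: w means that its cap at i is orthogonal to all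
    shorter words. So all caps of phi vanish, and [cap_kernel] applies. *)
Lemma word_vec_span n phi : (t <= n)%N -> odd t = odd n ->
  (forall w, word_ok t w -> n = (t + (size w).*2)%N -> path_form 0 t n phi (word_vec w) = 0) ->
  forall p, p \in paths 0 n -> last 0%N p = t -> phi p = 0.
Proof.
elim/ltn_ind: n phi => n IH phi; rewrite leq_eqVlt => /orP[/eqP <- _ H p pt lp|].
  rewrite (straight_path pt lp); have := H [::] isT; rewrite addn0 => /(_ erefl).
  by rewrite path_form_nil => /eqP; rewrite mulf_eq0 (negbTE (path_weight_neq0 straight_mem)) => /eqP.
case: n IH => [|[|n]] IH //.
  by case: t => [|u] //= ; rewrite ltnS ltn0.
move=> lt_t ot H; have le_tn : (t <= n)%N.
  by move: lt_t ot; rewrite ltnS leq_eqVlt => /orP[/eqP ->|//] /=; case: (odd n).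
apply: (cap_kernel delta_root) => // i r le_in _ rn lr.
apply: (IH n _ _ le_tn) rn lr => //; first by move: ot => /=; rewrite negbK.
move=> w okw sw; rewrite -path_form_cup //.
by apply: (H (i :: w)); rewrite /= ?okw -?sw ?le_in // doubleS !addnS -sw.
Qed.

End WordVectors.

(** [dimension] is a choice, so its value requires uniqueness: two coordinate maps yield mutually
    inverse matrices, whose ranks bound each size by the other. *)
Lemma dimension_eq (K : fieldType) (V : lmodType K) (N : nat) (f : V -> 'rV[K]_N) :
  linear f -> bijective f -> dimension V = N.
Proof.
move=> lin_f bij_f.
have ax : $|Vector.axiom N V| by apply: squash; exists f.
apply: xget_unique => // d [[g lin_g bij_g]].
have [g' gK g'K] := bij_g; have [f' fK f'K] := bij_f.
pose gl : {linear V -> 'rV[K]_d} := HB.pack g (GRing.isLinear.Build _ _ _ _ g lin_g).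
pose fl : {linear V -> 'rV[K]_N} := HB.pack f (GRing.isLinear.Build _ _ _ _ f lin_f).
have lin_h : linear (g \o f').
  move=> a x y /=; rewrite -[RHS]/(a *: gl (f' x) + gl (f' y)) -linearP.
  congr g; apply: (can_inj fK); rewrite f'K.
  by rewrite -[RHS]/(fl (a *: f' x + f' y)) linearP /= !f'K.
pose h : {linear 'rV[K]_N -> 'rV[K]_d} :=
  HB.pack (g \o f') (GRing.isLinear.Build _ _ _ _ (g \o f') lin_h).
have lin_k : linear (f \o g').
  move=> a x y /=; rewrite -[RHS]/(a *: fl (g' x) + fl (g' y)) -linearP.
  congr f; apply: (can_inj gK); rewrite g'K.
  by rewrite -[RHS]/(gl (a *: g' x + g' y)) linearP /= !g'K.
pose k : {linear 'rV[K]_d -> 'rV[K]_N} :=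
  HB.pack (f \o g') (GRing.isLinear.Build _ _ _ _ (f \o g') lin_k).
have hk : lin1_mx k *m lin1_mx h = 1%:M.
  apply/row_matrixP => i; rewrite !rowE mulmxA !mul_rV_lin1 mulmx1 /=.
  by rewrite fK g'K.
have kh : lin1_mx h *m lin1_mx k = 1%:M.
  apply/row_matrixP => i; rewrite !rowE mulmxA !mul_rV_lin1 mulmx1 /=.
  by rewrite gK f'K.
have dN : (d <= N)%N by rewrite -(mxrank1 K d) -hk (leq_trans (mxrankM_maxl _ _)) // rank_leq_col.
have Nd : (N <= d)%N by rewrite -(mxrank1 K N) -kh (leq_trans (mxrankM_maxl _ _)) // rank_leq_col.
by apply/eqP; rewrite eqn_leq dN Nd.
Qed.

Lemma dimension_quot (K : fieldType) (V : lmodType K) (U : submodule V) (N : nat)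
    (g : {linear V -> 'rV[K]_N}) :
  (forall y, exists v, g v = y) ->
  (forall v, (v \in submodule_pred U) = (g v == 0)) ->
  dimension (mod_quot U) = N.
Proof.
move=> surj ker; pose f (x : mod_quot U) := g (mod_repr x).
have f_pi v : f (mod_pi U v) = g v.
  apply/eqP; rewrite -subr_eq0 -linearB -ker -mod_pi_eq mod_reprK eqxx //.
apply: (@dimension_eq _ _ _ f).
  move=> a x y; rewrite -[x]mod_reprK -[y]mod_reprK.
  by rewrite -linearP !f_pi linearP.
have [s gs] := choice surj.
exists (fun y => mod_pi U (s y)) => [x|y]; last by rewrite f_pi.
rewrite -[RHS]mod_reprK; apply/eqP; rewrite mod_pi_eq ker linearB gs.
by rewrite subrr.
Qed.

Section Ell.
Variables (K : fieldType) (q : K).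
Let delta := - (q + q^-1).
Hypothesis delta_root : delta ^+ 4 - 3 * delta ^+ 2 + 1 = 0.
Variables t n : nat.
Hypotheses (t4 : (t < 4)%N) (le_tn : (t <= n)%N) (odd_tn : odd t = odd n).

Definition paths_to := [seq p <- paths 0 n | last 0%N p == t].
Let N := size paths_to.

Let wordP (D : monic_diagram t n) : {w | word_diag w (val D)}.
Proof. by apply: cid; apply: TL_monic_word; apply: (valP D). Qed.

Let vecD (D : monic_diagram t n) : seq nat -> K := word_vec delta t (sval (wordP D)).

Let wordD_ok D : word_ok t (sval (wordP D)) /\ n = (t + (size (sval (wordP D))).*2)%N.
Proof.
case: (wordP D) => w wD /=.
by split; [apply: word_diag_ok wD | apply: word_diag_size wD].
Qed.

Let c := path_weight delta (iota 1 t).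

Let c_neq0 : c != 0.
Proof. by apply: path_weight_neq0 (straight_mem t4). Qed.

Let gramD (D1 D2 : monic_diagram t n) :
  path_form delta 0 t n (vecD D1) (vecD D2) = c * gram q D1 D2.
Proof.
have [ok1 s1] := wordD_ok D1; have [ok2 s2] := wordD_ok D2.
rewrite /vecD path_form_word_vec //; congr (_ * _).
by rewrite -(gram_word _ (svalP (wordP D1)) (svalP (wordP D2))).
Qed.

Let span phi : (forall D, path_form delta 0 t n phi (vecD D) = 0) ->
  forall p, p \in paths 0 n -> last 0%N p = t -> phi p = 0.
Proof.
move=> H; apply: (word_vec_span delta_root) => // w okw sw.
have [D wD] := word_ok_diag okw sw; have TD := word_diag_monic wD.
pose D0 : monic_diagram t n := Sub D TD.
have [ok0 s0] := wordD_ok D0.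
(* The word w and the word chosen for its diagram may differ. Their vectors pair equally with every
   word vector, as both pairings compute Gram entries of the same diagram; hence they agree on paths
   to t. *)
pose psi p := word_vec delta t w p - vecD D0 p.
have psi0 p : p \in paths 0 n -> last 0%N p = t -> psi p = 0.
  apply: (word_vec_span delta_root) => // v okv sv.
  have [Dv wDv] := word_ok_diag okv sv.
  have -> : path_form delta 0 t n psi (word_vec delta t v) =
      path_form delta 0 t n (word_vec delta t w) (word_vec delta t v) -
      path_form delta 0 t n (vecD D0) (word_vec delta t v).
    by rewrite /path_form -sumrB; apply: eq_bigr => r _; rewrite /psi; ring.
  rewrite /vecD !path_form_word_vec // -(gram_word _ wD wDv).
  by rewrite -(gram_word _ (svalP (wordP D0)) wDv) subrr.
rewrite -(H D0) /path_form big_seq_cond [RHS]big_seq_cond.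
apply: eq_bigr => p /andP[pn /eqP lp]; congr (_ * _).
by apply/eqP; rewrite -subr_eq0; apply/eqP/psi0.
Qed.

Let B : 'M[K]_(#|{: monic_diagram t n}|, N) :=
  \matrix_(i, k) vecD (enum_val i) (nth [::] paths_to k).

Lemma path_form_paths_to phi psi : path_form delta 0 t n phi psi =
  \sum_(k < N) path_weight delta (nth [::] paths_to k) * phi (nth [::] paths_to k)
     * psi (nth [::] paths_to k).
Proof. by rewrite /path_form -big_filter (big_nth [::]) big_mkord. Qed.

Lemma paths_toP (k : 'I_N) : nth [::] paths_to k \in paths 0 n /\
  last 0%N (nth [::] paths_to k) = t.
Proof.
by have := mem_nth [::] (ltn_ord k); rewrite mem_filter => /andP[/eqP -> ->].
Qed.

Lemma paths_to_uniq : uniq paths_to.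
Proof. by rewrite filter_uniq ?paths_uniq. Qed.

Let B_full : row_full B.
Proof.
rewrite /row_full -mxrank_tr -/(row_free B^T) -kermx_eq0.
apply/eqP/row_matrixP => i; rewrite row0; set x := row i _.
have xB : x *m B^T = 0 by rewrite /x -row_mul mulmx_ker row0.
(* Dividing the relation x by the path weights gives a function whose pairings with the diagram
   vectors are the entries of x B^T, so it is orthogonal to all of them. *)
pose phi p := if insub (index p paths_to) is Some k
  then x 0 k / path_weight delta p else 0.
have phiE (k : 'I_N) : phi (nth [::] paths_to k) = x 0 k / path_weight delta (nth [::] paths_to k).
  by rewrite /phi index_uniq ?paths_to_uniq // valK.
have phi0 : forall p, p \in paths 0 n -> last 0%N p = t -> phi p = 0.
  apply: span => D; move/matrixP/(_ 0 (enum_rank D)): xB; rewrite !mxE => <-.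
  rewrite path_form_paths_to; apply: eq_bigr => k _; have [pn _] := paths_toP k.
  by rewrite phiE !mxE enum_rankK mulrCA mulfV ?mulr1 //; apply: path_weight_neq0 pn.
apply/rowP => k; rewrite [RHS]mxE; have [pn lp] := paths_toP k.
have := phi0 _ pn lp; rewrite phiE => /eqP; rewrite mulf_eq0 invr_eq0.
by rewrite (negbTE (path_weight_neq0 delta_root pn)) orbF => /eqP.
Qed.

Let Phi (u : cell_module K t n) : 'rV[K]_N :=
  (\row_i (u (enum_val i) : K)) *m B.

Let Phi_lin : linear Phi.
Proof.
move=> a u v; rewrite /Phi scalemxAl -mulmxDl; congr (_ *m _).
by apply/rowP => i; rewrite !mxE !ffunE.
Qed.

Let PhiE u k : Phi u 0 k = \sum_D (u D : K) * vecD D (nth [::] paths_to k).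
Proof.
rewrite mxE [RHS](reindex _ (onW_bij _ (@enum_val_bij _))).
by apply: eq_bigr => i _; rewrite !mxE.
Qed.

Let cell_formE u v : c * cell_form q u v =
  \sum_(k < N) path_weight delta (nth [::] paths_to k) * Phi u 0 k * Phi v 0 k.
Proof.
transitivity (\sum_D1 \sum_D2 (u D1 : K) * v D2 * path_form delta 0 t n (vecD D1) (vecD D2)).
  rewrite mulr_sumr; apply: eq_bigr => D1 _; rewrite mulr_sumr; apply: eq_bigr => D2 _.
  by rewrite gramD mulrCA.
under eq_bigr => D1 _ do under eq_bigr => D2 _ do rewrite path_form_paths_to mulr_sumr.
under eq_bigr => D1 _ do rewrite exchange_big.
rewrite exchange_big; apply: eq_bigr => k _ /=.
rewrite !PhiE -mulrA mulr_suml mulr_sumr; apply: eq_bigr => D1 _.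
rewrite !mulr_sumr; apply: eq_bigr => D2 _; ring.
Qed.

(** Up to the non-zero factor c, the cell form is the pull-back along the surjection [Phi] of a
    non-degenerate diagonal form on K^N, so its radical is the kernel of [Phi]. *)
Lemma ell_paths : ell q t n = size [seq p <- paths 0 n | last 0%N p == t].
Proof.
rewrite /ell /cell_index le_tn odd_tn eqxx.
pose g : {linear cell_module K t n -> 'rV[K]_N} :=
  HB.pack Phi (GRing.isLinear.Build _ _ _ _ Phi Phi_lin).
have surj y : exists v, g v = y.
  have /submxP[x ->] : (y <= B)%MS by apply: submx_full.
  exists [ffun D => x 0 (enum_rank D)]; rewrite /= /Phi; congr (_ *m _).
  by apply/rowP => i; rewrite mxE ffunE enum_valK.
apply: (dimension_quot surj) => u; apply/asboolP/eqP => [H|gu v].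
  apply/rowP => k; rewrite [RHS]mxE; have [pn _] := paths_toP k.
  have [v gv] := surj (delta_mx 0 k); have := cell_formE u v.
  rewrite H mulr0 (bigD1 k) //= big1 ?addr0 => [/esym/eqP|l lk].
    rewrite -[Phi v]/(g v) gv [delta_mx _ _ _ _]mxE !eqxx mulr1 mulf_eq0.
    by rewrite (negbTE (path_weight_neq0 delta_root pn)) => /eqP.
  by rewrite -[Phi v]/(g v) gv [delta_mx _ _ _ _]mxE (negbTE lk) andbF mulr0.
have := cell_formE u v; rewrite big1 => [/eqP|k _].
  by rewrite mulf_eq0 (negbTE c_neq0) => /eqP.
by rewrite -[Phi u]/(g u) gu [(0 : 'rV__) _ _]mxE mulr0 mul0r.
Qed.

End Ell.

(** * The Jones-Wenzl idempotent and the spanning set of Boolean words *)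

Section JonesWenzl.
Variables (K : fieldType) (A : algType K) (delta : K).
Implicit Types x y z : A.

(** The ratios d_1/d_2 and d_2/d_3 in Wenzl's recursion P_{k+1} = P_k - (d_{k-1}/d_k) P_k f_k
    P_k. *)
Definition coef3 : K := delta / (delta ^+ 2 - 1).
Definition coef4 : K := (delta ^+ 2 - 1) / (delta ^+ 3 - 2 * delta).

Definition jw2 x : A := 1 - delta^-1 *: x.
Definition jw3 x y : A := jw2 x - coef3 *: (jw2 x * y * jw2 x).
Definition jw4 x y z : A := jw3 x y - coef4 *: (jw3 x y * z * jw3 x y).

Hypotheses (d1 : delta != 0) (d2 : delta ^+ 2 - 1 != 0)
  (d3 : delta ^+ 3 - 2 * delta != 0).

Variables x y z : A.
Hypotheses (xx : x * x = delta *: x) (yy : y * y = delta *: y)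
  (zz : z * z = delta *: z) (xyx : x * y * x = x) (yxy : y * x * y = y)
  (yzy : y * z * y = y) (zyz : z * y * z = z) (xz : x * z = z * x).

Local Notation P := (jw2 x).
Local Notation T := (jw3 x y).
Local Notation E := (jw4 x y z).

Lemma x_jw2 : x * P = 0.
Proof. by rewrite mulrBr mulr1 -scalerAr xx scalerA mulVf // scale1r subrr. Qed.

Lemma jw2_x : P * x = 0.
Proof. by rewrite mulrBl mul1r -scalerAl xx scalerA mulVf // scale1r subrr. Qed.

Lemma jw2_idem : P * P = P.
Proof. by rewrite {1}/jw2 mulrBl mul1r -scalerAl x_jw2 scaler0 subr0. Qed.

Lemma jw2_comm : z * P = P * z.
Proof. by rewrite mulrBr mulrBl mul1r mulr1 -scalerAl -scalerAr xz. Qed.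

Lemma y_jw2_y : y * P * y = coef3^-1 *: y.
Proof.
rewrite mulrBr mulrBl mulr1 yy -scalerAr -scalerAl yxy -scalerBl.
by congr (_ *: _); rewrite /coef3; field; rewrite d1 d2.
Qed.

Lemma coef3_neq0 : coef3 != 0.
Proof. by rewrite mulf_neq0 ?invr_eq0. Qed.

Lemma coef4_neq0 : coef4 != 0.
Proof. by rewrite mulf_neq0 ?invr_eq0. Qed.

Lemma x_jw3 : x * T = 0.
Proof. by rewrite mulrBr -scalerAr !mulrA x_jw2 !mul0r scaler0 subr0. Qed.

Lemma jw3_x : T * x = 0.
Proof. by rewrite mulrBl -scalerAl -!mulrA jw2_x !mulr0 scaler0 subr0. Qed.

Lemma y_jw3 : y * T = 0.
Proof.
rewrite mulrBr -scalerAr !mulrA y_jw2_y -scalerAl scalerA mulfV ?coef3_neq0 //.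
by rewrite scale1r subrr.
Qed.

Lemma jw3_y : T * y = 0.
Proof.
rewrite mulrBl -scalerAl -!mulrA [y * (P * y)]mulrA y_jw2_y -scalerAr scalerA.
by rewrite mulfV ?coef3_neq0 // scale1r subrr.
Qed.

Lemma jw2_jw3 : P * T = T.
Proof. by rewrite mulrBr -scalerAr !mulrA jw2_idem. Qed.

Lemma jw3_jw2 : T * P = T.
Proof. by rewrite mulrBl -scalerAl -[_ * P * P]mulrA jw2_idem. Qed.

Lemma jw3_idem : T * T = T.
Proof.
by rewrite {2}/jw3 mulrBr -scalerAr !mulrA jw3_jw2 jw3_y !mul0r scaler0 subr0.
Qed.

(** As z commutes with P, only z * z and z * y * z have to be reduced; the coefficient is delta -
    d_1/d_2 = d_3/d_2 by the Chebyshev recursion. *)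
Lemma z_jw3_z : z * T * z = coef4^-1 *: (z * P).
Proof.
have -> : z * T * z = (z * z) * P - coef3 *: (P * (z * y * z) * P).
  rewrite mulrBr mulrBl -scalerAr -scalerAl -!mulrA -jw2_comm.
  by rewrite [in LHS]mulrA jw2_comm -!mulrA.
rewrite zz zyz -jw2_comm -mulrA jw2_idem -scalerAl -scalerBl.
by congr (_ *: _); rewrite /coef3 /coef4; field; rewrite d2 d3.
Qed.

Lemma x_jw4 : x * E = 0.
Proof. by rewrite mulrBr -scalerAr !mulrA x_jw3 !mul0r scaler0 subr0. Qed.

Lemma jw4_x : E * x = 0.
Proof. by rewrite mulrBl -scalerAl -!mulrA jw3_x !mulr0 scaler0 subr0. Qed.

Lemma y_jw4 : y * E = 0.
Proof. by rewrite mulrBr -scalerAr !mulrA y_jw3 !mul0r scaler0 subr0. Qed.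

Lemma jw4_y : E * y = 0.
Proof. by rewrite mulrBl -scalerAl -!mulrA jw3_y !mulr0 scaler0 subr0. Qed.

Lemma z_jw4 : z * E = 0.
Proof.
rewrite mulrBr -scalerAr !mulrA z_jw3_z -scalerAl scalerA mulfV ?coef4_neq0 //.
by rewrite scale1r -mulrA jw2_jw3 subrr.
Qed.

Lemma jw4_z : E * z = 0.
Proof.
rewrite mulrBl -scalerAl -!mulrA [z * (T * z)]mulrA z_jw3_z -scalerAr scalerA.
by rewrite mulfV ?coef4_neq0 // scale1r jw2_comm mulrA jw3_jw2 subrr.
Qed.

Lemma jw4_jw3 : E * T = E.
Proof. by rewrite mulrBl -scalerAl -[_ * T * T]mulrA jw3_idem. Qed.

Lemma jw4_idem : E * E = E.
Proof.
by rewrite {2}/jw4 mulrBr -scalerAr !mulrA jw4_jw3 jw4_z mul0r scaler0 subr0.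
Qed.

Let Y := y * x * z * y.
Let Q := P * y * P.

Lemma jw3_z_jw3 : T * z * T =
  z * P - coef3 *: (z * Q) - coef3 *: (Q * z) + coef3 ^+ 2 *: Q
  - (coef3 ^+ 2 / delta) *: (P * Y * P).
Proof.
have PzP : P * z * P = z * P by rewrite -jw2_comm -mulrA jw2_idem.
have PzQ : P * z * Q = z * Q by rewrite -jw2_comm -[_ * P * Q]mulrA /Q !mulrA -[z * P * P]mulrA jw2_idem.
have QzP : Q * z * P = Q * z by rewrite -mulrA jw2_comm mulrA /Q -[_ * P * P]mulrA jw2_idem.
have QzQ : Q * z * Q = Q - delta^-1 *: (P * Y * P).
  have -> : Q * z * Q = P * (y * z * P * y) * P.
    rewrite /Q -!mulrA; congr (_ * (_ * _)); rewrite !mulrA -[P * z]jw2_comm.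
    by rewrite -[z * P * P]mulrA jw2_idem.
  have -> : y * z * P * y = y - delta^-1 *: Y.
    rewrite mulrBr mulrBl mulr1 yzy -scalerAr -scalerAl /Y.
    by rewrite -[y * z * x]mulrA -xz mulrA.
  by rewrite (mulrBr P) mulrBl -scalerAr -scalerAl /Y /Q !mulrA.
move: PzP PzQ QzP QzQ; rewrite /jw3 -/Q; move: (P) (Q) => p q PzP PzQ QzP QzQ.
rewrite mulrBl mulrBl !mulrBr -!scalerAl -!scalerAr PzP PzQ QzP QzQ.
rewrite [coef3 *: (coef3 *: _)]scalerA -expr2 scalerBr scalerA opprB -!addrA.
by congr (_ + (_ + _)); rewrite [RHS]addrC -addrA.
Qed.

Lemma jw2_Y_jw2 : P * Y * P =
  Y - delta^-1 *: (z * (x * y)) - delta^-1 *: (y * x * z) + delta^-2 *: (z * x).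
Proof.
have xY : x * Y = z * (x * y) by rewrite /Y !mulrA xyx xz.
have Yx : Y * x = y * x * z.
  by rewrite /Y -[y * x * z]mulrA xz -!mulrA [x * (y * x)]mulrA xyx -xz.
have xYx : x * Y * x = z * x by rewrite xY -!mulrA [x * (y * x)]mulrA xyx.
have -> : P * Y = Y - delta^-1 *: (x * Y) by rewrite mulrBl mul1r -scalerAl.
rewrite /jw2 mulrBr mulr1 mulrBl -!scalerAr -scalerAl xYx Yx xY.
by rewrite opprB scalerA -expr2 exprVn addrA addrAC.
Qed.

(** In E = T - coef4 T z T, the expansion of T z T contains f_2 f_1 f_3 f_2 with the non-zero
    coefficient - coef3^2 / delta. Solved for that word, the right side consists of E and of terms
    with z absent or at one end, the shapes that the spanning argument can absorb. *)
Lemma jw4_relation : y * x * z * y =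
  delta^-1 *: (z * (x * y)) + delta^-1 *: (y * x * z) - delta^-2 *: (z * x)
  + (delta / coef3 ^+ 2) *: (z * P - coef3 *: (z * Q) - coef3 *: (Q * z)
      + coef3 ^+ 2 *: Q - coef4^-1 *: (T - E)).
Proof.
have -> : coef4^-1 *: (T - E) = T * z * T.
  by rewrite /jw4 opprB addrCA subrr addr0 scalerA mulVf ?coef4_neq0 // scale1r.
rewrite jw3_z_jw3 opprB addrCA subrr addr0 scalerA.
have -> : delta / coef3 ^+ 2 * (coef3 ^+ 2 / delta) = 1.
  by field; rewrite d1 coef3_neq0.
rewrite scale1r jw2_Y_jw2 -/Y.
move: (delta^-1 *: _) (delta^-1 *: _) (delta^-2 *: _) => b a c.
have -> : Y - a - b + c = Y - (a + b - c) by rewrite opprB [c - _]addrC opprD !addrA.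
by rewrite addrC subrK.
Qed.

End JonesWenzl.

(** * Translates of the idempotent by braid conjugation *)

Section Shift.
Variables (K : fieldType) (A : algType K) (q : K).
Hypothesis q0 : q != 0.
Let delta := - (q + q^-1).
Implicit Types x y z w : A.

(** Up to a scalar, the Kauffman-bracket image of a braid generator; the inverse has q^-1 in place
    of q because q + q^-1 + delta = 0. *)
Definition braid x : A := 1 + q *: x.
Definition braid_inv x : A := 1 + q^-1 *: x.

Lemma braidK x : x * x = delta *: x -> braid x * braid_inv x = 1.
Proof.
move=> xx; rewrite mulrDl !mulrDr !mul1r mulr1 -scalerAl -scalerAr scalerA mulfV //.
rewrite scale1r xx -addrA -!scalerDl.
have -> : q^-1 + (q + delta) = 0 by rewrite /delta; ring.
by rewrite scale0r addr0.
Qed.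

Lemma braid_comm x y : x * y = y * x -> braid x * y = y * braid x.
Proof. by move=> xy; rewrite mulrDl mulrDr mul1r mulr1 -scalerAl -scalerAr xy. Qed.

(** Both sides equal q y x, because 1 + q delta + q^2 = 0. *)
Lemma braid_slide x y : x * x = delta *: x -> y * y = delta *: y ->
  x * y * x = x -> y * x * y = y ->
  braid x * braid y * x = y * (braid x * braid y).
Proof.
have H : 1 + q * delta + q * q = 0 by rewrite /delta; field.
move=> xx yy xyx yxy; transitivity (q *: (y * x)).
  rewrite -mulrA [braid y * x]mulrDl mul1r -scalerAl mulrDr -scalerAr.
  rewrite !mulrDl !mul1r -!scalerAl mulrA xyx xx !scalerDr !scalerA.
  rewrite addrCA -[RHS]addr0; congr (_ + _).
  by rewrite -{1}[x]scale1r -!scalerDl H scale0r.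
rewrite mulrDl mul1r mulrDr -scalerAl mulrDr -scalerAr mulrDr mulr1 -scalerAr.
rewrite mulr1 -scalerAr [y * (x + _)]mulrDr -scalerAr mulrA yxy yy !scalerDr !scalerA.
rewrite [q *: (y * x) + _]addrC addrA -[LHS]add0r; congr (_ + _).
by rewrite -{1}[y]scale1r -!scalerDl H scale0r.
Qed.

Lemma jw4_intertwine g x y z x' y' z' : g * x = x' * g -> g * y = y' * g ->
  g * z = z' * g -> g * jw4 delta x y z = jw4 delta x' y' z' * g.
Proof.
move=> gx gy gz.
have j2 : g * jw2 delta x = jw2 delta x' * g.
  by rewrite mulrBr mulrBl mulr1 mul1r -scalerAr -scalerAl gx.
have j3 : g * jw3 delta x y = jw3 delta x' y' * g.
  rewrite /jw3 (mulrBr g) [(_ - _ *: (_ * y' * _)) * g]mulrBl -scalerAr -scalerAl j2; congr (_ - _); congr (_ *: _).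
  by rewrite !mulrA j2 -[_ * g * y]mulrA gy -!mulrA j2.
rewrite /jw4 (mulrBr g) [(_ - _ *: (_ * z' * _)) * g]mulrBl -scalerAr -scalerAl j3; congr (_ - _); congr (_ *: _).
by rewrite !mulrA j3 -[_ * g * z]mulrA gz -!mulrA j3.
Qed.

(* The product of the four braid generators 1 + q f conjugates x, y, z to y, z, w. *)
Lemma jw4_shift x y z w :
  x * x = delta *: x -> y * y = delta *: y -> z * z = delta *: z -> w * w = delta *: w ->
  x * y * x = x -> y * x * y = y -> y * z * y = y -> z * y * z = z ->
  z * w * z = z -> w * z * w = w -> x * z = z * x -> x * w = w * x -> y * w = w * y ->
  exists a b, jw4 delta y z w = a * jw4 delta x y z * b.
Proof.
move=> xx yy zz ww xyx yxy yzy zyz zwz wzw xz xw yw.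
have := conj (braid_slide xx yy xyx yxy) (conj (braid_slide yy zz yzy zyz)
  (braid_slide zz ww zwz wzw)).
have := conj (braid_comm (esym xz)) (conj (braid_comm (esym xw)) (braid_comm (esym yw))).
have := conj (braid_comm xz) (conj (braid_comm yw) (braid_comm xw)).
have := conj (braidK xx) (conj (braidK yy) (conj (braidK zz) (braidK ww))).
move: (braid x) (braid y) (braid z) (braid w) (braid_inv x) (braid_inv y)
  (braid_inv z) (braid_inv w) => a b c d a' b' c' d'.
move=> [aa' [bb' [cc' dd']]] [az [bw aw]] [cx [dx dy]] [hx [hy hz]].
exists (a * b * c * d), (d' * c' * b' * a').
rewrite (@jw4_intertwine _ x y z y z w).
- rewrite !mulrA -[_ * d * d']mulrA dd' mulr1 -[_ * c * c']mulrA cc' mulr1.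
  by rewrite -[_ * b * b']mulrA bb' mulr1 -[_ * a * a']mulrA aa' mulr1.
- by rewrite -[_ * d * x]mulrA dx mulrA -[_ * c * x]mulrA cx mulrA hx !mulrA.
- rewrite -[_ * d * y]mulrA dy mulrA -[a * b * c]mulrA -[a * _ * y]mulrA hy.
  by rewrite mulrA az !mulrA.
- rewrite -[_ * c * d]mulrA -[_ * (c * d) * z]mulrA hz mulrA -[a * b * w]mulrA bw.
  by rewrite !mulrA aw.
Qed.

End Shift.

(** * Spanning modulo the ideal by words without repetition *)

Section Boolean.
Variables (K : fieldType) (A : algType K) (q : K).
Hypothesis q0 : q != 0.
Local Notation delta := (- (q + q^-1)).
Hypotheses (d1 : delta != 0) (d2 : delta ^+ 2 - 1 != 0)
  (d3 : delta ^+ 3 - 2 * delta != 0).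
Variable J : {pred A}.
Hypotheses (J0 : 0 \in J) (JD : forall x y, x \in J -> y \in J -> x + y \in J)
  (JM : forall a x b, x \in J -> a * x * b \in J).
Variables (N : nat) (g : nat -> A).
Hypotheses (g_sq : forall i, (i < N)%N -> g i * g i = delta *: g i)
  (g_adj : forall i, (i.+1 < N)%N -> g i * g i.+1 * g i = g i)
  (g_adj' : forall i, (i.+1 < N)%N -> g i.+1 * g i * g i.+1 = g i.+1)
  (g_comm : forall i j, (i.+1 < j < N)%N -> g i * g j = g j * g i)
  (g_jw4 : (2 < N)%N -> jw4 delta (g 0%N) (g 1%N) (g 2%N) \in J).

(** Membership in J is assumed for the first projector only; braid conjugation keeps its translates
    in J. *)
Lemma jw4_shifted i : (i.+2 < N)%N -> jw4 delta (g i) (g i.+1) (g i.+2) \in J.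
Proof.
elim: i => [|i IH] iN; first exact: g_jw4.
have [|||||||||||||a [b ->]] := @jw4_shift K A q q0 (g i) (g i.+1) (g i.+2) (g i.+3);
  try (by [apply: g_sq; lia | apply: g_adj; lia | apply: g_adj'; lia | apply: g_comm; lia]).
by apply/JM/IH; lia.
Qed.

Lemma JZ c x : x \in J -> c *: x \in J.
Proof. by move=> Jx; rewrite -[c *: x]mulr1 -mulr_algl JM. Qed.

(** In a word using each of g 0, ..., g m at most once, g m can be moved to an end: g m.-1, the only
    other letter not commuting with it, occurs on at most one side. *)
Fixpoint bool_span (k : nat) (x : A) : Prop :=
  if k is m.+1 then
    exists u v w, [/\ bool_span m u, bool_span m v, bool_span m w
      & x = u + g m * v + w * g m]
  else exists c, x = c *: 1.

Definition bool_modJ k x : Prop := exists2 s, bool_span k s & x - s \in J.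

Local Notation S := bool_span.
Local Notation M := bool_modJ.

Lemma bool_span0 k : S k 0.
Proof.
elim: k => [|k IH] /=; first by exists 0; rewrite scale0r.
by exists 0, 0, 0; rewrite mulr0 mul0r !addr0.
Qed.

Lemma bool_spanD k x y : S k x -> S k y -> S k (x + y).
Proof.
elim: k x y => [|k IH] x y /=.
  by move=> [c ->] [d ->]; exists (c + d); rewrite scalerDl.
move=> [u [v [w [su sv sw ->]]]] [u' [v' [w' [su' sv' sw' ->]]]].
exists (u + u'), (v + v'), (w + w'); split; [exact: IH | exact: IH | exact: IH |].
by rewrite mulrDr mulrDl addrACA [u + _ + _]addrACA.
Qed.

Lemma bool_spanZ k c x : S k x -> S k (c *: x).
Proof.
elim: k x => [|k IH] x /=; first by move=> [d ->]; exists (c * d); rewrite scalerA.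
move=> [u [v [w [su sv sw ->]]]]; exists (c *: u), (c *: v), (c *: w).
by split; [apply: IH|apply: IH|apply: IH|rewrite !scalerDr scalerAr [c *: (w * _)]scalerAl].
Qed.

Lemma bool_spanS k x : S k x -> S k.+1 x.
Proof.
move=> sx; exists x, 0, 0; rewrite mulr0 mul0r !addr0.
by split=> //; apply: bool_span0.
Qed.

Lemma bool_span_le m k x : (m <= k)%N -> S m x -> S k x.
Proof.
move=> /subnKC <-; elim: (k - m)%N => [|e IH]; first by rewrite addn0.
by move=> sx; rewrite addnS; apply/bool_spanS/IH.
Qed.

Lemma bool_span1 k : S k 1.
Proof. by apply: (@bool_span_le 0) => //; exists 1; rewrite scale1r. Qed.

Lemma bool_span_gen k : S k.+1 (g k).
Proof.
exists 0, 1, 0; rewrite mulr1 mul0r addr0 add0r.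
by split=> //; [apply: bool_span0|apply: bool_span1|apply: bool_span0].
Qed.

Lemma bool_span_comm k j x : (k < j < N)%N -> S k x -> x * g j = g j * x.
Proof.
elim: k x => [|k IH] x /andP[kj jN] /=.
  by move=> [c ->]; rewrite -scalerAl -scalerAr mul1r mulr1.
have kj' : (k < j < N)%N by rewrite (ltnW kj).
have gg : g k * g j = g j * g k by apply: g_comm; rewrite kj.
move=> [u [v [w [su sv sw ->]]]]; rewrite !mulrDl !mulrDr (IH u) //.
rewrite -!mulrA (IH v) // gg mulrA gg.
by congr (_ + _ + _); rewrite mulrA ?gg // !mulrA (IH w).
Qed.

Lemma modJ_of_J k x : x \in J -> M k x.
Proof. by move=> Jx; exists 0; [exact: bool_span0 | rewrite subr0]. Qed.

Lemma modJ_of_span k x : S k x -> M k x.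
Proof. by move=> sx; exists x; rewrite ?subrr. Qed.

Lemma modJD k x y : M k x -> M k y -> M k (x + y).
Proof.
move=> [s ss Js] [r sr Jr]; exists (s + r); first exact: bool_spanD.
by rewrite opprD addrACA JD.
Qed.

Lemma modJZ k c x : M k x -> M k (c *: x).
Proof.
move=> [s ss Js]; exists (c *: s); first exact: bool_spanZ.
by rewrite -scalerBr JZ.
Qed.

Lemma modJS k x : M k x -> M k.+1 x.
Proof. by move=> [s ss Js]; exists s => //; apply: bool_spanS. Qed.

Lemma modJ_genl k x : M k x -> M k.+1 (g k * x).
Proof.
move=> [s ss Js]; exists (g k * s).
  exists 0, s, 0; rewrite mul0r addr0 add0r.
  by split=> //; apply: bool_span0.
by rewrite -mulrBr -[_ * _]mulr1 JM.
Qed.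

Lemma modJ_genr k x : M k x -> M k.+1 (x * g k).
Proof.
move=> [s ss Js]; exists (s * g k).
  exists 0, 0, s; rewrite mulr0 !add0r.
  by split=> //; apply: bool_span0.
by rewrite -mulrBl -[x - s]mul1r JM.
Qed.

(** Left multipliers of the span modulo J. They form a subalgebra, so the task reduces to the
    generators, and membership in the span follows by acting on 1. *)
Definition preserves k u := forall x, M k x -> M k (u * x).
Local Notation L := preserves.

Lemma preserves1 k : L k 1.
Proof. by move=> x; rewrite mul1r. Qed.

Lemma preservesD k u v : L k u -> L k v -> L k (u + v).
Proof. by move=> Lu Lv x Mx; rewrite mulrDl; apply: modJD; [apply: Lu|apply: Lv]. Qed.

Lemma preservesZ k c u : L k u -> L k (c *: u).
Proof. by move=> Lu x Mx; rewrite -scalerAl; apply/modJZ/Lu. Qed.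

Lemma preservesM k u v : L k u -> L k v -> L k (u * v).
Proof. by move=> Lu Lv x Mx; rewrite -mulrA; apply/Lu/Lv. Qed.

Lemma preserves_modJ k u : L k u -> M k u.
Proof. by rewrite -{2}[u]mulr1; apply; apply/modJ_of_span/bool_span1. Qed.

Lemma preserves_span k u : (forall x, S k x -> M k (u * x)) -> L k u.
Proof.
move=> H x [s /H Ms Js]; rewrite -(subrK s x) mulrDr; apply: modJD => //.
by apply: modJ_of_J; rewrite -[_ * _]mulr1 JM.
Qed.

Lemma preserves_bool_span k m s : (forall j, (j < k)%N -> L k (g j)) ->
  (m <= k)%N -> S m s -> L k s.
Proof.
move=> Lg; elim: m s => [|m IH] s mk /=.
  by move=> [c ->]; apply/preservesZ/preserves1.
move=> [u [v [w [/IH Lu /IH Lv /IH Lw ->]]]].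
have Lm := Lg m mk; have mk' := ltnW mk.
by apply: preservesD; [apply: preservesD|]; try apply: preservesM; auto.
Qed.

(** [P] abstracts the context, a factor to the right or to the left of the word; the closure
    hypotheses match the terms of [jw4_relation]. *)
Lemma closed_word_yxzy (P : A -> Prop) i : (i.+2 < N)%N ->
  (forall x y, P x -> P y -> P (x + y)) -> (forall c x, P x -> P (c *: x)) ->
  (forall x, x \in J -> P x) ->
  (forall u, L i.+2 u -> P u) -> (forall u, L i.+2 u -> P (g i.+2 * u)) ->
  (forall u, L i.+2 u -> P (u * g i.+2)) ->
  L i.+2 (g i) -> L i.+2 (g i.+1) ->
  P (g i.+1 * g i * g i.+2 * g i.+1).
Proof.
move=> iN PD PZ PJ PL PzL PLz Lx Ly.
have PB x y : P x -> P y -> P (x - y).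
  by move=> Px Py; apply: PD => //; rewrite -scaleN1r; apply: PZ.
have LB u v : L i.+2 u -> L i.+2 v -> L i.+2 (u - v).
  by move=> Lu Lv; apply: preservesD => //; rewrite -scaleN1r; apply: preservesZ.
have L2 : L i.+2 (jw2 delta (g i)).
  by apply: LB; [apply: preserves1 | apply: preservesZ].
have LQ : L i.+2 (jw2 delta (g i) * g i.+1 * jw2 delta (g i)).
  by do 2?[apply: preservesM => //].
have L3 : L i.+2 (jw3 delta (g i) (g i.+1)).
  by apply: LB => //; apply: preservesZ.
rewrite (@jw4_relation _ _ delta d1 d2 d3 (g i) (g i.+1) (g i.+2));
  try (first [by apply: g_sq; lia | by apply: g_adj; lia | by apply: g_adj'; lia
    | by apply: g_comm; lia]).
have := jw4_shifted iN; move: (jw4 _ _ _ _) => E JE.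
move: (jw3 _ _ _) L3 => T L3; move: (jw2 _ _) L2 LQ => p L2 LQ.
repeat first [apply/PB | apply/PD | apply/PZ];
  first [by apply/PJ | by apply/PzL; do ?[apply/preservesM]
    | by apply/PLz; do ?[apply/preservesM] | by apply/PL; do ?[apply/preservesM]].
Qed.

(** Left multiplication by g j is checked on each summand u, g k * v, w * g k. Commutation, squares
    and adjacent relations settle all cases except the word g i.+1 * g i * g i.+2 * g i.+1, where
    the ideal J is used. *)
Lemma preserves_step k : (k < N)%N -> (forall j, (j < k)%N -> L k (g j)) ->
  forall j, (j < k.+1)%N -> L k.+1 (g j).
Proof.
move=> kN Lg j jk; apply: preserves_span => s [u [v [w [su sv sw ->]]]].
have Mof m x : (m <= k)%N -> S m x -> M k x.
  by move=> mk sx; apply: modJ_of_span; exact: bool_span_le mk sx.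
have Lof m x : (m <= k)%N -> S m x -> L k x.
  by move=> mk; apply: preserves_bool_span.
rewrite !mulrDr; move: jk; rewrite ltnS leq_eqVlt => /orP[/eqP ->|jk].
- apply: modJD; first apply: modJD.
  + by apply/modJ_genl/modJ_of_span.
  + rewrite mulrA g_sq // -scalerAl.
    by apply/modJZ/modJ_genl/modJ_of_span.
  (* The term g k * (w * g k): w is expanded one level further, so that the two outer letters either
     meet or enclose a single g k.-1. *)
  + case: k kN {Lg} su sv sw Mof Lof => [|k] kN su sv sw Mof Lof.
      have [c ->] := sw; rewrite -scalerAl mul1r -scalerAr g_sq // scalerA.
      by rewrite -[g 0%N]mulr1; apply/modJZ/modJ_genl/modJ_of_span/bool_span1.
    have [u' [v' [w' [su' sv' sw' ->]]]] := sw.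
    have cu := bool_span_comm (j := k.+1) _ su'.
    have cv := bool_span_comm (j := k.+1) _ sv'.
    have cw := bool_span_comm (j := k.+1) _ sw'.
    rewrite !mulrDl !mulrDr; apply: modJD; first apply: modJD.
    * rewrite cu ?ltnSn // mulrA g_sq // -scalerAl.
      by apply/modJZ/modJ_genl/(Mof k).
    * rewrite -mulrA cv ?ltnSn // !mulrA g_adj' //.
      by apply/modJ_genl/(Mof k).
    * rewrite !mulrA -cw ?ltnSn // -[_ * g k]mulrA -mulrA g_adj' //.
      by apply/modJ_genr/(Mof k).
- have Lj := Lg _ jk.
  apply: modJD; first apply: modJD.
  + by apply/modJS/Lj/modJ_of_span.
  + case: (ltnP j.+1 k) => [jk1|kj].
      rewrite mulrA g_comm ?jk1 // -mulrA.
      by apply/modJ_genl/Lj/modJ_of_span.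
    have ek : k = j.+1 by apply/eqP; rewrite eqn_leq kj jk.
    subst k; have [a [b [c [sa sb sc ->]]]] := sv.
    have jj : (j < j.+1 < N)%N by rewrite ltnSn.
    rewrite !mulrDr; apply: modJD; first apply: modJD.
    * rewrite -(bool_span_comm jj sa) mulrA.
      by apply/modJ_genr/Lj/(Mof j).
    * by rewrite !mulrA g_adj //; apply/modJS/Lj/(Mof j).
    (* The term g j * g k * c * g j with k = j.+1. As c commutes with g k, it is expanded once more;
       a letter g j.-1 in it produces the word of [closed_word_yxzy]. *)
    * rewrite mulrA [_ * (c * _)]mulrA -[_ * g j.+1 * c]mulrA -(bool_span_comm jj sc).
      have gj1 : M j.+1 (g j) by apply/modJ_of_span/bool_span_gen.
      case: j jk Lj Lg {kj jj} kN sv sc sa sb su sw Mof Lof gj1 => [|i] jk Lj Lg kN sv sc sa sb su sw Mof Lof gj1.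
        have [d ->] := sc; rewrite -scalerAl mul1r -scalerAr -scalerAl g_adj //.
        by apply/modJS/modJZ.
      have [a' [b' [c' [sa' sb' sc' ->]]]] := sc.
      have i2 : (i < i.+2 < N)%N by rewrite kN ltnW.
      have i1 : (i < i.+1 < N)%N by rewrite ltnSn /= ltnW.
      have Li := Lg i (ltnW (ltnSn _)); have ii : (i <= i.+2)%N by lia.
      rewrite mulrDl mulrDl !mulrDr !mulrDl; apply: modJD; first apply: modJD.
      -- rewrite mulrA -(bool_span_comm i1 sa') -!mulrA [g i.+1 * (_ * _)]mulrA g_adj //.
         by apply: modJS; apply: (Lof i a') gj1 => //; lia.
      -- rewrite -[g i * b' * _]mulrA (bool_span_comm i2 sb') -!mulrA.
         rewrite (bool_span_comm i1 sb') !mulrA.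
         apply: (@closed_word_yxzy (fun x => M i.+3 (x * b'))) => //.
         ++ by move=> x y Mx My; rewrite mulrDl; apply: modJD.
         ++ by move=> d x Mx; rewrite -scalerAl; apply: modJZ.
         ++ by move=> x Jx; apply: modJ_of_J; rewrite -[x]mul1r JM.
         ++ by move=> x Lx; apply/modJS/Lx/(Mof i).
         ++ by move=> x Lx; rewrite -mulrA; apply/modJ_genl/Lx/(Mof i).
         ++ move=> x Lx; rewrite -mulrA -(bool_span_comm i2 sb') mulrA.
            by apply/modJ_genr/Lx/(Mof i).
      -- have Lc : L i.+2 c' by apply: (Lof i).
         rewrite !mulrA -(bool_span_comm i1 sc') -!mulrA.
         have -> : g i.+1 * (g i * (g i.+2 * g i.+1)) = g i.+1 * g i * g i.+2 * g i.+1.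
           by rewrite !mulrA.
         apply: (@closed_word_yxzy (fun x => M i.+3 (c' * x))) => //.
         ++ by move=> x y Mx My; rewrite mulrDr; apply: modJD.
         ++ by move=> d x Mx; rewrite -scalerAr; apply: modJZ.
         ++ by move=> x Jx; apply: modJ_of_J; rewrite -[_ * x]mulr1 JM.
         ++ by move=> x Lx; apply/modJS/Lc/preserves_modJ.
         ++ move=> x Lx; rewrite mulrA (bool_span_comm i2 sc') -mulrA.
            by apply/modJ_genl/Lc/preserves_modJ.
         ++ by move=> x Lx; rewrite mulrA; apply/modJ_genr/Lc/preserves_modJ.
  + by rewrite mulrA; apply/modJ_genr/Lj/modJ_of_span.
Qed.

Lemma preserves_gen k : (k <= N)%N -> forall j, (j < k)%N -> L k (g j).
Proof.
elim: k => [|k IH] kN j //; apply: preserves_step => //.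
exact/IH/ltnW.
Qed.

Definition in_span (X : seq A) (s : A) : Prop :=
  exists c : nat -> K, s = \sum_(i < size X) c i *: X`_i.

Lemma in_spanD X s r : in_span X s -> in_span X r -> in_span X (s + r).
Proof.
move=> [c ->] [d ->]; exists (fun i => c i + d i); rewrite -big_split.
by apply: eq_bigr => i _; rewrite scalerDl.
Qed.

Lemma in_spanZ X c s : in_span X s -> in_span X (c *: s).
Proof.
move=> [d ->]; exists (fun i => c * d i); rewrite scaler_sumr.
by apply: eq_bigr => i _; rewrite scalerA.
Qed.

Lemma in_span_mem (X : seq A) x : x \in X -> in_span X x.
Proof.
move=> xX; exists (fun i => (i == index x X)%:R).
have lt : (index x X < size X)%N by rewrite index_mem.
rewrite (bigD1 (Ordinal lt)) //= eqxx scale1r nth_index // big1 ?addr0 //.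
by move=> i /negPf ni; rewrite -val_eqE /= in ni; rewrite ni scale0r.
Qed.

Lemma in_span_map (X Z : seq A) (f : A -> A) s :
  (forall x y, f (x + y) = f x + f y) -> (forall c x, f (c *: x) = c *: f x) ->
  {in X, forall x, in_span Z (f x)} -> in_span X s -> in_span Z (f s).
Proof.
move=> fD fZ H [c ->].
have f0 : f 0 = 0 by have := fZ 0 0; rewrite !scale0r.
elim/big_ind: _ => [|x y Hx Hy|i _].
- by exists (fun=> 0); rewrite f0 big1 // => i _; rewrite scale0r.
- by rewrite fD; apply: in_spanD.
- by rewrite fZ; apply: in_spanZ; apply: H; apply: mem_nth.
Qed.

(* Words in which every generator occurs at most once; [new_words k] are those
   containing the last of the first k generators. *)
Fixpoint words_pair (k : nat) : seq A * seq A :=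
  if k is m.+1 then
    let: (X, Y) := words_pair m in
    let Z := [seq g m * x | x <- X] ++ [seq y * g m | y <- Y] in (X ++ Z, Z)
  else ([:: 1], [::]).

Definition words k := (words_pair k).1.
Definition new_words k := (words_pair k).2.

Lemma wordsS k : words k.+1 = words k ++ new_words k.+1.
Proof. by rewrite /words /new_words /=; case: (words_pair k). Qed.

Lemma new_wordsS k : new_words k.+1 =
  [seq g k * x | x <- words k] ++ [seq y * g k | y <- new_words k].
Proof. by rewrite /words /new_words /=; case: (words_pair k). Qed.

Lemma words_span k x : x \in words k -> S k x.
Proof.
have [H _] : {in words k, forall x, S k x} /\ {in new_words k, forall x, S k x};
  last exact: H.
elim: k => [|k [IHX IHY]].
  by split=> y //; rewrite inE => /eqP ->; apply: bool_span1.
have HY : {in new_words k.+1, forall x, S k.+1 x}.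
  move=> y; rewrite new_wordsS mem_cat => /orP[/mapP[z /IHX sz ->]|/mapP[z /IHY sz ->]].
    by exists 0, z, 0; rewrite mul0r add0r addr0; split=> //; apply: bool_span0.
  by exists 0, 0, z; rewrite mulr0 !add0r; split=> //; apply: bool_span0.
split=> // y; rewrite wordsS mem_cat => /orP[/IHX|/HY //].
exact: bool_spanS.
Qed.

(** A product x * g k needs a word of its own only if x contains the previous generator; otherwise
    it equals g k * x. This is why [words_pair] multiplies only the new words on the right. *)
Lemma span_words k s : (k <= N)%N -> S k s -> in_span (words k) s.
Proof.
elim: k s => [|k IH] s kN.
  by move=> [c ->]; apply/in_spanZ/in_span_mem; rewrite mem_head.
move=> [u [v [w [su sv sw ->]]]]; have kN' := ltnW kN.
apply: in_spanD; first apply: in_spanD.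
- apply: (in_span_map (f := id)) (IH _ kN' su) => // x xX.
  by apply: in_span_mem; rewrite wordsS mem_cat xX.
- apply: (in_span_map (f := *%R (g k))) (IH _ kN' sv) => [x y|c x|x xX].
  + by rewrite mulrDr.
  + by rewrite scalerAr.
  + apply: in_span_mem; rewrite wordsS mem_cat new_wordsS mem_cat.
    by rewrite (map_f (fun z => g k * z)) // orbT.
- apply: (in_span_map (f := fun x => x * g k)) (IH _ kN' sw) => [x y|c x|x xX].
  + by rewrite mulrDl.
  + by rewrite scalerAl.
  apply: in_span_mem; rewrite wordsS mem_cat new_wordsS mem_cat.
  case: k kN {IH su sv sw kN'} xX => [|k] kN xX.
    move: xX; rewrite inE => /eqP ->; rewrite mul1r.
    have -> : g 0%N \in [seq g 0%N * x0 | x0 <- words 0]; last by rewrite orbT.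
    by apply/mapP; exists 1; rewrite ?mem_head ?mulr1.
  move: (xX); rewrite wordsS mem_cat => /orP[xX'|xY].
    rewrite (bool_span_comm (j := k.+1) _ (words_span xX')) ?ltnSn //.
    by rewrite (map_f (fun z => g k.+1 * z)) ?mem_cat ?xX' //= orbT.
  by rewrite [X in _ || (_ || X)](map_f (fun z => z * g k.+1)) // !orbT.
Qed.

Lemma size_words k : size (words k) = fib (2 * k + 1) /\ size (new_words k) = fib (2 * k).
Proof.
elim: k => [//|k [IHX IHY]].
have E : size (new_words k.+1) = fib (2 * k.+1).
  rewrite new_wordsS size_cat !size_map IHX IHY mulnS add2n addn1.
  by case: (2 * k)%N.
split=> //; rewrite wordsS size_cat E IHX mulnS add2n addn1.
by rewrite addn1 addnC.
Qed.

End Boolean.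

(** * The quotient algebra *)

Section TLFacts.
Variables (K : fieldType) (q : K).
Local Notation delta := (- (q + q^-1)).

Lemma TL_ind n (P : TL q n -> Prop) :
  (forall x y, P x -> P y -> P (x + y)) -> (forall c x, P x -> P (c *: x)) ->
  P 1 -> (forall i x, P x -> P (TL_gen q i * x)) -> forall x, P x.
Proof.
move=> PD PZ P1 PM x; rewrite -[x]alg_reprK.
move: (alg_repr x) => y.
have PW (s : seq 'I_n.-1) : P (alg_pi _ (<< FMonom s >> : free_alg K n.-1)).
  elim: s => [|i s IH].
    have -> : (<< FMonom [::] >> : free_alg K n.-1) = 1.
      by rewrite -[FMonom [::]]fmoneE.
    by rewrite rmorph1.
  have -> : (<< FMonom (i :: s) >> : free_alg K n.-1) = free_gen K i * << FMonom s >>.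
    rewrite free_genE free_mulE malgM_def fgmulUU mulr1.
    by congr (<< _ >>); apply: val_inj; rewrite /= fmM fmU.
  by rewrite rmorphM; apply: PM.
have -> : y = \sum_(k <- msupp y) y@_k *: (<< k >> : free_alg K n.-1).
  rewrite [LHS]monalgE; apply: eq_bigr => k _.
  by apply/malgP => w; rewrite mcoeffZ !mcoeffU mulr_natr.
rewrite raddf_sum; elim/big_ind: _ => [|u v Pu Pv|k _].
- by have := PZ 0 _ P1; rewrite scale0r.
- exact: (PD u v Pu Pv).
- have E : P (alg_pi (@TL_relators K q n) (y@_k *: (<< k >> : free_alg K n.-1))).
    by rewrite alg_piZ; apply: PZ; case: k => s; apply: PW.
  exact: E.
Qed.

Lemma TL_rep n (B : algType K) (b : 'I_n.-1 -> B) :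
  (forall i, b i * b i = delta *: b i) ->
  (forall i j : 'I_n.-1, (i.+1 == j) || (j.+1 == i) -> b i * b j * b i = b i) ->
  (forall i j : 'I_n.-1, (i.+1 < j)%N || (j.+1 < i)%N -> b i * b j = b j * b i) ->
  exists f : {lrmorphism TL q n -> B}, forall i, f (TL_gen q i) = b i.
Proof.
move=> b1 b2 b3.
pose g : {lrmorphism free_alg K n.-1 -> B} := free_eval b.
have gS := @TL_relators_vanish K q n B g b (free_eval_gen b) b1 b2 b3.
pose f : TL q n -> B := alg_lift g (S := @TL_relators K q n).
pose F : {lrmorphism TL q n -> B} := HB.pack f
  (GRing.isZmodMorphism.Build _ _ f (alg_lift_zmod gS))
  (GRing.isMonoidMorphism.Build _ _ f (alg_lift_monoid gS))
  (GRing.isScalable.Build K _ _ *:%R f (alg_lift_scalable gS)).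
exists F => i; rewrite /= /f /TL_gen (alg_lift_pi gS) /=.
exact: free_eval_gen.
Qed.

Lemma TL_aug n : exists f : {lrmorphism TL q n -> K^o}, forall i, f (TL_gen q i) = 0.
Proof.
by apply: TL_rep => [i|i j _|i j _]; rewrite ?mulr0 ?scaler0.
Qed.

Lemma map_jw4 (A B : algType K) (f : {lrmorphism A -> B}) x y z :
  f (jw4 delta x y z) = jw4 delta (f x) (f y) (f z).
Proof.
have fZ (c : K) (u : A) : f (c *: u) = c *: f u by rewrite linearZ.
have j2 : f (jw2 delta x) = jw2 delta (f x) by rewrite /jw2 rmorphB rmorph1 /= fZ.
have j3 : f (jw3 delta x y) = jw3 delta (f x) (f y).
  by rewrite /jw3 rmorphB /= fZ !rmorphM /= j2.
by rewrite /jw4 rmorphB /= fZ !rmorphM /= j3.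
Qed.

Hypotheses (d1 : delta != 0) (d2 : delta ^+ 2 - 1 != 0)
  (d3 : delta ^+ 3 - 2 * delta != 0).

Definition gen4 (i : nat) : TL q 4 := @TL_gen K q 4 (inord i : 'I_3).

Lemma gen4E (i : 'I_3) : @TL_gen K q 4 i = gen4 i.
Proof. by rewrite /gen4 inord_val. Qed.

Definition jwE : TL q 4 := jw4 delta (gen4 0) (gen4 1) (gen4 2).

Lemma gen4_sq i : gen4 i * gen4 i = delta *: gen4 i.
Proof. exact: TL_gen_sq. Qed.

Lemma gen4_adj i j : (i < 3)%N -> (j < 3)%N -> (i.+1 == j) || (j.+1 == i) ->
  gen4 i * gen4 j * gen4 i = gen4 i.
Proof. by move=> i3 j3 ij; apply: TL_gen_adj; rewrite !inordK. Qed.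

Lemma gen4_comm : gen4 0 * gen4 2 = gen4 2 * gen4 0.
Proof. by apply: TL_gen_comm; rewrite !inordK. Qed.

Lemma jwE_kill (i : 'I_3) : @TL_gen K q 4 i * jwE = 0 /\ jwE * @TL_gen K q 4 i = 0.
Proof.
have := (gen4_sq, gen4_comm); have := @gen4_adj => adj [sq comm].
rewrite gen4E; case: i => [[|[|[|//]]] i] /=.
- by rewrite x_jw4 ?jw4_x ?sq ?adj.
- by rewrite y_jw4 ?jw4_y ?sq ?adj.
- by rewrite z_jw4 ?jw4_z ?sq ?adj.
Qed.

Lemma jwE_neq0 : jwE != 0.
Proof.
have [f fg] := TL_aug 4; apply/eqP => /(congr1 f); rewrite rmorph0 map_jw4 !fg.
rewrite /jw4 /jw3 /jw2 !(mulr0, mul0r, scaler0, subr0) => /eqP.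
by rewrite oner_eq0.
Qed.

Lemma is_E4_jwE : is_E4 jwE.
Proof.
split; [exact: jwE_neq0| |exact: jwE_kill].
by apply: jw4_idem; rewrite ?gen4_sq ?gen4_adj ?gen4_comm.
Qed.

Lemma is_E4_E4 : is_E4 (E4 q).
Proof. by apply: (@xgetPex _ 0 [set E | is_E4 E]%classic); exists jwE; apply: is_E4_jwE. Qed.

Section Augmentation.
Variables (A : algType K) (T : Type) (gA : T -> A) (f : {lrmorphism A -> K^o}) (E : A).
Hypothesis fg : forall i, f (gA i) = 0.
Hypothesis indA : forall P : A -> Prop,
  (forall x y, P x -> P y -> P (x + y)) -> (forall c x, P x -> P (c *: x)) ->
  P 1 -> (forall i x, P x -> P (gA i * x)) -> forall x, P x.

Lemma kill_aug : (forall i, gA i * E = 0) -> forall x, x * E = (f x : K) *: E.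
Proof.
move=> gE; apply: indA => [x y Hx Hy|c x Hx||i x Hx].
- by rewrite mulrDl Hx Hy -scalerDl rmorphD.
- by rewrite -scalerAl Hx scalerA linearZ.
- by rewrite mul1r rmorph1 scale1r.
- by rewrite -mulrA Hx -scalerAr gE scaler0 rmorphM /= fg mul0r scale0r.
Qed.

Lemma aug_kill : (forall i, E * gA i = 0) -> forall x, E * x = (f x : K) *: E.
Proof.
move=> Eg; apply: indA => [x y Hx Hy|c x Hx||i x Hx].
- by rewrite mulrDr Hx Hy -scalerDl rmorphD.
- by rewrite -scalerAr Hx scalerA linearZ.
- by rewrite mulr1 rmorph1 scale1r.
- by rewrite mulrA Eg mul0r rmorphM /= fg mul0r scale0r.
Qed.

End Augmentation.

Lemma proportional (A : algType K) (E F : A) (a b : K) : E != 0 ->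
  E * E = a *: E -> E * E = E -> E * F = b *: E -> E * F = a *: F ->
  exists c : K, F = c *: E.
Proof.
move=> E0 EaE EE EbE EaF; have a0 : a != 0.
  by apply: contra_neq E0 => a0; rewrite -EE EaE a0 scale0r.
by exists (a^-1 * b); rewrite -scalerA -EbE EaF scalerA mulVf // scale1r.
Qed.

(** E_4 kills generators on its right and the Jones-Wenzl element kills them on its left, so the
    product E_4 * jwE is a multiple of each factor; idempotence of E_4 makes the relevant multiplier
    non-zero. Proportionality puts the explicit element into the ideal. *)
Lemma jwE_E4 : exists c : K, jwE = c *: E4 q.
Proof.
have [f fg] := TL_aug 4; have [E0 EE Eg] := is_E4_E4; have [_ _ jg] := is_E4_jwE.
have EgR := fun i => (Eg i).2; have jgL := fun i => (jg i).1.
have H1 := aug_kill fg (@TL_ind 4) EgR; have H2 := kill_aug fg (@TL_ind 4) jgL.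
exact: (proportional E0 (H1 _) EE (H1 _) (H2 _)).
Qed.

Section Quotient.
Variable n : nat.

Definition gen (i : nat) : TL q n :=
  if insub i is Some j then TL_gen q (j : 'I_n.-1) else 0.

Lemma genE (j : 'I_n.-1) : gen j = TL_gen q j.
Proof. by rewrite /gen valK. Qed.

Lemma gen_ord i (lt_in : (i < n.-1)%N) : gen i = TL_gen q (Ordinal lt_in).
Proof. exact: (genE (Ordinal lt_in)). Qed.

Lemma gen_sq i : (i < n.-1)%N -> gen i * gen i = delta *: gen i.
Proof. by move=> lt_in; rewrite !gen_ord TL_gen_sq. Qed.

Lemma gen_adj i : (i.+1 < n.-1)%N -> gen i * gen i.+1 * gen i = gen i.
Proof.
move=> lt_in; rewrite (gen_ord lt_in) (gen_ord (ltnW lt_in)) TL_gen_adj //=.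
by rewrite eqxx.
Qed.

Lemma gen_adj' i : (i.+1 < n.-1)%N -> gen i.+1 * gen i * gen i.+1 = gen i.+1.
Proof.
move=> lt_in; rewrite (gen_ord lt_in) (gen_ord (ltnW lt_in)) TL_gen_adj //=.
by rewrite eqxx orbT.
Qed.

Lemma gen_comm i j : (i.+1 < j < n.-1)%N -> gen i * gen j = gen j * gen i.
Proof.
case/andP=> ij jn; have lt_in : (i < n.-1)%N by lia.
by rewrite (gen_ord lt_in) (gen_ord jn) TL_gen_comm //= ij.
Qed.

Definition E4_set : set (TL q n) :=
  [set x : TL q n | exists h : (4 <= n)%N, x = TL_incl h (E4 q)]%classic.

Let J : {pred TL q n} := ideal_gen E4_set.

Lemma E4_ideal0 : 0 \in J.
Proof. by case: (ideal_gen_ideal E4_set) => H _ _; apply/ideal_genE. Qed.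

Lemma E4_idealD x y : x \in J -> y \in J -> x + y \in J.
Proof.
case: (ideal_gen_ideal E4_set) => _ H _ /ideal_genE Jx /ideal_genE Jy.
by apply/ideal_genE; apply: H.
Qed.

Lemma E4_idealM a x b : x \in J -> a * x * b \in J.
Proof. exact: ideal_genM. Qed.

Lemma jw4_ideal : (2 < n.-1)%N -> jw4 delta (gen 0) (gen 1) (gen 2) \in J.
Proof.
move=> n3; have h : (4 <= n)%N by lia.
have genI i : (i < 3)%N -> gen i = TL_incl h (gen4 i).
  move=> i3; rewrite /gen4 TL_incl_gen -genE; congr gen.
  by rewrite /= inordK.
rewrite !genI // -(map_jw4 (@TL_incl K q 4 n h)) -/jwE.
have [c ->] := jwE_E4; rewrite linearZ /=; apply: JZ => //.
  exact: E4_idealM.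
by apply: sub_ideal_gen; exists h.
Qed.

Hypothesis q0 : q != 0.

Lemma TL_spanned x : exists c : nat -> K,
  x - \sum_(i < fib (2 * n.-1 + 1)) c i *: (words gen n.-1)`_i \in J.
Proof.
have Lg := preserves_gen q0 d1 d2 d3 E4_ideal0 E4_idealD E4_idealM gen_sq gen_adj gen_adj'
  gen_comm jw4_ideal (leqnn n.-1).
have Mx : bool_modJ J gen n.-1 x.
  elim/TL_ind: x => [x y|c x||i x].
  - exact: modJD E4_idealD _ _ _ _.
  - exact: modJZ E4_idealM _ _ _ _.
  - by apply: modJ_of_span; [exact: E4_ideal0 | exact: bool_span1].
  - by rewrite -genE; apply: Lg.
have [s ss Js] := Mx.
have [c sc] := span_words gen_comm (leqnn n.-1) ss.
by exists c; move: Js; rewrite sc (size_words _ _).1.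
Qed.

End Quotient.

End TLFacts.

(** * The path representation and its image *)

Section Representation.
Variables (K : fieldType) (q : K).
Local Notation delta := (- (q + q^-1)).
Hypothesis delta_root : delta ^+ 4 - 3 * delta ^+ 2 + 1 = 0.
Variable n : nat.
Local Notation P := (paths 0 n).
Local Notation qdim := (qdim delta).
Local Notation cupcap := (cupcap delta).
Implicit Types (phi : seq nat -> K).

Lemma paths_pos : (0 < size P)%N.
Proof.
have [r rP _] : exists2 r, r \in P & last 0%N r = odd n.
  by apply: path_exists; case: (odd n) (odd_gt0 (n := n)) => //= ->.
by case: P rP.
Qed.

(** One less than the number of paths, so that the matrix size is a successor and the matrix algebra
    is non-zero by its type. *)
Definition rep_dim : nat := (size P).-1.
Local Notation I := 'I_rep_dim.+1.

Lemma rep_dimE : rep_dim.+1 = size P. Proof. by rewrite /rep_dim prednK // paths_pos. Qed.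

Definition pt (i : I) : seq nat := nth [::] P i.

Lemma pt_mem i : pt i \in P.
Proof. by rewrite mem_nth // -rep_dimE. Qed.

Lemma pt_inj : injective pt.
Proof.
move=> i j /eqP; rewrite nth_uniq ?paths_uniq // -?rep_dimE // => /eqP; exact: val_inj.
Qed.

Lemma pt_surj p : p \in P -> {i | pt i = p}.
Proof.
move=> pP; have lt : (index p P < rep_dim.+1)%N by rewrite rep_dimE index_mem.
by exists (Ordinal lt); rewrite /pt nth_index.
Qed.

Definition dirac (v : seq nat) : seq nat -> K := fun z => (z == v)%:R.

Definition op_mx (O : (seq nat -> K) -> seq nat -> K) : 'M[K]_rep_dim.+1 :=
  \matrix_(i, j) O (dirac (pt j)) (pt i).

(** The operators act on functions of arbitrary lists; locality says that values on P depend
    linearly on values on P, which makes [op_mx] multiplicative. *)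
Definition local_op (O : (seq nat -> K) -> seq nat -> K) : Prop :=
  forall phi p, p \in P -> O phi p = \sum_j phi (pt j) * O (dirac (pt j)) p.

Lemma dirac_expand phi p : p \in P -> phi p = \sum_j phi (pt j) * dirac (pt j) p.
Proof.
move=> /pt_surj[i <-]; rewrite (bigD1 i) //= /dirac eqxx mulr1 big1 ?addr0 // => j ji.
by rewrite (inj_eq pt_inj) eq_sym (negbTE ji) mulr0.
Qed.

Lemma op_mxM O1 O2 : local_op O1 -> op_mx O1 *m op_mx O2 = op_mx (fun phi => O1 (O2 phi)).
Proof.
move=> l1; apply/matrixP => i j; rewrite !mxE l1 ?pt_mem //.
by apply: eq_bigr => k _; rewrite !mxE mulrC.
Qed.

Lemma local_opM O1 O2 : local_op O1 -> local_op O2 -> local_op (fun phi => O1 (O2 phi)).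
Proof.
move=> l1 l2 phi p pP; rewrite l1 //.
under eq_bigr => j _ do rewrite (l2 _ _ (pt_mem j)) mulr_suml.
rewrite exchange_big; apply: eq_bigr => j _ /=.
by rewrite [in RHS]l1 // mulr_sumr; apply: eq_bigr => k _; rewrite mulrA.
Qed.

Lemma eq_op_mx O1 O2 : (forall phi p, p \in P -> O1 phi p = O2 phi p) ->
  op_mx O1 = op_mx O2.
Proof. by move=> H; apply/matrixP => i j; rewrite !mxE H ?pt_mem. Qed.

Lemma op_mxZ c O : op_mx (fun phi p => c * O phi p) = c *: op_mx O.
Proof. by apply/matrixP => i j; rewrite !mxE. Qed.

Lemma local_cupcap i : (i.+2 <= n)%N -> local_op (cupcap i).
Proof.
move=> le_in phi p pP; have: p \in P by []; rewrite mem_paths => /andP[/eqP sp vp].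
have [m nm] : exists m, n = m.+2 by exists n.-2; lia.
(* The factor 1 puts the expansion into the shape required by [cup_sum]. *)
have lin : cupcap i (fun z => 1 * \sum_(j <- enum I) (phi (pt j) * dirac (pt j) z)) p
    = \sum_j phi (pt j) * cupcap i (dirac (pt j)) p.
  transitivity (cup delta i 0 (fun z => 1 * \sum_(j <- enum I)
      (phi (pt j) * cap delta i 0 (dirac (pt j)) z)) p).
    congr (cup _ _ _ _ p); apply: funext => z; rewrite cap_scale cap_sum.
    by congr (_ * _); apply: eq_bigr => j _; rewrite cap_scale.
  rewrite cup_sum mul1r big_enum; apply: eq_bigr => j _.
  by rewrite cup_scale.
rewrite -lin; apply: (@eq_cup _ delta i 0 _ _ p m vp); first by rewrite sp.
move=> z; rewrite mem_paths => /andP[/eqP sz vz]; apply: eq_cap => // w.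
rewrite sz -nm => wP; rewrite mul1r big_enum; exact: dirac_expand.
Qed.

Definition rep_gen (i : nat) : 'M[K]_rep_dim.+1 := op_mx (cupcap i).

Lemma TL_path_rep : exists f : {lrmorphism TL q n -> 'M[K]_rep_dim.+1},
  forall i, f (TL_gen q i) = rep_gen i.
Proof.
apply: TL_rep => [i|i j ij|i j ij].
- have le_in : (i.+2 <= n)%N by have := ltn_ord i; lia.
  rewrite -[_ * _]/(_ *m _) op_mxM; last exact: local_cupcap.
  by rewrite -op_mxZ; apply: eq_op_mx => phi p pP; apply: cupcap_sq pP.
- have le_in : (i.+2 <= n)%N by have := ltn_ord i; lia.
  have le_jn : (j.+2 <= n)%N by have := ltn_ord j; lia.
  have li := local_cupcap le_in; have lj := local_cupcap le_jn.
  rewrite -![_ * _]/(_ *m _) op_mxM // op_mxM; last exact: local_opM.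
  case/orP: ij => /eqP ij; apply: eq_op_mx => phi p pP.
    by rewrite -ij; apply: cupcap_adj pP; rewrite ?ij.
  by rewrite -ij; apply: cupcap_adj' pP; rewrite ?ij.
- have le_in : (i.+2 <= n)%N by have := ltn_ord i; lia.
  have le_jn : (j.+2 <= n)%N by have := ltn_ord j; lia.
  have li := local_cupcap le_in; have lj := local_cupcap le_jn.
  rewrite -![_ * _]/(_ *m _) !op_mxM //; apply: eq_op_mx => phi p pP.
  by case/orP: ij => ij; [|symmetry]; apply: cupcap_far.
Qed.

(** Each column is a function on paths to which [cupcap_kernel] applies: no path of length above 3
    is straight. Applied to the image of E_4, it shows that this image is zero. *)
Lemma rep_kernel (V : 'M[K]_rep_dim.+1) : (3 < n)%N ->
  (forall i, (i < 3)%N -> rep_gen i *m V = 0) -> V = 0.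
Proof.
move=> n4 H; apply/matrixP => i j; rewrite [RHS]mxE.
pose phi p := \sum_k V k j * dirac (pt k) p.
have phiE k : phi (pt k) = V k j.
  rewrite /phi (bigD1 k) //= /dirac eqxx mulr1 big1 ?addr0 // => l lk.
  by rewrite (inj_eq pt_inj) eq_sym (negbTE lk) mulr0.
rewrite -phiE; apply: (cupcap_kernel delta_root n4) (pt_mem i) => k p k3 pP.
rewrite local_cupcap //; last by lia.
have [l <-] := pt_surj pP; have /matrixP/(_ l j) := H k k3; rewrite !mxE => E.
by rewrite -[RHS]E; apply: eq_bigr => o _; rewrite !mxE phiE mulrC.
Qed.

(* E_{p,p'} acts on the first m steps; it sends the path p' ++ r to p ++ r. *)
Definition unit_op (m : nat) (p p' : seq nat) phi : seq nat -> K :=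
  fun u => if take m u == p then phi (p' ++ drop m u) else 0.

Lemma swap_prefix m p p' u : (m <= n)%N -> u \in P -> take m u = p ->
  p' \in paths 0 m -> last 0%N p = last 0%N p' -> p' ++ drop m u \in P.
Proof.
move=> mn; rewrite !mem_paths => /andP[/eqP su vu] tu /andP[/eqP sp' vp'] ll.
move: vu; rewrite -{1}(cat_take_drop m u) tu /vpath !cat_path ll => /andP[_ ->].
by rewrite size_cat size_drop sp' su subnKC // eqxx /= andbT.
Qed.

Lemma local_unit m p p' : (m <= n)%N -> p' \in paths 0 m -> last 0%N p = last 0%N p' ->
  local_op (unit_op m p p').
Proof.
move=> mn p'm ll phi u uP; rewrite /unit_op; case: eqP => [tu|_].
  by apply: dirac_expand; apply: swap_prefix uP tu _ ll.
by rewrite big1 // => j _; rewrite mulr0.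
Qed.

(** The step of the basic construction: a generator placed between two matrix units gives a multiple
    of a matrix unit one step longer, whose added vertex t is the end of r. *)
Lemma unit_cupcap m p p' r s s' t phi u : (m.+1 < n)%N -> u \in P ->
  p \in paths 0 m.+1 -> p' \in paths 0 m.+1 -> r \in paths 0 m ->
  last 0%N r = t -> s' \in nbrs t ->
  unit_op m.+1 p (rcons r s) (cupcap m (unit_op m.+1 (rcons r s') p' phi)) u =
  qdim s / qdim t * unit_op m.+2 (rcons p t) (rcons p' t) phi u.
Proof.
move=> mn uP pm p'm rm lr st; rewrite /unit_op.
have su : size u = n by move: uP; rewrite mem_paths => /andP[/eqP].
have sp : size p = m.+1 by move: pm; rewrite mem_paths => /andP[/eqP].
have sr : size r = m by move: rm; rewrite mem_paths => /andP[/eqP].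
case Ed: (drop m.+1 u) => [|c z].
  by have := size_drop m.+1 u; rewrite Ed su /= => ?; lia.
have Etake : take m.+2 u = rcons (take m.+1 u) c.
  rewrite -{1}(cat_take_drop m.+1 u) Ed take_cat size_takel ?su ?(ltnW mn) //.
  by rewrite ltnNge leqnSn /= subSnn /= take0 cats1.
have Edrop : drop m.+2 u = z by rewrite -[m.+2]add1n -drop_drop Ed /= drop0.
rewrite Etake Edrop eqseq_rcons; case: eqP => [tu|_]; last by rewrite mulr0.
rewrite cat_rcons -sr cupcap_cat lr sr andTb.
case: eqP => [->|_]; last by rewrite mulr0.
rewrite cat_rcons -mulrA; congr (_ * (_ * _)).
have E b : take m.+1 (r ++ [:: b, t & z]) = rcons r b /\ drop m.+1 (r ++ [:: b, t & z]) = t :: z.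
  have sb : size (rcons r b) = m.+1 by rewrite size_rcons sr.
  by rewrite -cat_rcons -sb take_size_cat // drop_size_cat.
under eq_bigr => b _ do rewrite (E b).1 (E b).2 eqseq_rcons eqxx andTb eq_sym.
by rewrite (sum_nbrs_pick (fun=> phi (p' ++ t :: z))).
Qed.

Lemma unit_split m p p' phi u : (m < n)%N -> u \in P ->
  p \in paths 0 m -> last 0%N p = last 0%N p' ->
  unit_op m p p' phi u =
  \sum_(t <- nbrs (last 0%N p)) unit_op m.+1 (rcons p t) (rcons p' t) phi u.
Proof.
move=> mn uP pm ll; rewrite /unit_op.
have su : size u = n by move: uP; rewrite mem_paths => /andP[/eqP].
have vu : vpath 0 u by move: uP; rewrite mem_paths => /andP[_].
case Ed: (drop m u) => [|c z].
  by have := size_drop m u; rewrite Ed su /= => ?; lia.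
have Etake : take m.+1 u = rcons (take m u) c.
  rewrite -{1}(cat_take_drop m u) Ed take_cat size_takel ?su ?(ltnW mn) //.
  by rewrite ltnNge leqnSn /= subSnn /= take0 cats1.
have Edrop : drop m.+1 u = z by rewrite -[m.+1]add1n -drop_drop Ed /= drop0.
rewrite Etake Edrop; case: eqP => [tu|tu]; last first.
  by rewrite big1 // => t _; rewrite eqseq_rcons; case: eqP.
have cn : c \in nbrs (last 0%N p).
  move: vu; rewrite -(cat_take_drop m u) Ed tu /vpath cat_path /=.
  by case/and3P.
under eq_bigr => t _ do rewrite eqseq_rcons tu eqxx andTb cat_rcons.
by rewrite (sum_nbrs_pick (fun t => phi (p' ++ t :: z))).
Qed.

Section Image.
Variable f : {lrmorphism TL q n -> 'M[K]_rep_dim.+1}.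
Hypothesis f_gen : forall i, f (TL_gen q i) = rep_gen i.

Let im (X : 'M[K]_rep_dim.+1) : Prop := exists x, f x = X.

Let imM X Y : im X -> im Y -> im (X *m Y).
Proof. by move=> [x <-] [y <-]; exists (x * y); rewrite rmorphM. Qed.

Let imB X Y : im X -> im Y -> im (X - Y).
Proof. by move=> [x <-] [y <-]; exists (x - y); rewrite rmorphB. Qed.

Let imZ c X : im X -> im (c *: X).
Proof. by move=> [x <-]; exists (c *: x); rewrite linearZ. Qed.

Let im_gen i : (i.+2 <= n)%N -> im (rep_gen i).
Proof.
move=> le_in; have lt : (i < n.-1)%N by lia.
by exists (TL_gen q (Ordinal lt)); rewrite f_gen.
Qed.

(* A last step to t goes through unit_cupcap when some path of length m - 1 ends
   at t.  Otherwise both prefixes are the ascending path and t is its upper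
   neighbour; subtract the extension to the lower neighbour from the unit of
   length m. *)
Lemma unit_image m p p' : (m <= n)%N -> p \in paths 0 m -> p' \in paths 0 m ->
  last 0%N p = last 0%N p' -> im (op_mx (unit_op m p p')).
Proof.
elim: m p p' => [|m IH] p p' mn.
  rewrite !mem_paths => /andP[/nilP -> _] /andP[/nilP -> _] _.
  exists 1; rewrite rmorph1; apply/matrixP => i j; rewrite !mxE /unit_op take0 drop0 /=.
  by rewrite /dirac (inj_eq pt_inj).
case/lastP: p => [|o t] pm; first by rewrite mem_paths in pm.
case/lastP: p' => [|o' t'] pm'; first by rewrite mem_paths in pm'.
move: pm pm'; rewrite !mem_paths !size_rcons !eqSS /vpath !rcons_path.
move=> /andP[so /andP[vo ot]] /andP[so' /andP[vo' ot']].
rewrite !last_rcons => tt'; subst t'.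
have om : o \in paths 0 m by rewrite mem_paths so.
have om' : o' \in paths 0 m by rewrite mem_paths so'.
(* Writing s1, s2 for the ends of o1, o2, the unit from o2 to o1 extended by t1 is a multiple of
   E_{o1, r s1} f E_{r s2, o2}; both outer factors are in the image by induction. *)
have direct k o1 o2 t1 : m = k.+1 -> o1 \in paths 0 m -> o2 \in paths 0 m ->
    t1 \in nbrs (last 0%N o1) -> t1 \in nbrs (last 0%N o2) ->
    (exists2 r, r \in paths 0 k & last 0%N r = t1) ->
    im (op_mx (unit_op m.+1 (rcons o1 t1) (rcons o2 t1))).
  move=> ek o1m o2m o1t o2t [r rk lr]; subst m.
  have [_ t4 t1o1] := nbrsP o1t; have [_ _ t1o2] := nbrsP o2t; have [s4 _ _] := nbrsP o1t.
  have rP s : s \in nbrs t1 -> rcons r s \in paths 0 k.+1.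
    move=> st; move: rk; rewrite !mem_paths size_rcons eqSS => /andP[-> vr].
    by rewrite /vpath rcons_path lr st andbT.
  have r1 := rP _ t1o1; have r2 := rP _ t1o2.
  have E1 : im (op_mx (unit_op k.+1 o1 (rcons r (last 0%N o1)))).
    by apply: IH; rewrite ?last_rcons // ltnW.
  have E2 : im (op_mx (unit_op k.+1 (rcons r (last 0%N o2)) o2)).
    by apply: IH; rewrite ?last_rcons // ltnW.
  have := imZ (qdim t1 / qdim (last 0%N o1)) (imM E1 (imM (im_gen mn) E2)).
  rewrite op_mxM; last exact: local_cupcap.
  rewrite op_mxM; last by apply: local_unit; rewrite ?last_rcons // ltnW.
  rewrite -op_mxZ; congr (im _); apply: eq_op_mx => phi u uP.
  rewrite (@unit_cupcap k o1 o2 r _ _ t1) // mulrA.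
  have := qdim_neq0 delta_root s4; have := qdim_neq0 delta_root t4.
  by move=> a b; rewrite -[RHS]mul1r; congr (_ * _); field; rewrite a b.
have [lo bo] := last_vpath vo; have [lo' bo'] := last_vpath vo'.
move: so so' lo bo lo' bo' => /eqP so /eqP so'; rewrite so so' !add0n => lo bo lo' bo'.
case: (boolP ((0 < m)%N && (t <= m.-1)%N)) => [/andP[m0 tm]|].
  apply: (direct m.-1) => //; first by rewrite prednK.
  apply: path_exists => //; first by case: (nbrsP ot).
  case: (m) m0 lo => // k _; have [->|->] := nbrs_cases ot.
    by move=> /= ->; rewrite negbK.
  by move=> /= /(congr1 negb); rewrite !negbK => <-.
move=> far; have t4 : (t < 4)%N by case: (nbrsP ot).
(* Outside the direct case, parity and the bound by the length force the prefix to end at height m,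
   so it climbs straight and t lies one above. *)
have top_end w : t \in nbrs (last 0%N w) -> odd (last 0%N w) = odd m ->
    (last 0%N w <= m)%N -> last 0%N w = m /\ t = m.+1.
  move=> path_weight wo wb; have [et|et] := nbrs_cases path_weight; last first.
    by case/negP: far; rewrite et in wb; apply/andP; split; lia.
  suff em : last 0%N w = m by rewrite et em.
  rewrite et in far; apply/eqP; rewrite eqn_leq wb leqNgt; apply/negP => lt.
  case/negP: far; have m0 : (0 < m)%N by apply: leq_ltn_trans lt.
  rewrite m0 /=; case: (m) wo lt m0 => // k wo; rewrite ltnS leq_eqVlt => /orP[/eqP ek|//].
  by move: wo; rewrite ek /=; case: (odd k).
have [em et] := top_end _ ot lo bo; have [em' _] := top_end _ ot' lo' bo'.
have split_eq phi u : u \in P -> unit_op m o o' phi u =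
    \sum_(t0 <- nbrs m) unit_op m.+1 (rcons o t0) (rcons o' t0) phi u.
  by move=> uP; rewrite (unit_split _ mn) // ?em ?em'.
have imE := IH o o' (ltnW mn) om om' (etrans em (esym em')).
have ex : im (op_mx (unit_op m o o')) -> im (op_mx (unit_op m.+1 (rcons o t) (rcons o' t))).
  move=> _; case em0 : m imE split_eq => [|k].
    move=> imE0 split_eq0; rewrite et em0; congr (im _): imE0.
    by apply: eq_op_mx => phi u uP; rewrite split_eq0 // big_seq1.
  move=> imE1 split_eq1.
  have nbm : nbrs k.+1 = [:: k; k.+2].
    by move: t4; rewrite et em0; case: (k) => [|[|k']].
  have kt : k \in nbrs k.+1 by rewrite nbm mem_head.
  have dk : im (op_mx (unit_op k.+2 (rcons o k) (rcons o' k))).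
    have := @direct k o o' k em0 om om'; rewrite em em' em0; apply=> //.
    apply: path_exists => //; move: t4; rewrite et em0; lia.
  have := imB imE1 dk; congr (im _); apply/matrixP => i j; rewrite !mxE.
  by rewrite split_eq1 ?pt_mem // nbm !big_cons big_nil et em0 addr0 addrC addKr.
exact: ex.
Qed.

Lemma delta_image i j : last 0%N (pt i) = last 0%N (pt j) -> im (delta_mx i j).
Proof.
move=> lij; have := unit_image (leqnn n) (pt_mem i) (pt_mem j) lij.
congr (im _); apply/matrixP => k l; rewrite !mxE /unit_op.
have sz o : o \in P -> size o = n by rewrite mem_paths => /andP[/eqP].
rewrite take_oversize ?sz ?pt_mem // drop_oversize ?sz ?pt_mem // cats0.
by rewrite /dirac !(inj_eq pt_inj) [l == j]eq_sym; case: eqP.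
Qed.

(** A generator only changes an excursion inside the path and keeps its end, so all images are block
    diagonal with respect to endpoints. *)
Lemma rep_block x i j : last 0%N (pt i) <> last 0%N (pt j) -> f x i j = 0.
Proof.
elim/TL_ind: x i j => [x y Hx Hy|c x Hx||k x Hx] i j nij.
- by rewrite rmorphD mxE Hx // Hy // addr0.
- by rewrite linearZ mxE Hx // mulr0.
- by rewrite rmorph1 mxE; case: eqP nij => // ->.
have -> : f (TL_gen q k * x) = rep_gen k *m f x by rewrite -f_gen; apply: rmorphM.
rewrite mxE big1 // => l _.
case: (eqVneq (last 0%N (pt l)) (last 0%N (pt j))) => [lj|/eqP lj]; last by rewrite Hx // mulr0.
rewrite mxE; suff -> : cupcap k (dirac (pt l)) (pt i) = 0 by rewrite mul0r.
have si : size (pt i) = n by have := pt_mem i; rewrite mem_paths => /andP[/eqP].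
have kn : (k.+1 < n)%N by have := ltn_ord k; lia.
have sk : size (take k (pt i)) = k by rewrite size_takel // si; lia.
have := size_drop k (pt i); case Ed : (drop k (pt i)) => [|b [|c r]] /= sd; try lia.
rewrite -(cat_take_drop k (pt i)) -{1}sk Ed cupcap_cat; case: eqP => // _.
rewrite big1 ?mulr0 // => b' _; rewrite /dirac; case: eqP => // E.
case: nij; rewrite -lj -E -[in LHS](cat_take_drop k (pt i)) Ed !last_cat //.
Qed.

End Image.

End Representation.

Lemma mx2_fib n : (0 < n)%N -> (mx2 2 1 1 1 : 'M[nat]_2) ^+ n =
  mx2 (fib n.*2.+1) (fib n.*2) (fib n.*2) (fib n.*2.-1).
Proof.
case: n => // n _; elim: n => [|n IH]; first by rewrite expr1.
rewrite exprS IH; apply/matrixP => i j; rewrite !mxE !big_ord_recl big_ord0 !mxE /=.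
rewrite !doubleS /= !fibS.
case: i => [[|[|//]] ?]; case: j => [[|[|//]] ?]; rewrite /= ?mulr_natl ?mul1r ?addr0; first [ring | lia].
Qed.

(** * Dimension and semisimplicity of the quotient *)

Section Structure.
Variables (K : fieldType) (q : K) (n : nat).
Local Notation delta := (- (q + q^-1)).
Hypotheses (q0 : q != 0) (delta_root : delta ^+ 4 - 3 * delta ^+ 2 + 1 = 0).
Hypothesis n0 : (0 < n)%N.
Local Notation I := 'I_(rep_dim n).+1.
Local Notation h i := (last 0%N (pt i)).

Let d1 : delta != 0. Proof. exact: (qdim_neq0 delta_root (isT : (1 < 4)%N)). Qed.
Let d2 : delta ^+ 2 - 1 != 0.
Proof. exact: (qdim_neq0 delta_root (isT : (2 < 4)%N)). Qed.
Let d3 : delta ^+ 3 - 2 * delta != 0.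
Proof. exact: (qdim_neq0 delta_root (isT : (3 < 4)%N)). Qed.

Lemma card_pairs : #|[pred ij : I * I | h ij.1 == h ij.2]| = fib (2 * n - 1).
Proof.
rewrite -sum_path_count_sq // -(sum_last n (fun t => path_count 0 t n)).
have sumI (g : seq nat -> nat) : (\sum_(p <- paths 0 n) g p = \sum_(i : I) g (pt i))%N.
  rewrite (big_nth [::]) big_mkord; pose e := rep_dimE n.
  rewrite (reindex (cast_ord e)); first exact: eq_bigr.
  by exists (cast_ord (esym e)) => i _; rewrite ?cast_ordK ?cast_ordKV.
rewrite sumI -sum1_card.
transitivity (\sum_(ij : I * I) (h ij.1 == h ij.2 : nat))%N.
  by rewrite big_mkcond; apply: eq_bigr => ij _; rewrite inE; case: eqP.
rewrite -(pair_bigA _ (fun i j => (h i == h j : nat))) /=.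
apply: eq_bigr => i _; rewrite /path_count -sum1_count [RHS]big_mkcond.
apply: etrans (esym (sumI (fun p => if last 0%N p == h i then 1%N else 0%N))).
by apply: eq_bigr => j _; rewrite eq_sym; case: eqP.
Qed.

Variable f : {lrmorphism TL q n -> 'M[K]_((rep_dim n).+1)}.
Hypothesis f_gen : forall i, f (TL_gen q i) = rep_gen q n i.

Local Notation J := (ideal_gen (@E4_set K q n)).

Lemma rep_E4 x : x \in J -> f x = 0.
Proof.
apply: lift_ideal => _ [hn ->]; apply: (rep_kernel delta_root hn) => i i3.
have lt : (i < n.-1)%N by lia.
have [_ _ kill] := is_E4_E4 d1 d2 d3.
have [k3 _] := kill (Ordinal i3).
have -> : rep_gen q n i = f (@TL_incl K q 4 n hn (TL_gen q (Ordinal i3 : 'I_4.-1))).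
  by rewrite TL_incl_gen f_gen.
have E1 := rmorphM f (@TL_incl K q 4 n hn (TL_gen q (Ordinal i3 : 'I_4.-1)))
  (@TL_incl K q 4 n hn (E4 q)).
by rewrite -[LHS]E1 -(rmorphM (@TL_incl K q 4 n hn)) k3 !rmorph0.
Qed.

Let N := #|[pred ij : I * I | h ij.1 == h ij.2]|.

(** Coordinates inside the endpoint blocks; by [rep_block] they determine the whole matrix. *)
Definition entries (x : TL q n) : 'rV[K]_N :=
  \row_k f x (enum_val k).1 (enum_val k).2.

Lemma entries_linear : linear entries.
Proof. by move=> a x y; apply/rowP => k; rewrite !mxE linearP !mxE. Qed.

HB.instance Definition _ := GRing.isLinear.Build K (TL q n) 'rV[K]_N *:%R entries
  entries_linear.

Lemma rep_unit i j : h i = h j -> exists x, f x = delta_mx i j.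
Proof. exact: (delta_image delta_root f_gen). Qed.

Lemma rep_image (X : 'M[K]_((rep_dim n).+1)) : (forall i j, h i <> h j -> X i j = 0) ->
  exists x, f x = X.
Proof.
move=> X0; rewrite [X]matrix_sum_delta.
elim/big_ind: _ => [|_ _ [x <-] [y <-]|i _].
- by exists 0; rewrite rmorph0.
- by exists (x + y); rewrite rmorphD.
elim/big_ind: _ => [|_ _ [x <-] [y <-]|j _].
- by exists 0; rewrite rmorph0.
- by exists (x + y); rewrite rmorphD.
case: (eqVneq (h i) (h j)) => [/rep_unit[x <-]|/eqP/X0 ->].
  by exists (X i j *: x); rewrite linearZ.
by exists 0; rewrite rmorph0 scale0r.
Qed.

Lemma entries_surj y : exists x, entries x = y.
Proof.
have [|x fx] := @rep_image (\sum_k y 0 k *: delta_mx (enum_val k).1 (enum_val k).2).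
  move=> i j hij; rewrite summxE big1 // => k _; rewrite !mxE.
  have := enum_valP k; rewrite inE => /eqP hk.
  by case: eqP => [ei|]; case: eqP => [ej|]; rewrite ?mulr0 //; case: hij; rewrite ei ej.
exists x; apply/rowP => k; rewrite mxE fx summxE (bigD1 k) //= !mxE !eqxx mulr1.
rewrite big1 ?addr0 // => l lk; rewrite !mxE.
case: eqP => [e1|]; case: eqP => [e2|]; rewrite ?mulr0 //.
case/eqP: lk; apply: enum_val_inj; case: (enum_val l) (enum_val k) e1 e2 => a b [c d] /=.
by move=> -> ->.
Qed.

(* dim Q_n <= N by the spanning words and the entries map onto K^N, so its kernel
   is no larger than the ideal. *)
Lemma entries_ideal x : (x \in J) = (entries x == 0).
Proof.
apply/idP/eqP => [/rep_E4 fx|]; first by apply/rowP => k; rewrite !mxE fx mxE.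
pose W := \matrix_(i < N) entries (words (@gen K q n) n.-1)`_i.
have sz : fib (2 * n.-1 + 1) = N.
  by rewrite /N card_pairs; congr fib; lia.
have span y : exists c : 'rV_N, entries y = c *m W /\
    y - \sum_(i < N) c 0 i *: (words (@gen K q n) n.-1)`_i \in J.
  have [c] := TL_spanned d1 d2 d3 q0 y; rewrite sz => Jy.
  exists (\row_i c i); split; last by under eq_bigr => i _ do rewrite mxE.
  have : entries (y - \sum_(i < N) c i *: (words (@gen K q n) n.-1)`_i) = 0.
    by apply/rowP => k; rewrite !mxE (rep_E4 Jy) mxE.
  rewrite linearB /= => /eqP; rewrite subr_eq0 => /eqP ->.
  rewrite mulmx_sum_row linear_sum; apply: eq_bigr => i _.
  by rewrite linearZ /= mxE rowK.
(* There are N spanning words and their coordinates span K^N, so the square matrix W is invertible;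
   vanishing entries then force vanishing coefficients, which leaves x in the ideal. *)
have W_full : row_full W.
  apply/row_fullP; have [c cW] := choice (fun i => (entries_surj (row i 1%:M))).
  have [b bP] := choice (fun i => span (c i)).
  exists (\matrix_i b i); apply/row_matrixP => i; rewrite row_mul rowK.
  by have [<- _] := bP i; rewrite cW.
have [c [-> Jx]] := span x.
have W_free : row_free W by rewrite row_free_unit -row_full_unit.
move=> c0; have c00 : c = 0 by apply: (row_free_inj W_free); rewrite c0 mul0mx.
by move: Jx; rewrite c00 big1 ?subr0 // => i _; rewrite mxE scale0r.
Qed.

Lemma dimension_Q5 : dimension (Q5 q n) = fib (2 * n - 1).
Proof.
rewrite -card_pairs; apply: (dimension_quot (g := entries)) => [|x].
  exact: entries_surj.
exact: entries_ideal.
Qed.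

Definition rep5 (x : Q5 q n) : 'M[K]_((rep_dim n).+1) := f (alg_repr x).

Lemma rep5_pi x : rep5 (alg_pi _ x) = f x.
Proof.
apply/eqP; rewrite -subr_eq0 /rep5 -rmorphB; apply/eqP/rep_E4.
by rewrite -alg_pi_eq alg_reprK.
Qed.

Lemma rep5D x y : rep5 (x + y) = rep5 x + rep5 y.
Proof.
by rewrite -[x]alg_reprK -[y]alg_reprK -rmorphD !rep5_pi rmorphD.
Qed.

Lemma rep5M x y : rep5 (x * y) = rep5 x *m rep5 y.
Proof.
by rewrite -[x]alg_reprK -[y]alg_reprK -rmorphM !rep5_pi rmorphM.
Qed.

Lemma rep5_0 : rep5 0 = 0.
Proof. by have := rep5_pi 0; rewrite !rmorph0. Qed.

Lemma rep5_inj : injective rep5.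
Proof.
move=> x y; rewrite -[x]alg_reprK -[y]alg_reprK !rep5_pi => /eqP.
rewrite -subr_eq0 -rmorphB => /eqP fxy; apply/eqP; rewrite alg_pi_eq entries_ideal.
by apply/eqP/rowP => k; rewrite !mxE fxy mxE.
Qed.

Lemma rep5_block x i j : h i <> h j -> rep5 x i j = 0.
Proof. exact: (rep_block f_gen). Qed.

Lemma rep5_image (X : 'M[K]_((rep_dim n).+1)) : (forall i j, h i <> h j -> X i j = 0) ->
  exists x, rep5 x = X.
Proof. by move/rep_image => [x <-]; exists (alg_pi _ x); rewrite rep5_pi. Qed.

(** The left ideal of elements supported on column p; by the block shape it is a copy of the column
    space of the block of p. *)
Definition column_pred (p : I) : {pred (Q5 q n)^o} :=
  fun x => [forall i, [forall j, (j != p) ==> (rep5 x i j == 0)]].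

Lemma column_predP p x :
  reflect (forall i j, j != p -> rep5 x i j = 0) (x \in column_pred p).
Proof.
apply: (iffP forallP) => [H i j jp|H i].
  by have /forallP/(_ j) := H i; rewrite jp => /eqP.
by apply/forallP => j; apply/implyP => jp; rewrite H.
Qed.

Lemma column_closed p : submod_closed (column_pred p).
Proof.
split; first by apply/column_predP => i j _; rewrite rep5_0 mxE.
move=> a x y /column_predP Hx /column_predP Hy; apply/column_predP => i j jp.
rewrite -[a *: x]/(a * x) rep5D rep5M mxE Hy // addr0 mxE big1 // => k _.
by rewrite Hx // mulr0.
Qed.

Definition column_ideal p : submodule ((Q5 q n)^o : lmodType (Q5 q n)) :=
  Submodule (@column_closed p).

Lemma column_simple p : simple_submodule (column_ideal p).
Proof.
split.
  have [|e ep] := @rep5_image (delta_mx p p).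
    by move=> i j; rewrite mxE; case: eqP => [->|]; case: eqP => [->|].
  exists e; first by apply/column_predP => i j jp; rewrite ep mxE (negbTE jp) andbF.
  apply/eqP => e0; move/matrixP/(_ p p): ep; rewrite e0 rep5_0 !mxE !eqxx => /eqP.
  by rewrite eq_sym oner_eq0.
move=> W WU; case: (pselect (forall w, w \in submodule_pred W -> w = 0)); first by left.
move=> /existsNP[w /not_implyP[wW w0]]; right=> u /column_predP Hu.
have /column_predP Hw := WU _ wW.
have [k wk] : exists k, rep5 w k p != 0.
  apply/existsP; rewrite -[X in is_true X]negbK negb_exists; apply/negP => /forallP H.
  apply: w0; apply: rep5_inj; rewrite rep5_0; apply/matrixP => i j; rewrite [RHS]mxE.
  case: (eqVneq j p) => [->|/Hw //]; by have := H i; rewrite negbK => /eqP.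
have hk : h k = h p.
  by apply: contra_neq_eq wk => /eqP; apply: rep5_block.
(* The matrix with column p of u, divided by the entry (k, p) of w, placed in column k: it sends w
   to u, and it is block diagonal because k and p have the same endpoint. *)
have [|x xP] := @rep5_image (\matrix_(i, j) (if j == k then rep5 u i p / rep5 w k p else 0)).
  move=> i j hij; rewrite mxE; case: eqP => // jk; rewrite rep5_block ?mul0r //.
  by rewrite -hk -jk.
have -> : u = x *: (w : (Q5 q n)^o).
  apply: rep5_inj; rewrite -[x *: w]/(x * w) rep5M xP; apply/matrixP => i j.
  rewrite mxE (bigD1 k) //= mxE eqxx big1 ?addr0; last first.
    by move=> l lk; rewrite mxE (negbTE lk) mul0r.
  case: (eqVneq j p) => [->|jp]; first by rewrite divfK.
  by rewrite (Hu i j jp) (Hw k j jp) mulr0.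
have [W0 WP] := submodule_closed W.
by rewrite -[_ *: _]addr0; apply: WP.
Qed.

Lemma semisimple_Q5 : semisimple_ring (Q5 q n).
Proof.
exists (rep_dim n).+1, column_ideal; split; first exact: column_simple.
move=> x.
have unit_ex p : exists y : Q5 q n, rep5 y = delta_mx p p.
  by apply: rep5_image => i j; rewrite mxE; case: eqP => [->|]; case: eqP => [->|].
have [e eP] := choice unit_ex.
have col p y i j : rep5 (y * e p) i j = if j == p then rep5 y i p else 0.
  rewrite rep5M eP mxE (bigD1 p) //= mxE eqxx big1 ?addr0; last first.
    by move=> l lp; rewrite mxE (negbTE lp) mulr0.
  by case: eqP => _; rewrite ?mulr1 ?mulr0.
have rep5_sum (F : I -> Q5 q n) : rep5 (\sum_i F i) = \sum_i rep5 (F i).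
  by apply: big_morph; [exact: rep5D | exact: rep5_0].
exists [ffun p => x * e p]; split.
  split=> [p|].
    by apply/column_predP => i j jp; rewrite ffunE col (negbTE jp).
  apply: rep5_inj; rewrite rep5_sum; apply/matrixP => i j; rewrite summxE.
  rewrite (bigD1 j) //= ffunE col eqxx big1 ?addr0 // => p pj.
  by rewrite ffunE col eq_sym (negbTE pj).
move=> u [uU xu]; apply/ffunP => p; rewrite ffunE; apply: rep5_inj.
apply/matrixP => i j; rewrite col.
case: (eqVneq j p) => [->|jp]; last by have /column_predP -> := uU p.
rewrite xu rep5_sum summxE (bigD1 p) //= big1 ?addr0 // => k kp.
by have /column_predP -> := uU k; rewrite // eq_sym.
Qed.

End Structure.

(** The left side is q^-4 (1 + q^2 + q^4 + q^6 + q^8), the fifth cyclotomic polynomial at q^2 up to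
    a unit. *)
Lemma delta_root_of_order5 (K : fieldType) (q : K) : q != 0 ->
  5.-primitive_root (q ^+ 2) ->
  (- (q + q^-1)) ^+ 4 - 3 * (- (q + q^-1)) ^+ 2 + 1 = 0.
Proof.
move=> q0 prim; have := prim_expr_order prim; rewrite -exprM => q10.
have q2 : q ^+ 2 - 1 != 0.
  by rewrite subr_eq0 -[q ^+ 2]expr1 -(prim_order_dvd prim 1).
have cyclo : (q ^+ 2 - 1) * (1 + q ^+ 2 + q ^+ 4 + q ^+ 6 + q ^+ 8) = 0.
  by rewrite -[RHS](subrr (q ^+ (2 * 5))) {2}q10; ring.
move/eqP: cyclo; rewrite mulf_eq0 (negbTE q2) /= => /eqP cyclo.
by rewrite -(mul0r (q ^- 4)) -cyclo; field.
Qed.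

Theorem proposition6p2 (R : realType) (q : complex R)
    (q_neq0 : q != 0) (q2_order : 5.-primitive_root (q ^+ 2)) :
  (forall n : nat, (0 < n)%N ->
     mx2 (ell q 1 (2 * n + 1)) (ell q 2 (2 * n))
         (ell q 3 (2 * n + 1)) (ell q 0 (2 * n))
       = (mx2 2 1 1 1 : 'M[nat]_2) ^+ n
     /\ [/\ ell q 0 (2 * n) = fib (2 * n - 1),
            ell q 2 (2 * n) = fib (2 * n),
            ell q 1 (2 * n + 1) = fib (2 * n + 1)
          & ell q 3 (2 * n + 1) = fib (2 * n)])
  /\ (forall n : nat, (0 < n)%N ->
        semisimple_ring (Q5 q n) /\ dimension (Q5 q n) = fib (2 * n - 1)).
Proof.
have root := delta_root_of_order5 q_neq0 q2_order.
have ellE t n : (t < 4)%N -> (t <= n)%N -> odd t = odd n -> ell q t n = path_count 0 t n.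
  by move=> t4 tn otn; rewrite (ell_paths root t4 tn otn) size_filter.
split=> n n0; last first.
  have [f fg] := TL_path_rep root n.
  by split; [exact: (semisimple_Q5 q_neq0 root n0 fg)
            |exact: (dimension_Q5 q_neq0 root n0 fg)].
have [E0 E2 E1 E3] : [/\ ell q 0 (2 * n) = fib n.*2.-1, ell q 2 (2 * n) = fib n.*2,
    ell q 1 (2 * n + 1) = fib n.*2.+1 & ell q 3 (2 * n + 1) = fib n.*2].
  rewrite mul2n addn1; case: n n0 => // n _.
  (* After replacing n by n+1 the even length 2(n+1) has index n in [path_count0_even], whereas the
     odd length 2(n+1)+1 has index n+1 in [path_count0_odd]. *)
  have [h0 _ h2 _] := path_count0_even n; have [_ h1 _ h3] := path_count0_odd n.+1.
  by rewrite !ellE //= ?odd_double // doubleS in h1 h3 *; split.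
rewrite E0 E1 E2 E3 mx2_fib // mul2n addn1 subn1.
by split.
Qed.
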